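(* Let $f(t)=|t|^{\frac43}t$ (i.e. $f(t)=|t|^{q-2}t$ with $q=\frac{10}{3}$). Then there exists $a^*>0$ such that for every $a\in(0,a^*]$ the problem $$\Big(-u_{xx}+D_x^{-2}u_{yy}+\lambda u-f(u)\Big)_x=0 \text{ in } \mathbb{R}^2,\qquad \int_{\mathbb{R}^2}u^2\,dx\,dy=a^2,$$ has no nontrivial solution, i.e. there is no pair $(u,\lambda)\in S(a)\times\mathbb{R}$ which is a weak solution.
   Context: For $h:\mathbb{R}^2\to\mathbb{R}$ let $D_x^{-1}h(x,y)=\int_{-\infty}^x h(s,y)\,ds$. Let $Y=\{g_x: g\in C_0^\infty(\mathbb{R}^2)\}$ with inner product $\langle u,v\rangle_X=\int_{\mathbb{R}^2}(u_xv_x+D_x^{-1}u_y\,D_x^{-1}v_y+uv)\,dx\,dy$ and induced norm $\|\cdot\|$. The space $X$ consists of all $u:\mathbb{R}^2\to\mathbb{R}$ for which there is a sequence $(u_n)\subset Y$ with $u_n\to u$ a.e. and $\|u_j-u_k\|\to0$ as $j,k\to\infty$; it is a Hilbert space. Put $\langle u,v\rangle_0=\int_{\mathbb{R}^2}(u_xv_x+D_x^{-1}u_y\,D_x^{-1}v_y)\,dx\,dy$. For $a>0$, $S(a)=\{u\in X:\int_{\mathbb{R}^2}u^2=a^2\}$. A pair $(u,\lambda)\in S(a)\times\mathbb{R}$ is called a weak solution of the problem if $\langle u,\phi\rangle_0-\lambda\int_{\mathbb{R}^2}u\phi\,dx\,dy-\int_{\mathbb{R}^2}f(u)\phi\,dx\,dy=0$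 for all $\phi\in X$. *)

(* Defs.v *)
From HB Require Import structures.
From mathcomp Require Import all_boot all_order all_algebra.
From mathcomp Require Import all_classical all_reals all_analysis.
Set Implicit Arguments. Unset Strict Implicit. Unset Printing Implicit Defensive.
Import Order.TTheory GRing.Theory Num.Theory.
Import numFieldNormedType.Exports.
Local Open Scope classical_set_scope.
Local Open Scope ring_scope.

Section KP.
Variable R : realType.

Definition leb2 := (@lebesgue_measure R \x @lebesgue_measure R)%E.

Definition int2 (h : R * R -> R) : R := Rintegral leb2 setT h.

Definition px (h : R * R -> R) : R * R -> R :=
  fun p => derive1 (fun s => h (s, p.2)) p.1.
Definition py (h : R * R -> R) : R * R -> R :=
  fun p => derive1 (fun t => h (p.1, t)) p.2.

Fixpoint pd (l : seq bool) (h : R * R -> R) : R * R -> R :=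
  match l with
  | [::] => h
  | b :: l' => (if b then px else py) (pd l' h)
  end.

Definition C0inf (g : R * R -> R) : Prop :=
  (forall l, continuous (pd l g)) /\
  (forall l (p : R * R), derivable (fun s => pd l g (s, p.2)) p.1 1 /\
                         derivable (fun t => pd l g (p.1, t)) p.2 1) /\
  (exists M : R, forall p : R * R, (M < `|p.1| \/ M < `|p.2|) -> g p = 0).

Definition Dxinv (h : R * R -> R) : R * R -> R :=
  fun p => Rintegral (@lebesgue_measure R) [set s | s <= p.1] (fun s => h (s, p.2)).

(* <u,v>_0 and <u,v>_X, by the explicit integral formulas (used on Y) *)
Definition inner0 (u v : R * R -> R) : R :=
  int2 (fun p => px u p * px v p + Dxinv (py u) p * Dxinv (py v) p).
Definition innerX (u v : R * R -> R) : R := inner0 u v + int2 (fun p => u p * v p).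

Definition inY (u : R * R -> R) : Prop := exists g, C0inf g /\ u = px g.

Definition approxX (u : R * R -> R) (s : nat -> R * R -> R) : Prop :=
  (forall n, inY (s n)) /\
  {ae leb2, forall p, (fun n => s n p) @ \oo --> u p} /\
  (forall e : R, 0 < e -> exists N : nat, forall j k : nat, (N <= j)%N -> (N <= k)%N ->
     Num.sqrt (innerX (s j \- s k) (s j \- s k)) < e).

Definition inX (u : R * R -> R) : Prop := exists s, approxX u s.

(* <u,v>_0 for u, v in X, extended by continuity from Y:
   L is the value of <u,v>_0 *)
Definition inner0X (u v : R * R -> R) (L : R) : Prop :=
  exists s t, approxX u s /\ approxX v t /\
    (fun n => inner0 (s n) (t n)) @ \oo --> L.

Definition Sa (a : R) (u : R * R -> R) : Prop :=
  inX u /\ int2 (fun p => u p ^+ 2) = a ^+ 2.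

Definition weak_solution (f : R -> R) (a : R) (u : R * R -> R) (lam : R) : Prop :=
  Sa a u /\
  forall phi, inX phi -> forall L, inner0X u phi L ->
    L - lam * int2 (fun p => u p * phi p) - int2 (fun p => f (u p) * phi p) = 0.

Definition f43 (t : R) : R := (`|t| `^ (4 / 3)) * t.

End KP.

(* Main.v *)
(** Approximate [u] by [dx (g n)] with [g n] test functions, so that [g n] is an almost critical point of
    [J g = (A + B - lam m)/2 - int F43 (g_x)], where [A = |g_xx|^2], [B = |g_y|^2], [m = |g_x|^2], and put
    [Q = int |g_x|^(10/3)].  Testing [dJ] with [g] gives the Nehari identity [A + B - lam m = Q].
    Testing with [y g_y] and [x g_x] would give two Pohozaev identities, but these are not admissible:
    we use [sin (k y)/k] and [sin (k x)/k] times a symmetric difference quotient of step [h] and let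
    [n -> oo], then [h -> 0], then [k -> 0].  The quadratic terms telescope under translation.  In the
    nonlinear one, convexity of [F43] leaves a remainder that is [o(h)], by comparing the equation
    with its own translate.  The three identities eliminate [lam] and give [A + B = 3/5 Q] in the limit.

    On the other hand [int |w|^(4/3) w^2 <= e int w^4 + e^-2 int w^2] and the anisotropic estimate
    [int w^4 <= 4 |w_x|^2 |g_y| |w|] for [w = g_x] yield [Q <= (A + B) (4 |w| + |w|^2)], so that [A + B -> 0]
    when [a] is small.  Then [int g_n,x g_N,x = - int g_n,xx g_N -> 0] for fixed [N], while [g_n,x] is close to
    [g_N,x] in L^2 and has norm close to [a > 0]. *)
Require Import Defs.
From HB Require Import structures.
From mathcomp Require Import all_boot all_order all_algebra.
From mathcomp Require Import all_classical all_reals all_analysis.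
From mathcomp Require Import measurable_realfun.
From mathcomp Require Import ring lra.
Set Implicit Arguments. Unset Strict Implicit. Unset Printing Implicit Defensive.
Import Order.TTheory GRing.Theory Num.Theory.
Import numFieldNormedType.Exports.
Local Open Scope classical_set_scope.
Local Open Scope ring_scope.

(** * Continuous compactly supported functions on the plane *)
Section Integration.
Context {R : realType}.
Implicit Types (h k : R * R -> R).

(** The exponent 10/3 is the mass-critical one: u(x, y) -> t^(3/2) u(t x, t^2 y) preserves the mass
    and multiplies A, B and Q all by t^2. On g the generator is g/2 + x g_x + 2 y g_y, whence the
    weights 1/2, 1 and 2 with which the three identities combine so that [lam] cancels. The outcome
    A + B = 3/5 Q says that the energy vanishes, and since both sides scale alike, an estimate Q <=
    c(a) (A + B) with c(a) small rules it out for small mass, whatever [lam] is.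

    The obstacle is regularity: only g_xx, g_y and g_x are controlled in L^2, so x g_x and y g_y
    have no bound in X along the sequence. For fixed k and h their replacements are bounded
    uniformly in n, but the bound grows like 1/(h k); this forces the order of the limits. The
    nonlinear term must be differenced along y although g_xy is not controlled. There W = g(. + h) -
    g satisfies |W_x|^2 <= |W| |W_xx|, with |W| = O(h) from g_y and |W_xx| = o(1) from continuity of
    translations: this is the o(h) that survives division by h. *)

Lemma open2_measurable (A : set (R * R)) : open A -> measurable A.
Proof.
move=> oA.
pose box (a b c d : rat) : set (R * R) :=
  `]ratr a : R, ratr b[%classic `*` `]ratr c : R, ratr d[%classic.
(* Boxes not contained in [A] are replaced by the empty set, so that the union runs over all
   rational quadruples and stays countable. *)
pose U (a b c d : rat) := if `[< box a b c d `<=` A >] then box a b c d else set0.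
have -> : A = \bigcup_a \bigcup_b \bigcup_c \bigcup_d U a b c d.
  apply/seteqP; split => [[x y] Axy|p [a _ [b _ [c _ [d _]]]]]; last first.
    by rewrite /U; case: ifPn => // /asboolP; apply.
  have /= [e /= e0 eA] := (nbhs_ballP (x, y) A).1 (open_nbhs_nbhs (conj oA Axy)).
  have q (t : R) : exists2 r : rat * rat,
      ratr r.1 < t < ratr r.2 & (t - e < ratr r.1) && (ratr r.2 < t + e).
    have t1 : t - e < t by rewrite ltrBlDr ltrDl.
    have t2 : t < t + e by rewrite ltrDl.
    have [r1 /itvP r1P] := rat_in_itvoo t1.
    have [r2 /itvP r2P] := rat_in_itvoo t2.
    by exists (r1, r2); rewrite /= !(r1P, r2P).
  have [[a b] /= ab1 ab2] := q x; have [[c d] /= cd1 cd2] := q y.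
  exists a => //; exists b => //; exists c => //; exists d => //.
  rewrite /U ifT; first by split => /=; rewrite in_itv/=.
  apply/asboolP => -[s t] [/=]; rewrite !in_itv/= => st1 st2.
  by apply: eA; split; rewrite /ball/= ltr_norml; lra.
do 4 (apply: bigcupT_measurable_rat => ?).
rewrite /U; case: ifP => // _.
by apply: measurableX; exact: measurable_itv.
Qed.

Lemma continuous2_measurable h : continuous h -> measurable_fun setT h.
Proof.
move=> /continuousP ch; apply: (measurability _ (RGenOpens.measurableE R)).
by move=> _ [_ [a [b ->] <-]]; rewrite setTI; apply: open2_measurable; apply: ch; exact: interval_open.
Qed.

Definition Cc h := continuous h /\
  exists M : R, forall p : R * R, (M < `|p.1| \/ M < `|p.2|) -> h p = 0.

Notation sq M := (`[- M, M]%classic `*` `[- M, M]%classic).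

Lemma notin_sq (M : R) (p : R * R) : ~ (sq M : set (R * R)) p -> M < `|p.1| \/ M < `|p.2|.
Proof.
move=> np; have [h1|] := ltP M `|p.1|; first by left.
have [h2|] := ltP M `|p.2|; first by right.
rewrite !ler_norml => h2 h1; exfalso; apply: np.
by split => /=; rewrite in_itv/=.
Qed.

Lemma sq_measure (M : R) : 0 <= M ->
  @leb2 R (sq M) = ((2 * M) ^+ 2)%:E.
Proof.
move=> M0; rewrite /leb2 product_measure1E//= lebesgue_measure_itv/= lte_fin.
case: ltP => [_|h]; first by rewrite -EFinM; congr EFin; ring.
have M00 : M = 0.
  by apply/eqP; rewrite eq_le M0 andbT; lra.
by rewrite mule0 M00 mulr0 expr0n.
Qed.

Lemma Cc_bounded h : Cc h -> exists2 K : R, 0 <= K & forall p, `|h p| <= K.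
Proof.
move=> [ch [M hM]].
have : compact (h @` sq M).
  apply: continuous_compact; first exact: continuous_subspaceT.
  by apply: compact_setX; exact: segment_compact.
move=> /compact_bounded[K [_ Kb]].
exists (`|K| + 1) => [|p]; first by rewrite addr_ge0.
have [pM|/notin_sq/hM ->] := pselect ((sq M : set (R * R)) p); last first.
  by rewrite normr0 addr_ge0.
by apply: (Kb (`|K| + 1)); [rewrite (le_lt_trans (ler_norm _))// ltrDl|exists p].
Qed.

Lemma bounded_sq_integrable h (K M : R) : 0 <= M -> measurable_fun setT h ->
  (forall p, `|h p| <= K) -> (forall p, ~ (sq M : set (R * R)) p -> h p = 0) ->
  (@leb2 R).-integrable setT (EFin \o h) /\ `|int2 h| <= K * (2 * M) ^+ 2.
Proof.
move=> M0 mh hK hM.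
have msq : measurable (sq M : set (R * R)) by apply: measurableX; exact: measurable_itv.
have ih : (@leb2 R).-integrable (sq M) (EFin \o h).
  apply: measurable_bounded_integrable => //.
  - by change (@leb2 R (sq M) < +oo)%E; rewrite sq_measure// ltry.
  - exact: measurable_funS mh.
  - by exists K; split; rewrite ?num_real// => x Kx p _ /=; exact: le_trans (ltW Kx).
have hE : (EFin \o h) \_ (sq M) = EFin \o h.
  apply/funext => p; rewrite patchE; case: ifPn => // /negP pM /=; rewrite hM// => h'.
  by apply: pM; rewrite inE.
split; first by rewrite -hE -integrable_mkcond.
have -> : int2 h = Rintegral (@leb2 R) (sq M) h.
  by rewrite /int2 /Rintegral [in RHS]integral_mkcond hE.
apply: le_trans (le_normr_Rintegral _ _ ) _ => //.
apply: (@le_trans _ _ (Rintegral (@leb2 R) (sq M) (cst K))).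
  apply: le_Rintegral => //.
  - exact/integrable_norm.
  - by apply: measurable_bounded_integrable => //; [change (@leb2 R (sq M) < +oo)%E; rewrite sq_measure// ltry|exists `|K|; split; rewrite ?num_real// => x Kx p _ /=; exact: ltW].
rewrite Rintegral_cst//; change (K * fine (@leb2 R (sq M)) <= K * (2 * M) ^+ 2).
by rewrite sq_measure.
Qed.

Lemma Cc_ge0_support h : Cc h ->
  exists2 M : R, 0 <= M & forall p, ~ (sq M : set (R * R)) p -> h p = 0.
Proof.
move=> [_ [M hM]]; exists `|M| => // p /notin_sq np; apply: hM.
by have := ler_norm M; case: np => np; [left|right]; exact: le_lt_trans np.
Qed.

Lemma Cc_integrable h : Cc h -> (@leb2 R).-integrable setT (EFin \o h).
Proof.
move=> ch; have [M M0 hM] := Cc_ge0_support ch; have [K _ hK] := Cc_bounded ch.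
by have [] := bounded_sq_integrable M0 (continuous2_measurable ch.1) hK hM.
Qed.

Lemma int2_bound h (K M : R) : Cc h -> 0 <= M -> (forall p, `|h p| <= K) ->
  (forall p : R * R, (M < `|p.1| \/ M < `|p.2|) -> h p = 0) ->
  `|int2 h| <= K * (2 * M) ^+ 2.
Proof.
move=> ch M0 hK hM.
have hM' p : ~ (sq M : set (R * R)) p -> h p = 0 by move/notin_sq/hM.
by have [] := bounded_sq_integrable M0 (continuous2_measurable ch.1) hK hM'.
Qed.

Lemma int2D h k : Cc h -> Cc k -> int2 (fun p => h p + k p) = int2 h + int2 k.
Proof. by move=> ch ck; rewrite /int2 RintegralD//; exact: Cc_integrable. Qed.

Lemma int2B h k : Cc h -> Cc k -> int2 (fun p => h p - k p) = int2 h - int2 k.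
Proof. by move=> ch ck; rewrite /int2 RintegralB//; exact: Cc_integrable. Qed.

Lemma int2Z (a : R) h : Cc h -> int2 (fun p => a * h p) = a * int2 h.
Proof. by move=> ch; rewrite /int2 RintegralZl//; exact: Cc_integrable. Qed.

Lemma int2_ge0 h : (forall p, 0 <= h p) -> 0 <= int2 h.
Proof. by move=> h0; apply: Rintegral_ge0. Qed.

Lemma le_int2 h k : Cc h -> Cc k -> (forall p, h p <= k p) -> int2 h <= int2 k.
Proof. by move=> ch ck hk; apply: le_Rintegral => //; exact: Cc_integrable. Qed.

End Integration.

(** * Fubini and the fundamental theorem of calculus on slices *)

Section Fubini.
Context {R : realType}.
Implicit Types (h k : R * R -> R).
Notation mu := (@lebesgue_measure R).
Notation sq M := (`[- M, M]%classic `*` `[- M, M]%classic).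

Definition int1 (f : R -> R) : R := Rintegral mu setT f.

(** Wider than [Cc]: [anisotropic_product] applies Fubini to an integrand cut off along a horizontal
    line, which is measurable but not continuous. *)
Definition bnd_sq (M : R) h := [/\ measurable_fun setT h,
  exists K, forall p, `|h p| <= K & forall p, ~ (sq M : set (R * R)) p -> h p = 0].

Lemma Cc_bnd_sq h : Cc h -> exists2 M : R, 0 <= M & bnd_sq M h.
Proof.
move=> ch; have [M M0 hM] := Cc_ge0_support ch; have [K _ hK] := Cc_bounded ch.
by exists M => //; split => //; [exact: continuous2_measurable ch.1|exists K].
Qed.

Lemma bounded_itv_integrable (f : R -> R) (K M : R) : measurable_fun setT f ->
  (forall x, `|f x| <= K) -> (forall x, ~ (`[- M, M]%classic x) -> f x = 0) ->
  mu.-integrable setT (EFin \o f).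
Proof.
move=> mf fK fM.
have : mu.-integrable `[- M, M] (EFin \o f).
  apply: measurable_bounded_integrable => //.
  - exact: (compact_finite_measure (@segment_compact R (- M) M)).
  - exact: measurable_funS mf.
  - by exists K; split; rewrite ?num_real// => x Kx p _ /=; exact: le_trans (ltW Kx).
rewrite integrable_mkcond//; congr (mu.-integrable _ _); apply/funext => x.
by rewrite patchE; case: ifPn => // /negP h /=; rewrite fM// => h'; apply: h; rewrite inE.
Qed.

Lemma slice_integrable M h y : bnd_sq M h ->
  mu.-integrable setT (fun x => (h (x, y))%:E).
Proof.
move=> [mh [K hK] hM]; apply: (@bounded_itv_integrable (fun x => h (x, y)) K M) => //.
- exact: (measurableT_comp mh (pair2_measurable y)).
- by move=> x xM; apply: hM => -[].
Qed.

Lemma fubini_GE M h y : bnd_sq M h ->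
  fubini_G mu (EFin \o h) y = (int1 (fun x => h (x, y)))%:E.
Proof.
move=> bh; rewrite /fubini_G /int1 /Rintegral fineK//.
exact: (integrable_fin_num _ (slice_integrable y bh)).
Qed.

Lemma bnd_sq_integrable M h : 0 <= M -> bnd_sq M h ->
  (@leb2 R).-integrable setT (EFin \o h).
Proof. by move=> M0 [mh [K hK] hM]; have [] := bounded_sq_integrable M0 mh hK hM. Qed.

Lemma int1_integrable M h : 0 <= M -> bnd_sq M h ->
  mu.-integrable setT (EFin \o (fun y => int1 (fun x => h (x, y)))).
Proof.
move=> M0 bh; have [mh [K hK] hM] := bh.
have mG : measurable_fun setT (fun y => int1 (fun x => h (x, y))).
  apply/measurable_EFinP.
  rewrite [X in measurable_fun _ X](_ : _ = fubini_G mu (EFin \o h)).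
    exact: measurable_fubini_G (bnd_sq_integrable M0 bh).
  by apply/funext => y; rewrite (fubini_GE y bh).
have hcE y : int1 (fun x => h (x, y)) = Rintegral mu `[- M, M] (fun x => h (x, y)).
  rewrite /int1 [RHS]Rintegral_mkcond; congr Rintegral; apply/funext => x.
  rewrite patchE; case: ifPn => // /negP xM.
  by apply: hM => -[/= h1 _]; apply: xM; rewrite inE.
apply: (@bounded_itv_integrable _ (K * fine (mu `[- M, M])) M) => // y; last first.
  move=> yM; rewrite /int1 [X in Rintegral _ _ X](_ : _ = cst 0).
    by rewrite Rintegral_cst// mul0r.
  by apply/funext => x; apply: hM => -[].
rewrite hcE; apply: le_trans (le_normr_Rintegral _ _) _ => //.
  by apply: integrableS (slice_integrable y bh).
rewrite -Rintegral_cst//; apply: le_Rintegral => //.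
  by apply: integrable_norm; apply: integrableS (slice_integrable y bh).
apply: measurable_bounded_integrable => //.
  exact: (compact_finite_measure (@segment_compact R (- M) M)).
by exists `|K|; split; rewrite ?num_real// => x Kx p _ /=; exact: ltW.
Qed.

Lemma int2E21 M h : 0 <= M -> bnd_sq M h ->
  int2 h = int1 (fun y => int1 (fun x => h (x, y))).
Proof.
move=> M0 bh; rewrite /int2 /Rintegral -integral21_prod_meas1; last first.
  exact: bnd_sq_integrable bh.
by rewrite [RHS]/int1 /Rintegral; congr fine; apply: eq_integral => y _; exact: (fubini_GE y bh).
Qed.

Lemma bnd_sq_swap M h : bnd_sq M h -> bnd_sq M (fun p => h (p.2, p.1)).
Proof.
move=> [mh [K hK] hM]; split; last 1 first.
- by move=> [x y] xy; apply: hM => /= -[h1 h2]; apply: xy.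
- apply: (measurableT_comp mh); apply: measurable_fun_pair => //.
- by exists K.
Qed.

(** The inner integrals of the swapped function are those of [h] in the other order, and both orders
    give the double integral. This lets vertical statements be deduced from horizontal ones. *)
Lemma int2_swap M h : 0 <= M -> bnd_sq M h -> int2 (fun p => h (p.2, p.1)) = int2 h.
Proof.
move=> M0 bh; rewrite (int2E21 M0 (bnd_sq_swap bh))/=.
rewrite [in RHS]/int2 /Rintegral -integral12_prod_meas1; last exact: bnd_sq_integrable bh.
rewrite [LHS]/int1 /Rintegral; congr fine; apply: eq_integral => x _.
exact: esym (fubini_GE x (bnd_sq_swap bh)).
Qed.

Lemma int2E12 M h : 0 <= M -> bnd_sq M h ->
  int2 h = int1 (fun x => int1 (fun y => h (x, y))).
Proof.
by move=> M0 bh; rewrite -(int2_swap M0 bh) (int2E21 M0 (bnd_sq_swap bh)).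
Qed.

Lemma FTC2 (F f : R -> R) (a b : R) : a < b -> (forall x : R, is_derive x 1 F (f x)) ->
  continuous f -> Rintegral mu `[a, b] f = F b - F a.
Proof.
move=> ab dF cf; rewrite /Rintegral (@continuous_FTC2 _ f F a b)//.
- exact: continuous_subspaceT.
- split.
  + by move=> x _; case: (dF x).
  + apply: cvg_at_right_filter; apply: differentiable_continuous.
    by apply/derivable1_diffP; case: (dF a).
  + apply: cvg_at_left_filter; apply: differentiable_continuous.
    by apply/derivable1_diffP; case: (dF b).
- by move=> x _; rewrite derive1E; case: (dF x).
Qed.

Lemma FTC_Nyc (F f : R -> R) (M x : R) : (forall x : R, is_derive x 1 F (f x)) ->
  continuous f -> (forall x, M < `|x| -> F x = 0 /\ f x = 0) ->
  Rintegral mu [set s | s <= x] f = F x.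
Proof.
(* [a] lies left of both [x] and the support, so that F(a) = 0 and the half-line integral is the one
   over [a, x]. *)
move=> dF cf FM; pose a := - (`|M| + `|x| + 1).
have ax : a < x.
  by have := ler_norm (- x); rewrite normrN /a; have := normr_ge0 M; lra.
have Ma y : y <= a -> M < `|y|.
  by move=> ya; have := ler_norm (- y); rewrite normrN; have := ler_norm M;
    have := normr_ge0 x; rewrite /a in ya; lra.
have Fa : F a = 0 by apply: (FM _ _).1; exact: Ma.
rewrite -[RHS]subr0 -{1}Fa -(FTC2 ax dF cf) Rintegral_mkcond [RHS]Rintegral_mkcond.
congr Rintegral; apply/funext => y; rewrite !patchE.
case: ifPn => [|/negP yx].
  rewrite inE/= => yx; case: ifPn => // /negP; rewrite inE/= in_itv/= yx andbT => ya.
  by apply: (FM _ _).2; apply: Ma; rewrite leNgt; apply/negP => h; apply: ya; exact: ltW.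
case: ifPn => //; rewrite inE/= in_itv/= => /andP[_ h].
by exfalso; apply: yx; rewrite inE.
Qed.

Lemma int1_derive0 (F f : R -> R) (M : R) : (forall x : R, is_derive x 1 F (f x)) ->
  continuous f -> (forall x, M < `|x| -> F x = 0 /\ f x = 0) -> int1 f = 0.
Proof.
move=> dF cf FM; pose b := `|M| + 1.
have Mb : M < b by have := ler_norm M; rewrite /b; lra.
have b0 : 0 < b by rewrite /b; have := normr_ge0 M; lra.
have <- : F b = 0 by apply: (FM _ _).1; rewrite gtr0_norm.
rewrite -(FTC_Nyc b dF cf FM) [RHS]Rintegral_mkcond /int1.
congr Rintegral; apply/funext => y; rewrite !patchE; case: ifPn => // /negP yb.
apply: (FM _ _).2; apply: (lt_trans Mb); apply: (lt_le_trans _ (ler_norm y)).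
by rewrite ltNge; apply/negP => h; apply: yb; rewrite inE.
Qed.

Lemma slice1_continuous h y : continuous h -> continuous (fun x => h (x, y)).
Proof.
move=> ch x; apply: (@cvg_comp _ _ _ (fun x => (x, y)) h _ (nbhs (x, y))); last exact: ch.
apply: (@cvg_pair _ _ _ (nbhs x) (nbhs x) (nbhs y) _ _ _ id (cst y)); first exact: cvg_id.
exact: cvg_cst.
Qed.

Lemma slice2_continuous h x : continuous h -> continuous (fun y => h (x, y)).
Proof.
move=> ch y; apply: (@cvg_comp _ _ _ (fun y => (x, y)) h _ (nbhs (x, y))); last exact: ch.
apply: (@cvg_pair _ _ _ (nbhs y) (nbhs x) (nbhs y) _ _ _ (cst x) id); first exact: cvg_cst.
exact: cvg_id.
Qed.

Lemma swap_continuous2 h : continuous h -> continuous (fun p => h (p.2, p.1)).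
Proof.
move=> ch p; apply: (@cvg_comp _ _ _ (fun p : R * R => (p.2, p.1)) h _ (nbhs (p.2, p.1))); last exact: ch.
apply: (@cvg_pair _ _ _ (nbhs p) (nbhs p.2) (nbhs p.1) _ _ _ snd fst); [exact: cvg_snd|exact: cvg_fst].
Qed.

Lemma Cc_swap h : Cc h -> Cc (fun p => h (p.2, p.1)).
Proof.
move=> [ch [M hM]]; split; first exact: swap_continuous2.
by exists M => p /= [] ?; apply: hM; [right|left].
Qed.

Lemma int2_swapC h : Cc h -> int2 (fun p => h (p.2, p.1)) = int2 h.
Proof. by move=> /Cc_bnd_sq[M M0 bh]; exact: int2_swap bh. Qed.

(** A relation is used because [px] and [py] are total: an equation with them would not record
    differentiability. *)
Definition dX h k := forall p : R * R, is_derive p.1 1 (fun s => h (s, p.2)) (k p).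
Definition dY h k := forall p : R * R, is_derive p.2 1 (fun t => h (p.1, t)) (k p).

Lemma dX_swap h k : dY h k -> dX (fun p => h (p.2, p.1)) (fun p => k (p.2, p.1)).
Proof. by move=> hk [x y]/=; exact: (hk (y, x)). Qed.

Lemma Cc_common h k : Cc h -> Cc k ->
  exists2 M : R, 0 <= M & forall p, M < `|p.1| \/ M < `|p.2| -> h p = 0 /\ k p = 0.
Proof.
move=> [_ [M hM]] [_ [N kN]]; exists (`|M| + `|N|); first by rewrite addr_ge0.
move=> p hp; have := ler_norm M; have := ler_norm N.
have := normr_ge0 N; have := normr_ge0 M => M0 N0 N1 M1.
by case: hp => hp; (split; [apply: hM|apply: kN]); solve [left; lra|right; lra].
Qed.

Lemma int2_dX h k : Cc h -> Cc k -> dX h k -> int2 k = 0.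
Proof.
move=> ch ck hk; have [M M0 bk] := Cc_bnd_sq ck; rewrite (int2E21 M0 bk).
have [N N0 hN] := Cc_common ch ck.
rewrite /int1 [X in Rintegral _ _ X](_ : _ = cst 0).
  by rewrite Rintegral_cst// mul0r.
apply/funext => y; apply: (@int1_derive0 (fun x => h (x, y)) _ N).
- by move=> x; exact: (hk (x, y)).
- exact: slice1_continuous ck.1.
- by move=> x xN; apply: hN; left.
Qed.

End Fubini.

(** * Translation invariance and the anisotropic L^4 estimate *)

Section Calculus.
Context {R : realType}.
Implicit Types (h k : R * R -> R).
Notation mu := (@lebesgue_measure R).

Lemma CcD h k : Cc h -> Cc k -> Cc (fun p => h p + k p).
Proof.
move=> ch ck; split; first by move=> p; apply: cvgD; [exact: ch.1|exact: ck.1].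
by have [M _ hM] := Cc_common ch ck; exists M => p /hM[-> ->]; rewrite addr0.
Qed.

Lemma CcN h : Cc h -> Cc (fun p => - h p).
Proof.
move=> [ch [M hM]]; split; first by move=> p; apply: cvgN; exact: ch.
by exists M => p /hM ->; rewrite oppr0.
Qed.

Lemma CcB h k : Cc h -> Cc k -> Cc (fun p => h p - k p).
Proof. by move=> ch ck; apply: CcD => //; exact: CcN. Qed.

Lemma CcMl h k : Cc h -> continuous k -> Cc (fun p => h p * k p).
Proof.
move=> [ch [M hM]] ck; split; first by move=> p; apply: cvgM; [exact: ch|exact: ck].
by exists M => p /hM ->; rewrite mul0r.
Qed.

Lemma CcMr h k : continuous h -> Cc k -> Cc (fun p => h p * k p).
Proof.
move=> ch ck; rewrite (_ : (fun _ => _) = (fun p => k p * h p)); first exact: CcMl.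
by apply/funext => p; rewrite mulrC.
Qed.

Lemma CcZ (a : R) h : Cc h -> Cc (fun p => a * h p).
Proof. by move=> ch; apply: CcMr => // p; exact: cvg_cst. Qed.

Lemma Cc_comp (phi : R -> R) h : continuous phi -> phi 0 = 0 -> Cc h ->
  Cc (fun p => phi (h p)).
Proof.
move=> cphi phi0 [ch [M hM]]; split; last by exists M => p /hM ->.
by move=> p; apply: (@cvg_comp _ _ _ h phi _ (nbhs (h p))); [exact: ch|exact: cphi].
Qed.

Lemma Cc_norm h : Cc h -> Cc (fun p => `|h p|).
Proof. by apply: Cc_comp; [exact: norm_continuous|exact: normr0]. Qed.

Lemma Cc_sqr h : Cc h -> Cc (fun p => h p ^+ 2).
Proof. by move=> ch; apply: (CcMl ch ch.1). Qed.

Lemma ler_norm_int2 h : Cc h -> `|int2 h| <= int2 (fun p => `|h p|).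
Proof. by move=> ch; apply: le_normr_Rintegral => //; exact: Cc_integrable. Qed.

Definition tx (a : R) h := fun p : R * R => h (p.1 + a, p.2).
Definition ty (a : R) h := fun p : R * R => h (p.1, p.2 + a).

Lemma tx_continuous a h : continuous h -> continuous (tx a h).
Proof.
move=> ch p.
apply: (@cvg_comp _ _ _ (fun p : R * R => (p.1 + a, p.2)) h _ (nbhs (p.1 + a, p.2)));
  last exact: ch.
apply: (@cvg_pair _ _ _ (nbhs p) (nbhs (p.1 + a)) (nbhs p.2) _ _ _ (fun p => p.1 + a) snd).
  by apply: cvgD; [exact: cvg_fst|exact: cvg_cst].
exact: cvg_snd.
Qed.

Lemma Cc_tx a h : Cc h -> Cc (tx a h).
Proof.
move=> [ch [M hM]]; split; first exact: tx_continuous.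
exists (M + `|a|) => p hp; apply: hM => /=.
have := ler_normD (p.1 + a) (- a); rewrite addrK normrN => h1.
by have := normr_ge0 a; case: hp => hp; [left|right]; lra.
Qed.

Lemma ty_swap a h : ty a h = (fun p => tx a (fun p => h (p.2, p.1)) (p.2, p.1)).
Proof. by []. Qed.

Lemma Cc_ty a h : Cc h -> Cc (ty a h).
Proof. by move=> ch; rewrite ty_swap; apply: Cc_swap; apply: Cc_tx; exact: Cc_swap. Qed.

Lemma int1_shift (f : R -> R) (a : R) : continuous f -> (forall x, 0 <= f x) ->
  int1 (fun x => f (x + a)) = int1 f.
Proof.
move=> cf f0.
have dF (x : R) : is_derive x 1 (fun t : R => t + a) 1.
  by rewrite -[X in is_derive _ _ _ X]addr0; apply: is_deriveD.
have F' : (fun t : R => t + a)^`()%classic = cst 1.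
  by apply/funext => x; rewrite derive1E; case: (dF x).
rewrite /int1 /Rintegral; congr fine.
rewrite [RHS](@increasing_ge0_integration_by_substitutionT R (fun t => t + a)) //.
- by apply: eq_integral => x _; rewrite F' /= mulr1.
- by move=> x y; rewrite ltrD2r.
- by rewrite F'; exact: cst_continuous.
- by rewrite F'; exact: is_cvg_cst.
- by rewrite F'; exact: is_cvg_cst.
- apply/cvgrNyPle => A; near=> x; rewrite -lerBrDr; near: x.
  by apply: nbhs_ninfty_le; exact: num_real.
- apply/cvgryPge => A; near=> x; rewrite -lerBlDr; near: x.
  by apply: nbhs_pinfty_ge; exact: num_real.
Unshelve. all: by end_near. Qed.

Lemma int2_tx a h : Cc h -> int2 (tx a h) = int2 h.
Proof.
have nn k : Cc k -> (forall p, 0 <= k p) -> int2 (tx a k) = int2 k.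
  move=> ck k0; have [M M0 bk] := Cc_bnd_sq ck.
  have [N N0 bN] := Cc_bnd_sq (Cc_tx a ck).
  rewrite (int2E21 M0 bk) (int2E21 N0 bN); congr int1; apply/funext => y.
  rewrite /tx/= (@int1_shift (fun x => k (x, y))) //.
  exact: slice1_continuous ck.1.
move=> ch.
(* The substitution above is for nonnegative integrands, so [h] is written as |h| - (|h| - h). *)
have c1 := Cc_norm ch; have c2 := CcB c1 ch.
have -> : int2 h = int2 (fun p => `|h p|) - int2 (fun p => `|h p| - h p).
  by rewrite -int2B//; congr int2; apply/funext => p; rewrite subKr.
rewrite -[in RHS](nn _ c1)// -[in RHS](nn _ c2) => [|p]; last by rewrite subr_ge0 ler_norm.
rewrite -int2B; [|exact: Cc_tx|exact: Cc_tx].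
by congr int2; apply/funext => p; rewrite /tx subKr.
Qed.

Lemma int2_ty a h : Cc h -> int2 (ty a h) = int2 h.
Proof.
move=> ch; rewrite ty_swap int2_swapC; last by apply: Cc_tx; exact: Cc_swap.
by rewrite int2_tx ?int2_swapC//; exact: Cc_swap.
Qed.

Lemma is_derive_sqr (f : R -> R) (x a : R) : is_derive x 1 f a ->
  is_derive x 1 (fun t => f t ^+ 2) (2 * (f x * a)).
Proof.
move=> fa; have -> : (fun t => f t ^+ 2) = f * f by [].
have := is_deriveM fa fa; congr is_derive; rewrite /GRing.scale/=; ring.
Qed.

(* The two factors are bounded slice by slice: [sup_x w^2 <= 2 int |w w_x| dx] on each horizontal line, and
   [sup_y int p^2 dx <= 2 |int2 (p_x v)|] because [p_y = v_x]. *)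
Lemma anisotropic_product h v q r w z :
  Cc h -> Cc v -> Cc q -> Cc r -> Cc w -> Cc z ->
  dX h q -> dY h r -> dX v r -> dX w z ->
  int2 (fun p => h p ^+ 2 * w p ^+ 2) <=
  4 * (int2 (fun p => `|q p * v p|) * int2 (fun p => `|w p * z p|)).
Proof.
move=> ch cv cq cr cw cz hq hr vr wz.
pose C := 2 * int2 (fun p => `|q p * v p|).
have cqv : Cc (fun p => `|q p * v p|) by apply/Cc_norm/CcMl => //; exact: cv.1.
have chr : Cc (fun p => h p * r p) by apply: CcMl => //; exact: cr.1.
have cqv' : Cc (fun p => q p * v p) by apply: CcMl => //; exact: cv.1.
have cwz : Cc (fun p => `|w p * z p|) by apply/Cc_norm/CcMl => //; exact: cz.1.
have cwz' : Cc (fun p => w p * z p) by apply: CcMl => //; exact: cz.1.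
have C0 : 0 <= C by rewrite mulr_ge0//; apply: int2_ge0.
have m_le y : int1 (fun x => h (x, y) ^+ 2) <= C.
  (* 2 h r is the vertical derivative of h^2. Cutting it off at height [y] and integrating
     vertically first gives h(x, y)^2; integrating horizontally first gives the bound. *)
  pose H := fun p : R * R => if p.2 <= y then 2 * (h p * r p) else 0.
  have [M M0 [mhr [K hK] hM]] := Cc_bnd_sq (CcZ 2 chr).
  have bH : bnd_sq M H.
    split.
    - apply: measurable_fun_ifT => //.
      by apply: measurable_fun_ler => //; exact: measurable_snd.
    - exists K => p; rewrite /H; case: ifP => // _; rewrite normr0.
      exact: le_trans (hK p).
    - by move=> p /hM ?; rewrite /H; case: ifP.
  have -> : int1 (fun x => h (x, y) ^+ 2) = int2 H.
    rewrite (int2E12 M0 bH); congr int1; apply/funext => x.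
    have [N N0 hN] := Cc_common ch (CcZ 2 chr).
    have d (t : R) : is_derive t 1 (fun t => h (x, t) ^+ 2) (2 * (h (x, t) * r (x, t))).
      by apply: is_derive_sqr; exact: (hr (x, t)).
    rewrite -(@FTC_Nyc _ (fun t => h (x, t) ^+ 2) (fun t => 2 * (h (x, t) * r (x, t))) N y); last 2 first.
    - exact: (slice2_continuous (CcZ 2 chr).1).
    - by move=> t tN; have [|-> ->] := hN (x, t); [right|rewrite expr0n].
    rewrite Rintegral_mkcond /int1; congr Rintegral; apply/funext => t.
    rewrite patchE /H/=; have -> // : (t \in [set s | s <= y]) = (t <= y).
    by apply/idP/idP; rewrite inE.
  have [M' M'0 bqv] := Cc_bnd_sq (CcZ 2 cqv).
  rewrite /C -(int2Z _ cqv) (int2E21 M0 bH) (int2E21 M'0 bqv).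
  apply: le_Rintegral => //; [exact: (int1_integrable M0 bH)|exact: (int1_integrable M'0 bqv)|].
  move=> t _.
  have i1 : mu.-integrable setT (fun x => (2 * `|q (x, t) * v (x, t)|)%:E).
    exact: slice_integrable bqv.
  case: (leP t y) => ty; last first.
    rewrite [X in X <= _](_ : _ = 0).
      by apply: Rintegral_ge0 => x _; rewrite mulr_ge0.
    rewrite /int1 [X in Rintegral _ _ X](_ : _ = cst 0) ?Rintegral_cst ?mul0r//.
    by apply/funext => x; rewrite /H/= leNgt ty.
  have [M1 M10 bqv1] := Cc_bnd_sq (CcZ (-2) cqv').
  have [M2 M20 bqv2] := Cc_bnd_sq (CcZ 2 (CcD cqv' chr)).
  have i2 : mu.-integrable setT (fun x => (-2 * (q (x, t) * v (x, t)))%:E).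
    exact: slice_integrable bqv1.
  have i3 : mu.-integrable setT (fun x => (2 * (q (x, t) * v (x, t) + h (x, t) * r (x, t)))%:E).
    exact: slice_integrable bqv2.
  have -> : int1 (fun x => H (x, t)) = int1 (fun x => -2 * (q (x, t) * v (x, t))).
    (* [r] is also the horizontal derivative of [v], so q v + h r = (h v)_x has integral zero on
       every line and h r can be traded for - q v. *)
    have e0 : int1 (fun x => 2 * (q (x, t) * v (x, t) + h (x, t) * r (x, t))) = 0.
      have chv : Cc (fun p => 2 * (h p * v p)) by apply/CcZ/CcMl => //; exact: cv.1.
      have [N N0 hN] := Cc_common chv (CcZ 2 (CcD cqv' chr)).
      apply: (@int1_derive0 _ (fun x => 2 * (h (x, t) * v (x, t))) _ N).
      - move=> x; have := is_deriveM (hq (x, t)) (vr (x, t)) => /= /(is_deriveZ 2).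
        have -> : 2 \*: ((fun s => h (s, t)) * (fun s => v (s, t))) =
          (fun x0 => 2 * (h (x0, t) * v (x0, t))) by [].
        by congr is_derive; rewrite /GRing.scale/=; ring.
      - exact: (slice1_continuous (CcZ 2 (CcD cqv' chr)).1).
      - by move=> x xN; apply: hN; left.
    rewrite -[LHS]addr0 -[RHS]addr0 -{2}e0 -RintegralD//.
    rewrite addr0; congr Rintegral; apply/funext => x /=; rewrite /H/= ty; ring.
  apply: le_Rintegral => // x _; have := ler_norm (- (q (x, t) * v (x, t))); rewrite normrN; lra.
pose S y := int1 (fun x => 2 * `|w (x, y) * z (x, y)|).
have S_le x y : w (x, y) ^+ 2 <= S y.
  have [N N0 hN] := Cc_common cw (CcZ 2 cwz').
  have [M1 M10 b1] := Cc_bnd_sq (CcZ 2 cwz).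
  have [M2 M20 b2] := Cc_bnd_sq (CcZ 2 cwz').
  have d (t : R) : is_derive t 1 (fun t => w (t, y) ^+ 2) (2 * (w (t, y) * z (t, y))).
    by apply: is_derive_sqr; exact: (wz (t, y)).
  rewrite -(@FTC_Nyc _ (fun t => w (t, y) ^+ 2) (fun t => 2 * (w (t, y) * z (t, y))) N x); last 2 first.
  - exact: (slice1_continuous (CcZ 2 cwz').1).
  - by move=> t tN; have [|-> ->] := hN (t, y); [left|rewrite expr0n].
  rewrite Rintegral_mkcond; apply: le_Rintegral => //.
    + have -> : (EFin \o patch (fun=> 0) [set s : R | s <= x] (fun t => 2 * (w (t, y) * z (t, y))))
        = (fun t => (2 * (w (t, y) * z (t, y)))%:E) \_ [set s : R | s <= x].
        by rewrite restrict_EFin.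
      rewrite -integrable_mkcond//; last by rewrite -set_itvNyc.
      by apply: integrableS (slice_integrable y b2) => //; rewrite -set_itvNyc.
    + exact: (slice_integrable y b1).
    + move=> t _; rewrite patchE; case: ifP => _ /=; last by rewrite mulr_ge0.
      by apply: ler_wpM2l => //; exact: ler_norm.
have chw : Cc (fun p => h p ^+ 2 * w p ^+ 2).
  by apply: CcMl; [exact: Cc_sqr|exact: (Cc_sqr cw).1].
have [M M0 bhw] := Cc_bnd_sq chw; have [N N0 bS] := Cc_bnd_sq (CcZ 2 cwz).
have [L L0 bh2] := Cc_bnd_sq (Cc_sqr ch).
have -> : 4 * (int2 (fun p => `|q p * v p|) * int2 (fun p => `|w p * z p|)) =
  C * int2 (fun p => 2 * `|w p * z p|) by rewrite int2Z// /C; ring.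
rewrite (int2E21 M0 bhw) (int2E21 N0 bS) -/S -RintegralZl//; last exact: (int1_integrable N0 bS).
apply: le_Rintegral => //.
- exact: (int1_integrable M0 bhw).
- exact: (integrableZl _ _ (int1_integrable N0 bS)).
move=> y _; apply: (@le_trans _ _ (int1 (fun x => h (x, y) ^+ 2 * S y))).
  apply: le_Rintegral => //; first exact: (slice_integrable y bhw).
    rewrite [X in mu.-integrable _ X](_ : _ = (fun x => ((S y)%:E * (h (x, y) ^+ 2)%:E)%E)).
      exact: (integrableZl _ _ (slice_integrable y bh2)).
    by apply/funext => x; rewrite -EFinM mulrC.
  by move=> x _; apply: ler_wpM2l; [exact: sqr_ge0|exact: S_le].
rewrite /int1 RintegralZr//; last exact: (slice_integrable y bh2).
apply: ler_wpM2r; last exact: m_le.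
by apply: Rintegral_ge0 => x _; rewrite mulr_ge0.
Qed.

End Calculus.

(** * Smooth functions *)
Section Smooth.
Context {R : realType}.
Implicit Types (g h k : R * R -> R).

Lemma is_derive_continuous (f : R -> R) (x a : R) : is_derive x 1 f a -> {for x, continuous f}.
Proof.
by move=> fa; apply: differentiable_continuous; apply/derivable1_diffP; case: fa.
Qed.

Lemma MVT1 (f df : R -> R) (a b : R) : (forall x : R, is_derive x 1 f (df x)) -> a < b ->
  exists2 c, a < c < b & f b - f a = df c * (b - a).
Proof.
move=> dF ab; have cf : {within `[a, b], continuous f}.
  by apply: continuous_subspaceT => x; exact: (is_derive_continuous (dF x)).
by have [c cab E] := MVT ab (fun x _ => dF x) cf; exists c.
Qed.

Lemma MVT_le (f df : R -> R) (K a b : R) : (forall x : R, is_derive x 1 f (df x)) ->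
  (forall x, `|df x| <= K) -> `|f b - f a| <= K * `|b - a|.
Proof.
move=> dF dK; wlog ab : a b / a <= b => [H|].
  case/orP: (le_total a b) => ab; first exact: H.
  by rewrite distrC [in leRHS]distrC; exact: H.
move: ab; rewrite le_eqVlt => /predU1P[->|ab]; first by rewrite !subrr normr0 mulr0.
by have [c _ ->] := MVT1 dF ab; rewrite normrM ler_wpM2r.
Qed.

Lemma dX_px g k : dX g k -> px g = k.
Proof. by move=> d; apply/funext => p; rewrite /px derive1E; case: (d p). Qed.

Lemma dY_py g k : dY g k -> py g = k.
Proof. by move=> d; apply/funext => p; rewrite /py derive1E; case: (d p). Qed.

(** [C0inf] without its support clause, so that trigonometric multipliers qualify. *)
Definition smooth g := (forall l, continuous (pd l g)) /\
  (forall l (p : R * R), derivable (fun s => pd l g (s, p.2)) p.1 1 /\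
                         derivable (fun t => pd l g (p.1, t)) p.2 1).

Definition supp_in (M : R) g := forall p : R * R, (M < `|p.1| \/ M < `|p.2|) -> g p = 0.

Lemma C0infE g : C0inf g <-> smooth g /\ exists M, supp_in M g.
Proof. by split=> [[a [b c]]|[[a b] c]]. Qed.

Lemma pd_dX g l : smooth g -> dX (pd l g) (pd (true :: l) g).
Proof.
move=> [_ dg] p; have [d1 _] := dg l p; apply: DeriveDef => //.
by rewrite /= /px derive1E.
Qed.

Lemma pd_dY g l : smooth g -> dY (pd l g) (pd (false :: l) g).
Proof.
move=> [_ dg] p; have [_ d1] := dg l p; apply: DeriveDef => //.
by rewrite /= /py derive1E.
Qed.

Lemma px_dX g : smooth g -> dX g (px g).
Proof. exact: (@pd_dX g [::]). Qed.

Lemma py_dY g : smooth g -> dY g (py g).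
Proof. exact: (@pd_dY g [::]). Qed.

Lemma pd_cat g l l' : pd l (pd l' g) = pd (l ++ l') g.
Proof. by elim: l => //= b l ->. Qed.

Lemma smooth_pd g l : smooth g -> smooth (pd l g).
Proof. by move=> [c d]; split => [l'|l' p]; rewrite pd_cat; [exact: c|exact: d]. Qed.

(** The strict inequalities make the outer region open, so [g] vanishes near each of its points
    along the line of differentiation. *)
Lemma supp_in_dX M g k : dX g k -> supp_in M g -> supp_in M k.
Proof.
move=> gk gM p pM; have [_ <-] := gk p; rewrite -derive1E.
have -> : 0 = (cst 0 : R -> R)^`()%classic p.1 by rewrite derive1_cst.
rewrite !derive1E; apply: near_eq_derive.
case: pM => pM; last by near=> s; apply: gM; right.
have : \forall s \near p.1, M < `|s|.
  have := @cvgr_gt R R (nbhs p.1) _ (fun s => `|s|) `|p.1| (@norm_continuous R R p.1) M pM; exact.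
by apply: filterS => s sM; apply: gM; left.
Unshelve. all: by end_near. Qed.

Lemma supp_in_swap M g : supp_in M g -> supp_in M (fun p => g (p.2, p.1)).
Proof. by move=> gM p [] pM; apply: gM; [right|left]. Qed.

Lemma supp_in_dY M g k : dY g k -> supp_in M g -> supp_in M k.
Proof.
move=> /dX_swap gk /supp_in_swap gM; have := supp_in_swap (supp_in_dX gk gM).
by move=> H [x y]; exact: (H (x, y)).
Qed.

Lemma supp_in_pd M g l : smooth g -> supp_in M g -> supp_in M (pd l g).
Proof.
move=> sg gM; elim: l => // -[] l IH; first exact: (supp_in_dX (pd_dX l sg)).
exact: (supp_in_dY (pd_dY l sg)).
Qed.

Lemma C0inf_pd g l : C0inf g -> C0inf (pd l g).
Proof.
move=> /C0infE[sg [M gM]]; apply/C0infE; split; first exact: smooth_pd.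
by exists M; exact: supp_in_pd.
Qed.

Lemma C0inf_Cc g : C0inf g -> Cc g.
Proof. by move=> [c [_ M]]; split => //; exact: (c [::]). Qed.

Lemma C0inf_px g : C0inf g -> C0inf (px g). Proof. exact: (@C0inf_pd g [:: true]). Qed.
Lemma C0inf_py g : C0inf g -> C0inf (py g). Proof. exact: (@C0inf_pd g [:: false]). Qed.
Lemma C0inf_smooth g : C0inf g -> smooth g. Proof. by move=> /C0infE[]. Qed.

Lemma mixed_difference g gx gxy (x y t : R) : dX g gx -> dY gx gxy -> 0 < t ->
  exists p : R * R, [/\ x < p.1 < x + t, y < p.2 < y + t &
    g (x + t, y + t) - g (x + t, y) - g (x, y + t) + g (x, y) = t ^+ 2 * gxy p].
Proof.
move=> h1 h2 t0.
have [c cx Ec] := @MVT1 (fun s => g (s, y + t) - g (s, y))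
  (fun s => gx (s, y + t) - gx (s, y)) x (x + t)
  (fun s => is_deriveB (h1 (s, y + t)) (h1 (s, y))) (ltr_pwDr t0 (lexx _)).
have [d dy Ed] := @MVT1 (fun s => gx (c, s)) (fun s => gxy (c, s)) y (y + t)
  (fun s => h2 (c, s)) (ltr_pwDr t0 (lexx _)).
exists (c, d); split => //.
have -> : g (x + t, y + t) - g (x + t, y) - g (x, y + t) + g (x, y) =
  g (x + t, y + t) - g (x + t, y) - (g (x, y + t) - g (x, y)) by ring.
rewrite Ec Ed; ring.
Qed.

(** Schwarz's theorem. The second difference over a square is symmetric in the two variables, and by
    [mixed_difference] each order of differentiation is attained by it at some point of the square.
    On a small square continuity makes both values close to those at the corner. *)
Lemma mixed_derivatives g gx gy gxy gyx : dX g gx -> dY gx gxy -> dY g gy -> dX gy gyx ->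
  continuous gxy -> continuous gyx -> gxy = gyx.
Proof.
move=> h1 h2 h3 h4 c1 c2; apply/funext => -[x y]; apply/eqP; rewrite -subr_eq0 -normr_le0.
apply/ler_addgt0Pr => e e0; rewrite add0r.
have e2 : 0 < e / 2 by rewrite divr_gt0.
have /cvgrPdist_lt/(_ _ e2)/nbhs_ballP[d1 /= d10 H1] := c1 (x, y).
have /cvgrPdist_lt/(_ _ e2)/nbhs_ballP[d2 /= d20 H2] := c2 (x, y).
pose t := Num.min d1 d2; have t0 : 0 < t by rewrite lt_min d10.
have [p [px' py' E1]] := mixed_difference x y h1 h2 t0.
have [q [qy' qx' E2]] := @mixed_difference (fun p => g (p.2, p.1)) (fun p => gy (p.2, p.1))
  (fun p => gyx (p.2, p.1)) y x t (dX_swap h3) (fun p => h4 (p.2, p.1)) t0.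
have E : gxy p = gyx (q.2, q.1).
  apply: (@mulfI _ (t ^+ 2)); first by rewrite expf_neq0// gt_eqF.
  rewrite -E1 -E2/=; ring.
have td1 : t <= d1 by rewrite ge_min lexx.
have td2 : t <= d2 by rewrite ge_min lexx orbT.
have := H1 p; have := H2 (q.2, q.1).
rewrite /ball/= /prod_ball/= /ball/= => A2 A1.
have {}A1 : `|gxy (x, y) - gxy p| < e / 2.
  by apply: A1; split => /=; rewrite distrC ger0_norm; lra.
have {}A2 : `|gyx (x, y) - gyx (q.2, q.1)| < e / 2.
  by apply: A2; split => /=; rewrite distrC ger0_norm; lra.
rewrite -E in A2.
have -> : gxy (x, y) - gyx (x, y) = (gxy (x, y) - gxy p) - (gyx (x, y) - gxy p) by ring.
by apply: le_trans (ler_normB _ _) _; lra.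
Qed.

Lemma py_px g : smooth g -> py (px g) = px (py g).
Proof.
move=> sg; apply: (mixed_derivatives (px_dX sg) (pd_dY [:: true] sg) (py_dY sg)
  (pd_dX [:: false] sg)); [exact: (sg.1 [:: false; true])|exact: (sg.1 [:: true; false])].
Qed.

Lemma dX_shift (a b : R) g k : dX g k ->
  dX (fun p => g (p.1 + a, p.2 + b)) (fun p => k (p.1 + a, p.2 + b)).
Proof.
move=> gk p /=; have d1 : is_derive p.1 1 (fun t : R => t + a) 1.
  by rewrite -[X in is_derive _ _ _ X]addr0; apply: is_deriveD.
by have := @is_derive1_comp R (fun s => g (s, p.2 + b)) (fun t => t + a) _ _ _ (gk (p.1 + a, p.2 + b)) d1; rewrite mulr1.
Qed.

Lemma dY_shift (a b : R) g k : dY g k ->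
  dY (fun p => g (p.1 + a, p.2 + b)) (fun p => k (p.1 + a, p.2 + b)).
Proof.
move=> gk p /=; have d1 : is_derive p.2 1 (fun t : R => t + b) 1.
  by rewrite -[X in is_derive _ _ _ X]addr0; apply: is_deriveD.
by have := @is_derive1_comp R (fun s => g (p.1 + a, s)) (fun t => t + b) _ _ _ (gk (p.1 + a, p.2 + b)) d1; rewrite mulr1.
Qed.

Lemma dX_D g k g' k' : dX g k -> dX g' k' -> dX (fun p => g p + g' p) (fun p => k p + k' p).
Proof. by move=> h h' p; exact: is_deriveD (h p) (h' p). Qed.

Lemma dY_D g k g' k' : dY g k -> dY g' k' -> dY (fun p => g p + g' p) (fun p => k p + k' p).
Proof. by move=> h h' p; exact: is_deriveD (h p) (h' p). Qed.

Lemma dX_M g k g' k' : dX g k -> dX g' k' ->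
  dX (fun p => g p * g' p) (fun p => k p * g' p + g p * k' p).
Proof.
move=> h h' [x y]; have := is_deriveM (h (x, y)) (h' (x, y)).
by congr is_derive; rewrite /GRing.scale/=; ring.
Qed.

Lemma dY_M g k g' k' : dY g k -> dY g' k' ->
  dY (fun p => g p * g' p) (fun p => k p * g' p + g p * k' p).
Proof.
move=> h h' [x y]; have := is_deriveM (h (x, y)) (h' (x, y)).
by congr is_derive; rewrite /GRing.scale/=; ring.
Qed.

(** A family closed under both partial derivatives contains all iterated ones. Below, the index is a
    list of directions, a formal sum of products or a pair of coefficients. *)
Lemma smooth_family (I : Type) (F : I -> R * R -> R) (nx ny : I -> I) (i : I) :
  (forall i, continuous (F i)) -> (forall i, dX (F i) (F (nx i))) ->
  (forall i, dY (F i) (F (ny i))) -> smooth (F i).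
Proof.
move=> cF dx dy.
have E l : exists j, pd l (F i) = F j.
  elim: l => [|[] l [j IH]] /=; first by exists i.
    by exists (nx j); rewrite IH (dX_px (dx j)).
  by exists (ny j); rewrite IH (dY_py (dy j)).
split => [l|l p]; first by have [j ->] := E l; exact: cF.
by have [j ->] := E l; have [? _] := dx j p; have [? _] := dy j p.
Qed.

Lemma smooth_shift (a b : R) g : smooth g -> smooth (fun p => g (p.1 + a, p.2 + b)).
Proof.
move=> sg; apply: (@smooth_family (seq bool) (fun l p => pd l g (p.1 + a, p.2 + b))
  (cons true) (cons false) [::]) => l.
- by have := tx_continuous (a := a) (swap_continuous2 (tx_continuous (a := b) (swap_continuous2 (sg.1 l)))).
- exact: dX_shift (pd_dX l sg).
- exact: dY_shift (pd_dY l sg).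
Qed.

Lemma smoothD g h : smooth g -> smooth h -> smooth (fun p => g p + h p).
Proof.
move=> sg sh; apply: (@smooth_family (seq bool) (fun l p => pd l g p + pd l h p)
  (cons true) (cons false) [::]) => l.
- by move=> p; apply: cvgD; [exact: sg.1|exact: sh.1].
- exact: dX_D (pd_dX l sg) (pd_dX l sh).
- exact: dY_D (pd_dY l sg) (pd_dY l sh).
Qed.

(** Formal Leibniz sums: each pair of lists stands for a product of iterated derivatives, and
    [prodsum_next] is the product rule on such sums. *)
Fixpoint prodsum g h (L : seq (seq bool * seq bool)) : R * R -> R :=
  if L is ab :: L' then fun p => pd ab.1 g p * pd ab.2 h p + prodsum g h L' p else fun=> 0.

Fixpoint prodsum_next (b : bool) (L : seq (seq bool * seq bool)) :=
  if L is ab :: L' then (b :: ab.1, ab.2) :: (ab.1, b :: ab.2) :: prodsum_next b L' else [::].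

Lemma smoothM g h : smooth g -> smooth h -> smooth (fun p => g p * h p).
Proof.
move=> sg sh.
have -> : (fun p => g p * h p) = prodsum g h [:: ([::], [::])].
  by apply/funext => p /=; rewrite addr0.
apply: (@smooth_family _ (prodsum g h) (prodsum_next true) (prodsum_next false)).
- elim=> [|ab L IH] /= p; first exact: cvg_cst.
  by apply: cvgD; [apply: cvgM; [exact: sg.1|exact: sh.1]|exact: IH].
- elim=> [|ab L IH] /=; first by move=> p; exact: is_derive_cst.
  have := dX_D (dX_M (pd_dX ab.1 sg) (pd_dX ab.2 sh)) IH.
  by congr (dX _ _); apply/funext => p; rewrite addrA.
- elim=> [|ab L IH] /=; first by move=> p; exact: is_derive_cst.
  have := dY_D (dY_M (pd_dY ab.1 sg) (pd_dY ab.2 sh)) IH.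
  by congr (dY _ _); apply/funext => p; rewrite addrA.
Qed.

(** Sine and cosine are kept together so that differentiation only changes the coefficients; zero
    frequencies give the constants. *)
Definition plane_wave (c d a b : R) (p : R * R) :=
  a * sin (c * p.1 + d * p.2) + b * cos (c * p.1 + d * p.2).

Lemma plane_wave_derive (c e a b x : R) :
  is_derive x 1 (fun t => a * sin (c * t + e) + b * cos (c * t + e))
    (- (b * c) * sin (c * x + e) + (a * c) * cos (c * x + e)).
Proof.
have d1 : is_derive x 1 (fun t : R => c * t + e) c.
  have := is_deriveD (is_deriveZ c (is_derive_id x 1)) (is_derive_cst e x 1).
  by congr is_derive; rewrite /GRing.scale/= mulr1 addr0.
have ds := is_deriveZ a (@is_derive1_comp R sin (fun t => c * t + e) _ _ _ (is_derive_sin (c * x + e)) d1).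
have dc := is_deriveZ b (@is_derive1_comp R cos (fun t => c * t + e) _ _ _ (is_derive_cos (c * x + e)) d1).
have := is_deriveD ds dc; congr is_derive.
rewrite /GRing.scale/=; ring.
Qed.

Lemma plane_wave_dX c d a b : dX (plane_wave c d a b) (plane_wave c d (- (b * c)) (a * c)).
Proof. by move=> p; exact: (plane_wave_derive c (d * p.2) a b p.1). Qed.

Lemma plane_wave_dY c d a b : dY (plane_wave c d a b) (plane_wave c d (- (b * d)) (a * d)).
Proof.
move=> p; have := plane_wave_derive d (c * p.1) a b p.2; rewrite /plane_wave/=.
rewrite [d * _ + _]addrC; congr is_derive; apply/funext => t.
by rewrite [d * _ + _]addrC.
Qed.

Lemma plane_wave_continuous c d a b : continuous (plane_wave c d a b).
Proof.
move=> p; have l : (fun p : R * R => c * p.1 + d * p.2) q @[q --> p] --> c * p.1 + d * p.2.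
  by apply: cvgD; apply: cvgM; try exact: cvg_cst; [exact: cvg_fst|exact: cvg_snd].
apply: cvgD; apply: cvgM; try exact: cvg_cst.
- exact: (@cvg_comp _ _ _ _ sin _ _ _ l (@continuous_sin R _)).
- exact: (@cvg_comp _ _ _ _ cos _ _ _ l (@continuous_cos R _)).
Qed.

Lemma smooth_plane_wave c d a b : smooth (plane_wave c d a b).
Proof.
apply: (@smooth_family (R * R)%type (fun ab => plane_wave c d ab.1 ab.2)
  (fun ab => (- (ab.2 * c), ab.1 * c)) (fun ab => (- (ab.2 * d), ab.1 * d)) (a, b)) => -[a' b'].
- exact: plane_wave_continuous.
- exact: plane_wave_dX.
- exact: plane_wave_dY.
Qed.

Lemma smooth_cst c : smooth (fun=> c).
Proof.
have := smooth_plane_wave 0 0 0 c; congr smooth; apply/funext => p.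
by rewrite /plane_wave !mul0r addr0 cos0 add0r mulr1.
Qed.

Lemma C0infD g h : C0inf g -> C0inf h -> C0inf (fun p => g p + h p).
Proof.
move=> cg ch; apply/C0infE; split; first by apply: smoothD; exact: C0inf_smooth.
by case: (CcD (C0inf_Cc cg) (C0inf_Cc ch)).
Qed.

Lemma C0infMl g h : smooth g -> C0inf h -> C0inf (fun p => g p * h p).
Proof.
move=> sg ch; apply/C0infE; split; first by apply: smoothM => //; exact: C0inf_smooth.
by case: (CcMr (sg.1 [::]) (C0inf_Cc ch)).
Qed.

Lemma C0infZ (c : R) h : C0inf h -> C0inf (fun p => c * h p).
Proof. by apply: C0infMl; exact: smooth_cst. Qed.

Lemma C0infB g h : C0inf g -> C0inf h -> C0inf (fun p => g p - h p).
Proof.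
move=> cg ch; have := C0infD cg (C0infZ (-1) ch); congr C0inf.
by apply/funext => p; rewrite mulN1r.
Qed.

Lemma C0inf_tx a g : C0inf g -> C0inf (tx a g).
Proof.
move=> cg; apply/C0infE; split; last by case: (Cc_tx a (C0inf_Cc cg)).
have := smooth_shift a 0 (C0inf_smooth cg); congr smooth; apply/funext => p.
by rewrite /tx addr0.
Qed.

Lemma C0inf_ty a g : C0inf g -> C0inf (ty a g).
Proof.
move=> cg; apply/C0infE; split; last by case: (Cc_ty a (C0inf_Cc cg)).
have := smooth_shift 0 a (C0inf_smooth cg); congr smooth; apply/funext => p.
by rewrite /ty addr0.
Qed.

End Smooth.

(** * Limits of integrals *)
Section NegligibleIntegral.
Context d (T : measurableType d) {R : realType} (mu : {measure set T -> \bar R}).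
Import HBNNSimple.
Local Open Scope ereal_scope.

(* No measurability is assumed on the integrand: the integral is a supremum over simple functions below it. *)
Lemma ge0_integral_negligibleC (N : set T) (f : T -> \bar R) : measurable N -> mu N = 0 ->
  (forall x, 0 <= f x) -> \int[mu]_x f x = \int[mu]_(x in ~` N) f x.
Proof.
move=> mN N0 f0; have f0' x : 0 <= (f \_ (~` N)) x by rewrite patchE; case: ifP.
rewrite [RHS]integral_mkcond !ge0_integralTE//; apply/eqP; rewrite eq_le; apply/andP; split.
  apply: ge_ereal_sup => _ [h /= hf <-]; apply: ereal_sup_ubound => /=.
  (* A simple function below [f] is cut down to the complement of [N], which keeps its integral
     because [N] is null. *)
  exists (proj_nnsfun h (measurableC mN)).
    move=> x; rewrite -mrestrict !patchE; case: ifP => _ //; exact: hf.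
  have : \int[mu]_x (h x)%:E = \int[mu]_(x in ~` N) (h x)%:E.
    rewrite -setTD; apply: ge0_negligible_integral => //.
      by apply/measurable_EFinP.
    by move=> x _; rewrite lee_fin fun_ge0.
  rewrite (integralT_nnsfun mu h) (integral_nnsfun mu (measurableC mN) h) => ->.
  by rewrite -mrestrict.
apply: le_ereal_sup => _ [h /= hf <-]; exists h => // x.
by apply: le_trans (hf x) _; rewrite patchE; case: ifP.
Qed.

Lemma integral_negligibleC (N : set T) (f : T -> \bar R) : measurable N -> mu N = 0 ->
  \int[mu]_x f x = \int[mu]_(x in ~` N) f x.
Proof.
move=> mN N0; rewrite integralE [RHS]integralE; congr (_ - _);
  exact: ge0_integral_negligibleC.
Qed.

End NegligibleIntegral.

Section L1limit.
Context {R : realType}.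
Implicit Types (k : R * R -> R).

(** Convergence in L^1 to an almost everywhere limit: Fatou's lemma turns the Cauchy bound into a
    bound on the distance to [u]. *)
Lemma int2_cvg (h_ : nat -> R * R -> R) (u : R * R -> R) :
  (forall n, Cc (h_ n)) ->
  {ae (@leb2 R), forall p, h_ n p @[n --> \oo] --> u p} ->
  (forall e : R, 0 < e -> exists N, forall n m, (N <= n)%N -> (N <= m)%N ->
     int2 (fun p => `|h_ n p - h_ m p|) <= e) ->
  int2 (h_ n) @[n --> \oo] --> int2 u.
Proof.
move=> ch [A [mA A0 uA]] hC; apply/cvgrPdist_le => e e0; have [N HN] := hC e e0.
(* [u] is known to be measurable only where it is a pointwise limit, so all integrals are moved to
   the complement [D] of a null set. *)
pose D : set (R * R) := ~` A; have mD : measurable D by exact: measurableC.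
have hu p : D p -> h_ n p @[n --> \oo] --> u p.
  by move=> Dp; apply: contrapT => np; apply: Dp; exact: uA.
have mh n : measurable_fun D (h_ n).
  by apply: measurable_funS (continuous2_measurable (ch n).1).
have mu_ : measurable_fun D u by exact: (measurable_fun_cvg mh hu).
have toD f : int2 f = Rintegral (@leb2 R) D f.
  by rewrite /int2 /Rintegral; congr fine; exact: integral_negligibleC.
exists N => // n /= Nn.
have bound : (\int[@leb2 R]_(p in D) (`|u p - h_ n p|)%:E <= e%:E)%E.
  pose k (m : nat) (p : R * R) : \bar R := (`|h_ m p - h_ n p|)%:E.
  have mk m : measurable_fun D (k m).
    by apply/measurable_EFinP; apply: measurableT_comp => //; exact: measurable_funB.
  have k0 m p : D p -> (0 <= k m p)%E by rewrite lee_fin.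
  have -> : (\int[@leb2 R]_(p in D) (`|u p - h_ n p|)%:E)%E =
    (\int[@leb2 R]_(p in D) limn_einf (k^~ p))%E.
    apply: eq_integral.
    move=> p; rewrite inE => Dp.
    suff kc : k m p @[m --> \oo] --> (`|u p - h_ n p|)%:E.
      by rewrite is_cvg_limn_einfE; [apply/esym/cvg_lim => //; exact: kc|apply/cvg_ex; eexists; exact: kc].
    apply: cvg_EFin; first by near=> m; rewrite /k.
    by apply: cvg_norm; apply: cvgB; [exact: hu|exact: cvg_cst].
  apply: le_trans (fatou (@leb2 R) mD mk k0) _.
  rewrite limn_einf_lim; apply: lime_le; first exact: is_cvg_einfs.
  near=> m; apply: (@le_trans _ _ (\int[@leb2 R]_(x in D) k m x)%E).
    by apply: ereal_inf_lbound; exists m => /=.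
  have /fineK <- : (\int[@leb2 R]_(x in D) k m x)%E \is a fin_num.
    apply: integrable_fin_num => //.
    by apply: integrableS (Cc_integrable (Cc_norm (CcB (ch m) (ch n)))).
  rewrite lee_fin -/(Rintegral _ _ _) -toD; apply: HN => //.
  by near: m; exists N.
have ih : (@leb2 R).-integrable D (EFin \o h_ n).
  by apply: integrableS (Cc_integrable (ch n)).
have id : (@leb2 R).-integrable D (EFin \o (fun p => u p - h_ n p)).
  apply/integrableP; split; first by apply/measurable_EFinP; apply: measurable_funB; [exact: mu_|exact: mh].
  by apply: le_lt_trans bound _; rewrite ltry.
have iu : (@leb2 R).-integrable D (EFin \o u).
  rewrite [X in integrable _ _ X](_ : _ = (EFin \o (fun p => u p - h_ n p)) \+ (EFin \o h_ n)).
    exact: integrableD.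
  by apply/funext => p /=; rewrite -EFinD subrK.
rewrite !toD -RintegralB//; apply: le_trans (le_normr_Rintegral _ _) _ => //.
rewrite -lee_fin /Rintegral fineK//; apply: integrable_fin_num => //.
exact: (integrable_norm id).
Unshelve. all: by end_near. Qed.

End L1limit.

(** * The nonlinearity *)
Section Nonlinearity.
Context {R : realType}.
Implicit Types (s t : R).

Definition pow43 t : R := `|t| `^ (4 / 3).

Lemma f43E t : f43 t = pow43 t * t. Proof. by []. Qed.

Lemma pow43_ge0 t : 0 <= pow43 t. Proof. exact: powR_ge0. Qed.

(** With s = |t|^(1/3) the fractional powers become s^3 and s^4, and the inequalities below become
    polynomial ones. *)
Lemma pow43_cbrt t : exists2 s, 0 <= s & `|t| = s ^+ 3 /\ pow43 t = s ^+ 4.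
Proof.
exists (`|t| `^ (1 / 3)); first exact: powR_ge0.
split; rewrite -powR_mulrn ?powR_ge0// -powRrM.
  have -> : 1 / 3 * 3%:R = 1 :> R by field.
  by rewrite powRr1.
by have -> : 1 / 3 * 4%:R = 4 / 3 :> R by field.
Qed.

Lemma pow430 : pow43 0 = 0.
Proof. by have [s _ []] := pow43_cbrt 0; rewrite normr0 => /esym/eqP; rewrite expf_eq0/= => /eqP ->; rewrite expr0n. Qed.

Lemma f430 : f43 (0 : R) = 0. Proof. by rewrite f43E mulr0. Qed.

Lemma pow43_le_sqr (e t : R) : 0 < e -> pow43 t <= e * t ^+ 2 + e^-1 ^+ 2.
Proof.
move=> e0; have [s s0 [ts ->]] := pow43_cbrt t.
have -> : t ^+ 2 = s ^+ 6 by rewrite -(real_normK (num_real t)) ts -exprM.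
have e2 : 0 < e ^+ 2 by rewrite exprn_gt0.
rewrite -(ler_pM2l e2).
have -> : e ^+ 2 * (e * s ^+ 6 + e^-1 ^+ 2) = (e * s ^+ 2) ^+ 3 + 1.
  by field; rewrite gt_eqF.
have -> : e ^+ 2 * s ^+ 4 = (e * s ^+ 2) ^+ 2 by ring.
(* After multiplication by e^2 the claim is z^2 <= z^3 + 1, clear on either side of z = 1. *)
set z := e * s ^+ 2; have z0 : 0 <= z by rewrite mulr_ge0 ?exprn_ge0// ltW.
case: (leP z 1) => z1.
  have : z ^+ 2 <= 1 by rewrite expr_le1. have : 0 <= z ^+ 3 by rewrite exprn_ge0. lra.
have : z ^+ 2 * 1 <= z ^+ 2 * z by rewrite ler_wpM2l ?exprn_ge0// ltW.
rewrite -exprSr; lra.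
Qed.

(** Read with [x] and [y] as cube roots of |a| and |b|, this is the Lipschitz bound 2 |b|^(1/3) for
    |t|^(4/3) on |t| <= |b|. *)
Lemma cube_gap (x y : R) : 0 <= x -> x <= y -> y ^+ 4 - x ^+ 4 <= 2 * y * (y ^+ 3 - x ^+ 3).
Proof.
move=> x0 xy; rewrite -subr_ge0.
have -> : 2 * y * (y ^+ 3 - x ^+ 3) - (y ^+ 4 - x ^+ 4) =
  (y - x) * ((y - x) * (y ^+ 2 + y * x + x ^+ 2) + (y ^+ 2 * x + y * x ^+ 2)) by ring.
have y0 : 0 <= y by exact: le_trans xy.
rewrite mulr_ge0 ?subr_ge0// addr_ge0// ?mulr_ge0 ?subr_ge0//.
  by rewrite !addr_ge0 ?mulr_ge0 ?exprn_ge0.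
by rewrite addr_ge0 ?mulr_ge0 ?exprn_ge0.
Qed.

(** The constant is 3 = 1 + 2: the increment of [f43] is |b|^(4/3) (b - a) plus a times the
    increment of [pow43], and [cube_gap] costs a factor 2. *)
Lemma f43_lip_le (a b : R) : `|a| <= `|b| -> `|f43 b - f43 a| <= 3 * pow43 b * `|b - a|.
Proof.
move=> ab; rewrite !f43E.
have -> : pow43 b * b - pow43 a * a = pow43 b * (b - a) + a * (pow43 b - pow43 a) by ring.
apply: le_trans (ler_normD _ _) _; rewrite !normrM (ger0_norm (pow43_ge0 b)).
suff : `|a| * `|pow43 b - pow43 a| <= 2 * pow43 b * `|b - a| by lra.
have [x x0 [ax cx]] := pow43_cbrt a; have [y y0 [by_ cy]] := pow43_cbrt b.
have xy : x <= y by move: ab; rewrite ax by_ ler_pXn2r.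
have ba : `|b| - `|a| <= `|b - a| := lerB_dist b a.
have x4 : x ^+ 4 <= y ^+ 4 by rewrite ler_pXn2r.
have x3 : x ^+ 3 <= y ^+ 3 by rewrite ler_pXn2r.
have y4 : 0 <= 2 * y ^+ 4 by rewrite mulr_ge0 ?exprn_ge0.
rewrite ax cx cy ger0_norm ?subr_ge0//; apply: (@le_trans _ _ (2 * y ^+ 4 * (y ^+ 3 - x ^+ 3))).
  apply: (@le_trans _ _ (y ^+ 3 * (2 * y * (y ^+ 3 - x ^+ 3)))).
    by apply: ler_pM => //; rewrite ?exprn_ge0 ?subr_ge0//; exact: cube_gap.
  rewrite le_eqVlt; apply/orP; left; apply/eqP; ring.
by rewrite -by_ -ax ler_wpM2l.
Qed.

Lemma f43_lip (a b : R) : `|f43 b - f43 a| <= 3 * (pow43 a + pow43 b) * `|b - a|.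
Proof.
have ca := pow43_ge0 a; have cb := pow43_ge0 b.
case/orP: (le_total `|a| `|b|) => ab.
  apply: le_trans (f43_lip_le ab) _; rewrite ler_wpM2r//; lra.
rewrite distrC [`|b - a|]distrC; apply: le_trans (f43_lip_le ab) _; rewrite ler_wpM2r//; lra.
Qed.

Lemma pow43_continuous : continuous pow43.
Proof.
move=> a; apply/cvgrPdist_le => e e0.
have lip b : `|pow43 a - pow43 b| <= 2 * (2 + `|a| + `|b|) * `|a - b|.
  (* This removes the cube root from the Lipschitz constant of [cube_gap], leaving one that is
     locally bounded. *)
  have s1 s : 0 <= s -> s <= 1 + s ^+ 3.
    move=> s0; case: (leP s 1) => s1; first by have := exprn_ge0 3 s0; lra.
    have : s * 1 <= s * s ^+ 2 by rewrite ler_wpM2l// exprn_ege1// ltW.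
    rewrite -exprS; lra.
  have H u v : `|u| <= `|v| -> `|pow43 u - pow43 v| <= 2 * (2 + `|u| + `|v|) * `|u - v|.
    have [x x0 [ux ->]] := pow43_cbrt u; have [y y0 [vy ->]] := pow43_cbrt v => uv.
    have xy : x <= y by move: uv; rewrite ux vy ler_pXn2r.
    have x4 : x ^+ 4 <= y ^+ 4 by rewrite ler_pXn2r.
    rewrite distrC ger0_norm ?subr_ge0//; apply: le_trans (cube_gap x0 xy) _.
    rewrite -ux -vy; apply: ler_pM.
    - by rewrite mulr_ge0.
    - by rewrite subr_ge0.
    - rewrite ler_wpM2l//; have := s1 _ y0; have := s1 _ x0; rewrite -ux -vy.
      by have := normr_ge0 u; lra.
    - by rewrite distrC; exact: lerB_dist.
  case/orP: (le_total `|a| `|b|) => ab; first exact: H.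
  rewrite distrC [`|a - b|]distrC; have := H _ _ ab.
  by rewrite -[2 + `|b| + _]addrA [`|b| + _]addrC addrA.
pose K := 2 * (3 + 2 * `|a|); have K0 : 0 < K by rewrite /K; have := normr_ge0 a; lra.
near=> b.
have b1 : `|a - b| <= 1 by near: b; apply: cvgr_dist_le; [exact: cvg_id|exact: ltr01].
have b2 : `|a - b| <= e / K.
  by near: b; apply: cvgr_dist_le; [exact: cvg_id|rewrite divr_gt0].
apply: le_trans (lip b) _; apply: (@le_trans _ _ (K * (e / K))); last by rewrite mulrC divfK ?gt_eqF.
have : `|b| <= `|a| + `|a - b|.
  by rewrite -{1}(subKr a b) [`|a| + _]addrC addrC -[`|a - b|]normrN; apply: ler_normD.
move=> hb; apply: ler_pM => //; rewrite /K; have := normr_ge0 a; have := normr_ge0 b; lra.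
Unshelve. all: by end_near. Qed.

Lemma f43_continuous : continuous (@f43 R).
Proof. by move=> t; apply: cvgM; [exact: pow43_continuous|exact: cvg_id]. Qed.

(** Young's inequality with the conjugate exponents 10/7 and 10/3. *)
Lemma f43_young (a b : R) :
  f43 a * b <= 7 / 10 * (pow43 a * a ^+ 2) + 3 / 10 * (pow43 b * b ^+ 2).
Proof.
apply: (@le_trans _ _ (`|f43 a| * `|b|)); first by rewrite -normrM ler_norm.
rewrite f43E normrM (ger0_norm (pow43_ge0 a)).
have sq t : t ^+ 2 = `|t| ^+ 2 by rewrite real_normK// num_real.
rewrite (sq a) (sq b); have [x x0 [-> ->]] := pow43_cbrt a; have [y y0 [-> ->]] := pow43_cbrt b.
rewrite -subr_ge0.
(* In cube roots the polynomial 7 x^10 + 3 y^10 - 10 x^7 y^3 has a double root at y = x, and the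
   other factor has positive coefficients. *)
have -> : 7 / 10 * (x ^+ 4 * (x ^+ 3) ^+ 2) + 3 / 10 * (y ^+ 4 * (y ^+ 3) ^+ 2) -
    x ^+ 4 * x ^+ 3 * y ^+ 3 =
  (y - x) ^+ 2 * (3 * y ^+ 8 + 6 * y ^+ 7 * x + 9 * y ^+ 6 * x ^+ 2 + 12 * y ^+ 5 * x ^+ 3
    + 15 * y ^+ 4 * x ^+ 4 + 18 * y ^+ 3 * x ^+ 5 + 21 * y ^+ 2 * x ^+ 6 + 14 * y * x ^+ 7
    + 7 * x ^+ 8) / 10 by field.
apply: divr_ge0 => //; apply: mulr_ge0; first exact: sqr_ge0.
by do 8 (apply: addr_ge0; last by rewrite ?mulr_ge0// ?exprn_ge0//); rewrite mulr_ge0 ?exprn_ge0.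
Qed.

(* The potential [3/10 |t|^(10/3)], whose derivative is [f43]. *)
Definition F43 t : R := 3 / 10 * (pow43 t * t ^+ 2).

(** The tangent inequality is [f43_young] rewritten, because 7/10 |a|^(10/3) = f43(a) a - F43(a). *)
Lemma F43_convex (a b : R) : f43 a * (b - a) <= F43 b - F43 a.
Proof. by have := f43_young a b; rewrite /F43 !f43E mulrBr; nra. Qed.

(** Convexity at [a] and at [b] traps the remainder between 0 and (f43 b - f43 a)(b - a); [f43_lip]
    bounds the latter. *)
Lemma F43_taylor (a b : R) :
  `|F43 b - F43 a - f43 a * (b - a)| <= 3 * ((pow43 a + pow43 b) * (b - a) ^+ 2).
Proof.
have h1 := F43_convex a b; have h2 := F43_convex b a.
rewrite ger0_norm; last lra.
have h3 : (f43 b - f43 a) * (b - a) <= 3 * ((pow43 a + pow43 b) * (b - a) ^+ 2).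
  apply: le_trans (ler_norm _) _; rewrite normrM.
  apply: (@le_trans _ _ (3 * (pow43 a + pow43 b) * `|b - a| * `|b - a|)).
    by rewrite ler_wpM2r//; exact: f43_lip.
  by rewrite -!mulrA -expr2 real_normK ?num_real.
lra.
Qed.

End Nonlinearity.

(* [px] and [py] are sealed because unification would otherwise unfold them down to limits. *)
HB.lock Definition dx (R : realType) (g : R * R -> R) : R * R -> R := px g.
HB.lock Definition dy (R : realType) (g : R * R -> R) : R * R -> R := py g.
HB.lock Definition nrm (R : realType) (a : R * R -> R) : R :=
  Num.sqrt (int2 (fun p => a p ^+ 2)).

Canonical dx_unlockable := Unlockable dx.unlock.
Canonical dy_unlockable := Unlockable dy.unlock.
Canonical nrm_unlockable := Unlockable nrm.unlock.

Section SealedDerivatives.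
Context {R : realType}.
Implicit Types (g k : R * R -> R).

Lemma dxE g : dx g = px g. Proof. by rewrite unlock. Qed.
Lemma dyE g : dy g = py g. Proof. by rewrite unlock. Qed.

Lemma dx_dX g : smooth g -> dX g (dx g). Proof. by rewrite dxE; exact: px_dX. Qed.
Lemma dy_dY g : smooth g -> dY g (dy g). Proof. by rewrite dyE; exact: py_dY. Qed.
Lemma dX_dx g k : dX g k -> dx g = k. Proof. by rewrite dxE; exact: dX_px. Qed.
Lemma dY_dy g k : dY g k -> dy g = k. Proof. by rewrite dyE; exact: dY_py. Qed.
Lemma C0inf_dx g : C0inf g -> C0inf (dx g). Proof. by rewrite dxE; exact: C0inf_px. Qed.
Lemma C0inf_dy g : C0inf g -> C0inf (dy g). Proof. by rewrite dyE; exact: C0inf_py. Qed.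
Lemma dy_dx g : smooth g -> dy (dx g) = dx (dy g).
Proof. by move=> sg; rewrite !dxE !dyE; exact: py_px. Qed.

End SealedDerivatives.

(** * L^2 norms, weighted Cauchy-Schwarz and the trilinear bound *)

Section Norms.
Context {R : realType}.
Implicit Types (a b w z g h rho : R * R -> R).

Lemma nrmE a : nrm a = Num.sqrt (int2 (fun p => a p ^+ 2)).
Proof. by rewrite unlock. Qed.

Lemma nrm_ge0 a : 0 <= nrm a. Proof. by rewrite nrmE sqrtr_ge0. Qed.

Lemma nrm_sqr a : nrm a ^+ 2 = int2 (fun p => a p ^+ 2).
Proof. by rewrite nrmE sqr_sqrtr// int2_ge0// => p; exact: sqr_ge0. Qed.

Lemma eq_nrm a b : a =1 b -> nrm a = nrm b. Proof. by move/funext => ->. Qed.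

Lemma discriminant_le (A B C : R) : (forall t, 0 <= A - 2 * t * B + t ^+ 2 * C) -> 0 <= A -> 0 <= C ->
  B ^+ 2 <= A * C.
Proof.
move=> H A0; rewrite le_eqVlt => /predU1P[C0|C0].
  rewrite -C0 mulr0; have [->|B0] := eqVneq B 0; first by rewrite expr0n.
  (* For C = 0 the expression is affine in t, and this t gives it the value -1 unless B = 0. *)
  have := H ((A + 1) / (2 * B)); rewrite -C0.
  have -> : A - 2 * ((A + 1) / (2 * B)) * B + ((A + 1) / (2 * B)) ^+ 2 * 0 = -1 by field.
  by rewrite ler0N1.
have := H (B / C); have -> : A - 2 * (B / C) * B + (B / C) ^+ 2 * C = A - B ^+ 2 / C.
  by field; rewrite gt_eqF.
by rewrite subr_ge0 ler_pdivrMr.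
Qed.

(** The weight will be [pow43] of the approximants: nonlinear terms are treated as weighted L^2
    products. *)
Lemma CS_weighted rho a b : continuous rho -> (forall p, 0 <= rho p) -> Cc a -> Cc b ->
  `|int2 (fun p => rho p * (a p * b p))| <=
  Num.sqrt (int2 (fun p => rho p * a p ^+ 2)) * Num.sqrt (int2 (fun p => rho p * b p ^+ 2)).
Proof.
move=> crho rho0 ca cb.
have ge0 h : 0 <= int2 (fun p => rho p * h p ^+ 2).
  by apply: int2_ge0 => p; rewrite mulr_ge0// sqr_ge0.
rewrite -sqrtrM// -(ger0_norm (sqrtr_ge0 (_ * _))) -ler_sqr ?nnegrE//.
rewrite !real_normK ?num_real// sqr_sqrtr ?mulr_ge0//.
have caa := CcMr crho (Cc_sqr ca); have cbb := CcMr crho (Cc_sqr cb).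
have cab : Cc (fun p => rho p * (a p * b p)) by apply: CcMr => //; exact: CcMl ca cb.1.
apply: discriminant_le => // t.
rewrite -int2Z// -int2Z// -int2B//; last exact: CcZ.
rewrite -int2D//; [|exact: CcB (CcZ _ _)|exact: CcZ].
apply: int2_ge0 => p.
have -> : rho p * a p ^+ 2 - 2 * t * (rho p * (a p * b p)) + t ^+ 2 * (rho p * b p ^+ 2) =
  rho p * (a p - t * b p) ^+ 2 by ring.
by rewrite mulr_ge0// sqr_ge0.
Qed.

Lemma CS a b : Cc a -> Cc b -> `|int2 (fun p => a p * b p)| <= nrm a * nrm b.
Proof.
move=> ca cb; have := @CS_weighted (fun=> 1) a b (@cst_continuous _ _ (1 : R)) (fun=> ler01) ca cb.
have E h : (fun p : R * R => 1 * h p) = h by apply/funext => p; rewrite mul1r.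
by rewrite !nrmE (E (fun p => a p * b p)) (E (fun p => a p ^+ 2)) (E (fun p => b p ^+ 2)).
Qed.

Lemma nrm_norm a : nrm (fun p => `|a p|) = nrm a.
Proof. by rewrite !nrmE; congr (Num.sqrt (int2 _)); apply/funext => p; rewrite real_normK// num_real. Qed.

Lemma CS_norm a b : Cc a -> Cc b -> int2 (fun p => `|a p * b p|) <= nrm a * nrm b.
Proof.
move=> ca cb; rewrite -(nrm_norm a) -(nrm_norm b).
have := CS (Cc_norm ca) (Cc_norm cb); apply: le_trans; apply: le_trans (ler_norm _).
by under eq_fun do rewrite normrM.
Qed.

Lemma nrmD a b : Cc a -> Cc b -> nrm (fun p => a p + b p) <= nrm a + nrm b.
Proof.
move=> ca cb; rewrite -ler_sqr ?nnegrE ?addr_ge0 ?nrm_ge0// sqrrD !nrm_sqr.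
have cab := CcMl ca cb.1.
have -> : (fun p => (a p + b p) ^+ 2) = (fun p => (a p ^+ 2 + 2 * (a p * b p)) + b p ^+ 2).
  by apply/funext => p; ring.
rewrite int2D; [|exact: CcD (Cc_sqr ca) (CcZ _ cab)|exact: Cc_sqr].
rewrite int2D; [|exact: Cc_sqr|exact: CcZ]; rewrite int2Z// lerD2r lerD2l -[leRHS]mulr_natl.
by rewrite ler_wpM2l//; apply: le_trans (ler_norm _) (CS ca cb).
Qed.

Lemma nrmZ (c : R) a : Cc a -> nrm (fun p => c * a p) = `|c| * nrm a.
Proof.
move=> ca; rewrite !nrmE -sqrtr_sqr -sqrtrM ?sqr_ge0//; congr Num.sqrt.
by rewrite -int2Z//; [congr int2; apply/funext => p; rewrite exprMn|exact: Cc_sqr].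
Qed.

Lemma nrmN a : nrm (fun p => - a p) = nrm a.
Proof. by rewrite !nrmE; congr (Num.sqrt (int2 _)); apply/funext => p; rewrite sqrrN. Qed.

Lemma nrmB a b : Cc a -> Cc b -> nrm (fun p => a p - b p) <= nrm a + nrm b.
Proof. by move=> ca cb; rewrite -(nrmN b); apply: nrmD => //; exact: CcN. Qed.

Lemma nrm_le_mul (K : R) (k : R * R -> R) a : continuous k -> (forall p, `|k p| <= K) -> Cc a ->
  nrm (fun p => k p * a p) <= K * nrm a.
Proof.
move=> ck kK ca; have K0 : 0 <= K by exact: le_trans (kK (0, 0)).
rewrite -{1}(ger0_norm K0) -nrmZ// !nrmE ler_wsqrtr//; apply: le_int2.
- by apply: Cc_sqr; exact: CcMr.
- by apply: Cc_sqr; exact: CcZ.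
move=> p; rewrite !exprMn ler_wpM2r ?sqr_ge0//.
by rewrite -(real_normK (num_real (k p))) ler_pXn2r.
Qed.

Lemma nrm_bound (K M : R) a : Cc a -> 0 <= K -> 0 <= M -> (forall p, `|a p| <= K) ->
  supp_in M a -> nrm a <= K * (2 * M).
Proof.
move=> ca K0 M0 aK aM; rewrite -[leRHS]ger0_norm ?mulr_ge0// -sqrtr_sqr nrmE ler_wsqrtr//.
apply: le_trans (ler_norm _) _; rewrite exprMn; apply: int2_bound => //.
- exact: Cc_sqr.
- by move=> p; rewrite normrX ler_pXn2r// nnegrE.
- by move=> p /aM ->; rewrite expr0n.
Qed.

(** [d] is true for the horizontal and false for the vertical direction, so that the two Pohozaev
    identities can share their lemmas. *)
Definition transl (d : bool) : R -> (R * R -> R) -> R * R -> R := if d then tx else ty.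
Definition der (d : bool) : (R * R -> R) -> R * R -> R := if d then @dx R else @dy R.

Lemma Cc_transl d t a : Cc a -> Cc (transl d t a).
Proof. by case: d => ca; [exact: Cc_tx|exact: Cc_ty]. Qed.

Lemma int2_transl d t a : Cc a -> int2 (transl d t a) = int2 a.
Proof. by case: d => ca; [exact: int2_tx|exact: int2_ty]. Qed.

Lemma translE d t (phi : R -> R) a : transl d t (fun p => phi (a p)) = (fun p => phi (transl d t a p)).
Proof. by case: d. Qed.

Lemma translM d t a a' : transl d t (fun p => a p * a' p) = (fun p => transl d t a p * transl d t a' p).
Proof. by case: d. Qed.

Lemma translB d t a a' : transl d t (fun p => a p - a' p) = (fun p => transl d t a p - transl d t a' p).
Proof. by case: d. Qed.

Lemma transl_transl d t u a : transl d t (transl d u a) = transl d (t + u) a.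
Proof. by case: d; apply/funext => p; rewrite /transl /tx /ty /= addrA. Qed.

Lemma transl0 d a : transl d 0 a = a.
Proof. by case: d; apply/funext => -[x y]; rewrite /transl /tx /ty /= addr0. Qed.

Lemma nrm_transl d t a : Cc a -> nrm (transl d t a) = nrm a.
Proof.
by move=> ca; rewrite !nrmE -(translE d t (fun x => x ^+ 2)) int2_transl//; exact: Cc_sqr.
Qed.

Lemma C0inf_transl d t g : C0inf g -> C0inf (transl d t g).
Proof. by case: d => ca; [exact: C0inf_tx|exact: C0inf_ty]. Qed.

Lemma C0inf_der d g : C0inf g -> C0inf (der d g).
Proof. by case: d; [exact: C0inf_dx|exact: C0inf_dy]. Qed.

Lemma der_transl d d' t g : C0inf g -> der d (transl d' t g) = transl d' t (der d g).
Proof.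
move=> /C0inf_smooth sg; case: d; case: d'.
- by apply: dX_dx; have := dX_shift t 0 (dx_dX sg); congr (dX _ _);
    apply/funext => p; rewrite addr0.
- by apply: dX_dx; have := dX_shift 0 t (dx_dX sg); congr (dX _ _);
    apply/funext => p; rewrite addr0.
- by apply: dY_dy; have := dY_shift t 0 (dy_dY sg); congr (dY _ _);
    apply/funext => p; rewrite addr0.
- by apply: dY_dy; have := dY_shift 0 t (dy_dY sg); congr (dY _ _);
    apply/funext => p; rewrite addr0.
Qed.

Lemma derD d g h : C0inf g -> C0inf h -> der d (fun p => g p + h p) = (fun p => der d g p + der d h p).
Proof.
move=> /C0inf_smooth sg /C0inf_smooth sh; case: d.
- by apply: dX_dx; exact: dX_D (dx_dX sg) (dx_dX sh).
- by apply: dY_dy; exact: dY_D (dy_dY sg) (dy_dY sh).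
Qed.

Lemma derM d g h : smooth g -> C0inf h ->
  der d (fun p => g p * h p) = (fun p => der d g p * h p + g p * der d h p).
Proof.
move=> sg /C0inf_smooth sh; case: d.
- by apply: dX_dx; exact: dX_M (dx_dX sg) (dx_dX sh).
- by apply: dY_dy; exact: dY_M (dy_dY sg) (dy_dY sh).
Qed.

Lemma derZ d c g : C0inf g -> der d (fun p => c * g p) = (fun p => c * der d g p).
Proof.
move=> cg; rewrite (derM d (smooth_cst c) cg).
have -> : der d (fun=> c) = (fun=> 0).
  by case: d; [apply: dX_dx|apply: dY_dy] => p; exact: is_derive_cst.
by apply/funext => p; rewrite mul0r add0r.
Qed.

Lemma derB d g h : C0inf g -> C0inf h -> der d (fun p => g p - h p) = (fun p => der d g p - der d h p).
Proof.
move=> cg ch; have := derD d cg (C0infZ (-1) ch); rewrite (derZ d (-1) ch).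
have -> : (fun p => g p + -1 * h p) = (fun p => g p - h p) by apply/funext => p; rewrite mulN1r.
by move=> ->; apply/funext => p; rewrite mulN1r.
Qed.

(** The weight is split by [pow43_le_sqr], and its quadratic part goes to [anisotropic_product] with
    h = g_x and v = g_y, whose cross derivatives agree. Only [w] and its horizontal derivative
    enter, which is all that is controlled for increments of g_x. *)
Lemma trilinear (e : R) g w z : C0inf g -> Cc w -> Cc z -> dX w z -> 0 < e ->
  int2 (fun p => pow43 (dx g p) * w p ^+ 2) <=
  e * (4 * (nrm (dx (dx g)) * nrm (dy g) * (nrm w * nrm z))) + e^-1 ^+ 2 * nrm w ^+ 2.
Proof.
move=> cg cw cz wz e0.
have c1 := C0inf_Cc (C0inf_dx cg).
have cc : Cc (fun p => pow43 (dx g p)).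
  by apply: Cc_comp c1; [exact: pow43_continuous|exact: pow430].
have cgw : Cc (fun p => dx g p ^+ 2 * w p ^+ 2).
  by apply: CcMl; [exact: Cc_sqr|exact: (Cc_sqr cw).1].
have cw2 := Cc_sqr cw.
apply: (@le_trans _ _ (int2 (fun p => e * (dx g p ^+ 2 * w p ^+ 2) + e^-1 ^+ 2 * w p ^+ 2))).
  apply: le_int2 => [||p]; [exact: CcMl cc cw2.1|by apply: CcD; exact: CcZ|].
  by rewrite mulrA -mulrDl ler_wpM2r ?sqr_ge0//; exact: pow43_le_sqr.
rewrite int2D; [|exact: CcZ|exact: CcZ].
rewrite !int2Z// nrm_sqr lerD2r ler_pM2l//.
apply: le_trans (@anisotropic_product _ _ (dy g) _ (dx (dy g)) _ _ c1 _ _ _ cw cz _ _ _ wz) _.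
- exact: C0inf_Cc (C0inf_dy cg).
- exact: C0inf_Cc (C0inf_dx (C0inf_dx cg)).
- exact: C0inf_Cc (C0inf_dx (C0inf_dy cg)).
- exact: dx_dX (C0inf_smooth (C0inf_dx cg)).
- rewrite -(dy_dx (C0inf_smooth cg)); exact: dy_dY (C0inf_smooth (C0inf_dx cg)).
- exact: dx_dX (C0inf_smooth (C0inf_dy cg)).
rewrite ler_pM2l//; apply: ler_pM; try exact: int2_ge0.
  apply: CS_norm; [exact: C0inf_Cc (C0inf_dx (C0inf_dx cg))|exact: C0inf_Cc (C0inf_dy cg)].
exact: CS_norm.
Qed.

End Norms.

(* Abstracting the atoms keeps [lra] from comparing them up to unfolding. *)
Ltac norm_lra := repeat match goal with
  | |- context [int2 ?a] => let x := fresh "x" in set (x := int2 a) in *; clearbody x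
  | H : context [int2 ?a] |- _ => let x := fresh "x" in set (x := int2 a) in *; clearbody x
  | |- context [nrm ?a] => let x := fresh "x" in set (x := nrm a) in *; clearbody x
  | H : context [nrm ?a] |- _ => let x := fresh "x" in set (x := nrm a) in *; clearbody x
  end; lra.

(** * Almost critical sequences *)
Section Critical.
Context {R : realType}.
Implicit Types (a b c g h k psi : R * R -> R).

(** Exchanging the mixed derivatives makes the integrand (g_y)_x, so the nonlocal term of the inner
    product becomes local in [g]. *)
Lemma Dxinv_dy g : C0inf g -> Dxinv (py (dx g)) = dy g.
Proof.
move=> cg; have sg := C0inf_smooth cg; rewrite -dyE (dy_dx sg); apply/funext => -[x y].
have c1 := C0inf_Cc (C0inf_dy cg); have c2 := C0inf_Cc (C0inf_dx (C0inf_dy cg)).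
have [N N0 hN] := Cc_common c1 c2.
have d (s : R) : is_derive s 1 (fun s => dy g (s, y)) (dx (dy g) (s, y)).
  exact: (dx_dX (C0inf_smooth (C0inf_dy cg)) (s, y)).
rewrite /Dxinv/= (@FTC_Nyc _ (fun s => dy g (s, y)) (fun s => dx (dy g) (s, y)) N)//.
- exact: (slice1_continuous c2.1).
- by move=> s sN; apply: hN; left.
Qed.

(** The three parts of the X norm of [dx g], added up instead of combined in Euclidean fashion, so
    that each is bounded by the sum at once. *)
Definition NX g : R := nrm (dx (dx g)) + nrm (dy g) + nrm (dx g).

Lemma NX_ge0 g : 0 <= NX g. Proof. by rewrite !addr_ge0 ?nrm_ge0. Qed.

Lemma le_NX g : [/\ nrm (dx (dx g)) <= NX g, nrm (dy g) <= NX g & nrm (dx g) <= NX g].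
Proof.
have h1 := nrm_ge0 (dx (dx g)); have h2 := nrm_ge0 (dy g); have h3 := nrm_ge0 (dx g).
by rewrite /NX; split; norm_lra.
Qed.

Lemma dxB g h : C0inf g -> C0inf h -> dx (fun p => g p - h p) = (fun p => dx g p - dx h p).
Proof. exact: (@derB _ true). Qed.

Lemma dxD g h : C0inf g -> C0inf h -> dx (fun p => g p + h p) = (fun p => dx g p + dx h p).
Proof. exact: (@derD _ true). Qed.

Lemma dyD g h : C0inf g -> C0inf h -> dy (fun p => g p + h p) = (fun p => dy g p + dy h p).
Proof. exact: (@derD _ false). Qed.

Lemma dx_transl (d : bool) (t : R) g : C0inf g -> dx (transl d t g) = transl d t (dx g).
Proof. exact: (@der_transl _ true). Qed.

Lemma dy_transl (d : bool) (t : R) g : C0inf g -> dy (transl d t g) = transl d t (dy g).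
Proof. exact: (@der_transl _ false). Qed.

Lemma dyB g h : C0inf g -> C0inf h -> dy (fun p => g p - h p) = (fun p => dy g p - dy h p).
Proof. exact: (@derB _ false). Qed.

Lemma dxxB g h : C0inf g -> C0inf h ->
  dx (dx (fun p => g p - h p)) = (fun p => dx (dx g) p - dx (dx h) p).
Proof. by move=> cg ch; rewrite dxB// dxB//; exact: C0inf_dx. Qed.

Lemma NXD g h : C0inf g -> C0inf h -> NX (fun p => g p + h p) <= NX g + NX h.
Proof.
move=> cg ch; have c1 := C0inf_dx cg; have c2 := C0inf_dx ch.
rewrite /NX (dxD cg ch) (dxD c1 c2) (dyD cg ch).
have := nrmD (C0inf_Cc c1) (C0inf_Cc c2).
have := nrmD (C0inf_Cc (C0inf_dx c1)) (C0inf_Cc (C0inf_dx c2)).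
have := nrmD (C0inf_Cc (C0inf_dy cg)) (C0inf_Cc (C0inf_dy ch)).
norm_lra.
Qed.

Lemma NXB g h : C0inf g -> C0inf h -> NX (fun p => g p - h p) <= NX g + NX h.
Proof.
move=> cg ch; have c1 := C0inf_dx cg; have c2 := C0inf_dx ch.
rewrite /NX dxxB// dxB// dyB//.
have := nrmB (C0inf_Cc c1) (C0inf_Cc c2).
have := nrmB (C0inf_Cc (C0inf_dx c1)) (C0inf_Cc (C0inf_dx c2)).
have := nrmB (C0inf_Cc (C0inf_dy cg)) (C0inf_Cc (C0inf_dy ch)).
norm_lra.
Qed.

Lemma NX_transl (d : bool) (t : R) g : C0inf g -> NX (transl d t g) = NX g.
Proof.
move=> cg; rewrite /NX (dx_transl d t cg) (dx_transl d t (C0inf_dx cg)) (dy_transl d t cg) !nrm_transl//; apply: C0inf_Cc.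
- exact: C0inf_dx.
- exact: C0inf_dy.
- exact/C0inf_dx/C0inf_dx.
Qed.

(** The weak equation for u = g_x tested with phi = psi_x. *)
Definition dJ (lam : R) g psi : R :=
  int2 (fun p => dx (dx g) p * dx (dx psi) p) + int2 (fun p => dy g p * dy psi p)
  - lam * int2 (fun p => dx g p * dx psi p) - int2 (fun p => f43 (dx g p) * dx psi p).

Lemma Cc_prod g h : C0inf g -> C0inf h -> Cc (fun p => g p * h p).
Proof. by move=> cg ch; apply: CcMl; [exact: C0inf_Cc|exact: (C0inf_Cc ch).1]. Qed.

Lemma Cc_f43 g : Cc g -> Cc (fun p => f43 (g p)).
Proof. by apply: Cc_comp; [exact: f43_continuous|exact: f430]. Qed.

Lemma Cc_pow43 g : Cc g -> Cc (fun p => pow43 (g p)).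
Proof. by apply: Cc_comp; [exact: pow43_continuous|exact: pow430]. Qed.

Lemma inner0_dx g h : C0inf g -> C0inf h -> inner0 (dx g) (dx h) =
  int2 (fun p => dx (dx g) p * dx (dx h) p) + int2 (fun p => dy g p * dy h p).
Proof.
move=> cg ch; rewrite /inner0 !Dxinv_dy// -!dxE int2D; first by [].
- by apply: Cc_prod; exact/C0inf_dx/C0inf_dx.
- by apply: Cc_prod; exact: C0inf_dy.
Qed.

Lemma innerX_dx g : C0inf g -> innerX (dx g) (dx g) =
  nrm (dx (dx g)) ^+ 2 + nrm (dy g) ^+ 2 + nrm (dx g) ^+ 2.
Proof.
move=> cg; rewrite /innerX (inner0_dx cg cg) !nrm_sqr.
by congr (int2 _ + int2 _ + int2 _); apply/funext => p; rewrite expr2.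
Qed.

Lemma NX_le_innerX g : C0inf g -> NX g <= 3 * Num.sqrt (innerX (dx g) (dx g)).
Proof.
move=> cg; rewrite innerX_dx//; set S := _ + _ + _.
have h1 := sqr_ge0 (nrm (dx (dx g))); have h2 := sqr_ge0 (nrm (dy g)).
have h3 := sqr_ge0 (nrm (dx g)).
have H x : 0 <= x -> x ^+ 2 <= S -> x <= Num.sqrt S.
  by move=> x0 xS; rewrite -(ger0_norm x0) -sqrtr_sqr ler_wsqrtr.
have := H _ (nrm_ge0 (dx (dx g))); have := H _ (nrm_ge0 (dy g)); have := H _ (nrm_ge0 (dx g)).
rewrite /NX /S => H3 H2 H1.
have {}H1 := H1 ltac:(norm_lra); have {}H2 := H2 ltac:(norm_lra); have {}H3 := H3 ltac:(norm_lra).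
set x := Num.sqrt _ in H1 H2 H3 *; clearbody x; norm_lra.
Qed.

(** [trilinear] with parameter 1: on bounded sets the weighted L^2 norm of [dx h] is dominated by
    [NX h]. *)
Lemma pow43_weight_le (M : R) g h : C0inf g -> C0inf h -> NX g <= M ->
  int2 (fun p => pow43 (dx g p) * dx h p ^+ 2) <= (4 * M ^+ 2 + 1) * NX h ^+ 2.
Proof.
move=> cg ch gM; have [g1 g2 _] := le_NX g; have [h1 _ h3] := le_NX h.
have N0 := NX_ge0 h; have M0 : 0 <= M by exact: le_trans (NX_ge0 g) gM.
apply: le_trans (trilinear cg (C0inf_Cc (C0inf_dx ch)) (C0inf_Cc (C0inf_dx (C0inf_dx ch)))
  (dx_dX (C0inf_smooth (C0inf_dx ch))) (@ltr01 R)) _.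
have -> : (4 * M ^+ 2 + 1) * NX h ^+ 2 = 4 * (M ^+ 2 * NX h ^+ 2) + NX h ^+ 2 by ring.
rewrite invr1 expr1n !mul1r; apply: lerD; last by rewrite ler_pXn2r ?nnegrE ?nrm_ge0.
rewrite ler_pM2l// !expr2; apply: ler_pM; rewrite ?mulr_ge0 ?nrm_ge0//.
  by apply: ler_pM; rewrite ?nrm_ge0//; [exact: le_trans gM|exact: le_trans gM].
by apply: ler_pM; rewrite ?nrm_ge0.
Qed.

(** The Lipschitz constant of [f43] is itself a weight; Cauchy-Schwarz with it puts one [NX] on each
    factor. The 6 is the 3 of [f43_lip] times the two summands of the weight. *)
Lemma f43_diff_le (M : R) g g' h : C0inf g -> C0inf g' -> C0inf h -> NX g <= M -> NX g' <= M ->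
  int2 (fun p => `|f43 (dx g p) * dx h p - f43 (dx g' p) * dx h p|) <=
  6 * (4 * M ^+ 2 + 1) * NX (fun p => g p - g' p) * NX h.
Proof.
move=> cg cg' ch gM gM'.
have c1 := C0inf_Cc (C0inf_dx cg); have c2 := C0inf_Cc (C0inf_dx cg').
have c3 := C0inf_Cc (C0inf_dx ch); have cd := C0infB cg cg'.
have c4 := C0inf_Cc (C0inf_dx cd).
pose rho p := pow43 (dx g p) + pow43 (dx g' p).
have crho : Cc rho by apply: CcD; exact: Cc_pow43.
have rho0 p : 0 <= rho p by rewrite addr_ge0 ?pow43_ge0.
pose w := dx (fun p => g p - g' p).
have cw : Cc w by [].
have K0 : 0 <= 2 * (4 * M ^+ 2 + 1) by rewrite mulr_ge0// addr_ge0// mulr_ge0// sqr_ge0.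
have W k : C0inf k ->
    Num.sqrt (int2 (fun p => rho p * `|dx k p| ^+ 2)) <= Num.sqrt (2 * (4 * M ^+ 2 + 1)) * NX k.
  move=> ck; have ck1 := Cc_sqr (C0inf_Cc (C0inf_dx ck)).
  rewrite -[X in _ * X](ger0_norm (NX_ge0 k)) -sqrtr_sqr -sqrtrM// ler_wsqrtr//.
  have -> : (fun p => rho p * `|dx k p| ^+ 2) =
     (fun p => pow43 (dx g p) * dx k p ^+ 2 + pow43 (dx g' p) * dx k p ^+ 2).
    by apply/funext => p; rewrite real_normK ?num_real// mulrDl.
  rewrite int2D; [|exact: CcMl (Cc_pow43 c1) ck1.1|exact: CcMl (Cc_pow43 c2) ck1.1].
  have := pow43_weight_le cg ck gM; have := pow43_weight_le cg' ck gM'; norm_lra.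
apply: (@le_trans _ _ (3 * int2 (fun p => rho p * (`|w p| * `|dx h p|)))).
  rewrite -int2Z; last by apply: CcMr; [exact: crho.1|exact: CcMl (Cc_norm cw) (Cc_norm c3).1].
  apply: le_int2.
  - apply/Cc_norm/CcB; [exact: CcMl (Cc_f43 c1) c3.1|exact: CcMl (Cc_f43 c2) c3.1].
  - by apply/CcZ/CcMr; [exact: crho.1|exact: CcMl (Cc_norm cw) (Cc_norm c3).1].
  - move=> p; rewrite -mulrBl normrM !mulrA ler_wpM2r//.
    by have := f43_lip (dx g' p) (dx g p); rewrite /w dxB// /rho [pow43 (dx g' p) + _]addrC.
have -> : 6 * (4 * M ^+ 2 + 1) * NX (fun p => g p - g' p) * NX h =
  3 * ((Num.sqrt (2 * (4 * M ^+ 2 + 1)) * NX (fun p => g p - g' p)) *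
       (Num.sqrt (2 * (4 * M ^+ 2 + 1)) * NX h)).
  set N1 := NX _; set N2 := NX _; set S := Num.sqrt _.
  have -> : 3 * (S * N1 * (S * N2)) = 3 * S ^+ 2 * N1 * N2 by ring.
  by rewrite /S sqr_sqrtr//; ring.
rewrite ler_pM2l//; apply: le_trans (ler_norm _) _.
apply: le_trans (CS_weighted crho.1 rho0 (Cc_norm cw) (Cc_norm c3)) _.
by apply: ler_pM; rewrite ?sqrtr_ge0//; exact: W.
Qed.

Lemma prod_diff_le a b c : Cc a -> Cc b -> Cc c ->
  int2 (fun p => `|a p * c p - b p * c p|) <= nrm (fun p => a p - b p) * nrm c.
Proof.
move=> ca cb cc; apply: le_trans (CS_norm (CcB ca cb) cc).
by under eq_fun do rewrite -mulrBl.
Qed.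

Lemma int2_diff_le h k (e : R) : Cc h -> Cc k -> int2 (fun p => `|h p - k p|) <= e ->
  `|int2 h - int2 k| <= e.
Proof.
move=> ch ck; rewrite -int2B//; apply: le_trans; apply: ler_norm_int2; exact: CcB.
Qed.

(** The constant does not depend on [psi], which later upgrades convergence for each test function
    to convergence in the dual norm. *)
Lemma dJ_lip (lam M : R) g g' psi : C0inf g -> C0inf g' -> C0inf psi -> NX g <= M -> NX g' <= M ->
  `|dJ lam g psi - dJ lam g' psi| <=
  (2 + `|lam| + 6 * (4 * M ^+ 2 + 1)) * (NX (fun p => g p - g' p) * NX psi).
Proof.
move=> cg cg' ch gM gM'; rewrite /dJ.
have c1 := C0inf_dx cg; have c1' := C0inf_dx cg'; have ch1 := C0inf_dx ch.
have c2 := C0inf_dx c1; have c2' := C0inf_dx c1'; have ch2 := C0inf_dx ch1.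
have c3 := C0inf_dy cg; have c3' := C0inf_dy cg'; have ch3 := C0inf_dy ch.
have [n1 n2 n3] := le_NX (fun p => g p - g' p); have [m1 m2 m3] := le_NX psi.
rewrite dxxB// in n1; rewrite dyB// in n2; rewrite dxB// in n3.
have H a b c : C0inf a -> C0inf b -> C0inf c ->
    nrm (fun p => a p - b p) <= NX (fun p => g p - g' p) -> nrm c <= NX psi ->
    `|int2 (fun p => a p * c p) - int2 (fun p => b p * c p)| <= NX (fun p => g p - g' p) * NX psi.
  move=> ca cb cc h1 h2; apply: (@le_trans _ _ (nrm (fun p => a p - b p) * nrm c)).
    apply: int2_diff_le; [exact: Cc_prod|exact: Cc_prod|].
    by apply: prod_diff_le; exact: C0inf_Cc.
  by apply: ler_pM; rewrite ?nrm_ge0.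
have h1 := H _ _ _ c2 c2' ch2 n1 m1; have h2 := H _ _ _ c3 c3' ch3 n2 m2.
have h3 := H _ _ _ c1 c1' ch1 n3 m3.
have h4 := int2_diff_le (CcMl (Cc_f43 (C0inf_Cc c1)) (C0inf_Cc ch1).1)
  (CcMl (Cc_f43 (C0inf_Cc c1')) (C0inf_Cc ch1).1) (f43_diff_le cg cg' ch gM gM').
move: h1 h2 h3 h4.
set A := int2 _; set A' := int2 _; set B := int2 _; set B' := int2 _; set C := int2 _; set C' := int2 _.
set D := int2 _; set D' := int2 _; set N := NX _ * _ => h1 h2 h3 h4.
have -> : A + B - lam * C - D - (A' + B' - lam * C' - D') =
  (A - A') + (B - B') - lam * (C - C') - (D - D') by ring.
have h5 : `|lam * (C - C')| <= `|lam| * N by rewrite normrM ler_wpM2l.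
have -> : (2 + `|lam| + 6 * (4 * M ^+ 2 + 1)) * N = N + N + `|lam| * N + 6 * (4 * M ^+ 2 + 1) * N by ring.
apply: le_trans (ler_normB _ _) _; apply: lerD; last by rewrite -mulrA in h4.
apply: le_trans (ler_normB _ _) _; apply: lerD => //.
by apply: le_trans (ler_normD _ _) _; apply: lerD.
Qed.

End Critical.

(** * From a weak solution to an almost critical sequence *)

Section WeakCritical.
Context {R : realType}.
Implicit Types (g h k psi : R * R -> R).

Lemma ae_leb2S (P Q : R * R -> Prop) : (forall p, P p -> Q p) ->
  {ae (@leb2 R), forall p, P p} -> {ae (@leb2 R), forall p, Q p}.
Proof.
by move=> PQ [A [mA A0 PA]]; exists A; split => // p nQ; apply: PA => Pp; apply: nQ; exact: PQ.
Qed.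

Lemma ae_leb2W (P : R * R -> Prop) : (forall p, P p) -> {ae (@leb2 R), forall p, P p}.
Proof.
move=> HP; exists set0; split; [exact: measurable0|exact: measure0|].
by move=> p /= nP; apply: nP; exact: HP.
Qed.

Definition cauchyX (g_ : nat -> R * R -> R) := forall e : R, 0 < e -> exists N, forall n m,
  (N <= n)%N -> (N <= m)%N -> NX (fun p => g_ n p - g_ m p) <= e.

Lemma real_cauchy (x : nat -> R) :
  (forall e : R, 0 < e -> exists N, forall n m, (N <= n)%N -> (N <= m)%N -> `|x n - x m| <= e) ->
  exists l : R, x n @[n --> \oo] --> l.
Proof.
move=> H; apply/cvg_ex; apply: cauchy_cvg; apply: cauchy_exP => e e0.
have [|N HN] := H (e / 2); first by rewrite divr_gt0.
exists (x N); exists N => // n /= Nn; rewrite /ball/=.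
by apply: le_lt_trans (HN _ _ (leqnn N) Nn) _; lra.
Qed.

(** For each [psi], [dJ lam (g_ n) psi] tends to the weak form of [u], which is 0; the Cauchy
    property and [dJ_lip] make this uniform in [psi]. *)
Lemma weak_critical (A lam : R) u : weak_solution (@f43 R) A u lam ->
  exists g_ : nat -> R * R -> R, [/\ forall n, C0inf (g_ n), cauchyX g_, exists M, forall n, NX (g_ n) <= M,
    (nrm (dx (g_ n)) ^+ 2) @[n --> \oo] --> A ^+ 2 &
    forall e : R, 0 < e -> exists N, forall n, (N <= n)%N ->
      forall psi, C0inf psi -> `|dJ lam (g_ n) psi| <= e * NX psi].
Proof.
move=> [[[s [sY [su sC]]] ua] weak].
have /choice[g0 g0P] n : exists g, C0inf g /\ s n = dx g.
  by have [g] := sY n; rewrite -dxE; exists g.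
have c0 n : C0inf (g0 n) by have [] := g0P n.
have C0 : cauchyX g0.
  move=> e e0; have [|N HN] := sC (e / 3); first by rewrite divr_gt0.
  exists N => n m Nn Nm; apply: le_trans (NX_le_innerX (C0infB (c0 n) (c0 m))) _.
  have := HN n m Nn Nm; rewrite (_ : s n \- s m = dx (fun p => g0 n p - g0 m p)); first lra.
  by rewrite dxB//; have [_ <-] := g0P n; have [_ <-] := g0P m.
have [N0 HN0] := C0 1 ltr01.
(* Passing to a tail with mutual distances at most 1 gives a bound valid for every index. *)
pose g_ n := g0 (n + N0)%N; have cg n : C0inf (g_ n) by exact: c0.
pose M := NX (g0 N0) + 1.
have gM n : NX (g_ n) <= M.
  have -> : g_ n = (fun p => (g_ n p - g0 N0 p) + g0 N0 p) by apply/funext => p; rewrite subrK.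
  apply: le_trans (NXD (C0infB (cg n) (c0 N0)) (c0 N0)) _.
  by have := HN0 (n + N0)%N N0 (leq_addl _ _) (leqnn _); rewrite /M /g_; lra.
have M0 : 0 <= M by exact: le_trans (NX_ge0 _) (gM 0%N).
have gC : cauchyX g_.
  move=> e e0; have [N HN] := C0 e e0; exists N => n m Nn Nm.
  by apply: HN; rewrite (leq_trans _ (leq_addr _ _)).
have gu : {ae (@leb2 R), forall p, dx (g_ n) p @[n --> \oo] --> u p}.
  apply: ae_leb2S su => p sp; rewrite /g_.
  have -> : (fun n => dx (g0 (n + N0)%N) p) = (fun n => s (n + N0)%N p).
    by apply/funext => n; have [_ ->] := g0P (n + N0)%N.
  by have := cvg_comp _ _ (cvg_addnr N0) sp.
exists g_; split => //; first by exists M.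
  have E n : nrm (dx (g_ n)) ^+ 2 = int2 (fun p => dx (g_ n) p ^+ 2) by rewrite nrm_sqr.
  under eq_fun do rewrite E.
  rewrite -ua; apply: int2_cvg.
  - by move=> n; apply/Cc_sqr/C0inf_Cc/C0inf_dx.
  - apply: ae_leb2S gu => p; rewrite /= expr2 => h.
    by under eq_fun do rewrite expr2; exact: cvgM.
  move=> e e0; have [|N HN] := gC (e / (2 * M + 1)); first by rewrite divr_gt0// ltr_wpDl// mulr_ge0.
  exists N => n m Nn Nm.
  have c1 := C0inf_Cc (C0inf_dx (cg n)); have c2 := C0inf_Cc (C0inf_dx (cg m)).
  (* A difference of squares is difference times sum, so an L^2 Cauchy sequence has squares that are
     Cauchy in L^1. *)
  have := CS_norm (CcB c1 c2) (CcD c1 c2).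
  under eq_fun do rewrite -subr_sqr.
  move=> /le_trans; apply.
  apply: (@le_trans _ _ (e / (2 * M + 1) * (2 * M + 1))); last by rewrite divfK// gt_eqF// ltr_wpDl// mulr_ge0.
  apply: ler_pM; rewrite ?nrm_ge0//.
    have [_ _ h] := le_NX (fun p => g_ n p - g_ m p); rewrite dxB// in h.
    exact: le_trans h (HN _ _ Nn Nm).
  apply: le_trans (nrmD c1 c2) _; have [_ _ h] := le_NX (g_ n); have [_ _ h'] := le_NX (g_ m).
  by have := gM n; have := gM m; lra.
have pointwise psi : C0inf psi -> dJ lam (g_ n) psi @[n --> \oo] --> 0.
  move=> cp; have cp1 := C0inf_Cc (C0inf_dx cp).
  have ipsi : approxX (dx psi) (fun=> dx psi).
    split; first by move=> _; exists psi; rewrite dxE.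
    split; first by apply: ae_leb2W => p; exact: cvg_cst.
    move=> e e0; exists 0%N => _ _ _ _.
    rewrite (_ : dx psi \- dx psi = dx (fun p => psi p - psi p)).
      rewrite innerX_dx; last exact: C0infB.
      have Z k : nrm (fun p : R * R => k p - k p) = 0.
        rewrite nrmE (_ : (fun _ => _) = cst 0); first by rewrite /int2 Rintegral_cst// mul0r sqrtr0.
        by apply/funext => p; rewrite subrr expr0n.
      by rewrite dxxB// dxB// dyB// !Z expr0n !addr0 sqrtr0.
    by rewrite dxB.
  have iu : approxX u (fun n => dx (g_ n)).
    split; first by move=> n; exists (g_ n); rewrite dxE.
    split => // e e0; have [N HN] := sC e e0; exists N => j k Nj Nk.
    have [_ <-] := g0P (j + N0)%N; have [_ <-] := g0P (k + N0)%N.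
    by apply: HN; rewrite (leq_trans _ (leq_addr _ _)).
  have K1 : 0 < NX psi + 1 by rewrite ltr_wpDl// NX_ge0.
  (* [T] stands in turn for [dx (dx _)], [dy] and [dx]. *)
  have cauchy_prod (T : (R * R -> R) -> R * R -> R) :
      (forall k, C0inf k -> C0inf (T k)) ->
      (forall k k', C0inf k -> C0inf k' -> nrm (fun p => T k p - T k' p) <= NX (fun p => k p - k' p)) ->
      nrm (T psi) <= NX psi ->
      forall e : R, 0 < e -> exists N, forall n m, (N <= n)%N -> (N <= m)%N ->
      int2 (fun p => `|T (g_ n) p * T psi p - T (g_ m) p * T psi p|) <= e.
    move=> cT TN Tpsi e e0; have [|N HN] := gC (e / (NX psi + 1)); first by rewrite divr_gt0.
    exists N => n m Nn Nm.
    apply: le_trans (prod_diff_le (C0inf_Cc (cT _ (cg n))) (C0inf_Cc (cT _ (cg m))) (C0inf_Cc (cT _ cp))) _.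
    apply: (@le_trans _ _ (e / (NX psi + 1) * (NX psi + 1))); last by rewrite divfK// gt_eqF.
    apply: ler_pM; rewrite ?nrm_ge0//; first exact: le_trans (TN _ _ (cg n) (cg m)) (HN _ _ Nn Nm).
    by apply: le_trans Tpsi _; rewrite lerDl.
  have cpp n T : (forall k, C0inf k -> C0inf (T k)) -> Cc (fun p => T (g_ n) p * T psi p).
    by move=> cT; apply: Cc_prod; apply: cT.
  have [p1 p2 p3] := le_NX psi.
  have Cxx := @cauchy_prod (fun k => dx (dx k)) (fun k ck => C0inf_dx (C0inf_dx ck))
    (fun k k' ck ck' => ltac:(by rewrite -dxxB//; have [] := le_NX (fun p => k p - k' p))) p1.
  have Cy := @cauchy_prod (@dy R) (@C0inf_dy R)
    (fun k k' ck ck' => ltac:(by rewrite -dyB//; have [] := le_NX (fun p => k p - k' p))) p2.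
  have Cx := @cauchy_prod (@dx R) (@C0inf_dx R)
    (fun k k' ck ck' => ltac:(by rewrite -dxB//; have [] := le_NX (fun p => k p - k' p))) p3.
  have lim_of (T : (R * R -> R) -> R * R -> R) : (forall k, C0inf k -> C0inf (T k)) ->
      (forall e : R, 0 < e -> exists N, forall n m, (N <= n)%N -> (N <= m)%N ->
      int2 (fun p => `|T (g_ n) p * T psi p - T (g_ m) p * T psi p|) <= e) ->
      exists l : R, int2 (fun p => T (g_ n) p * T psi p) @[n --> \oo] --> l.
    move=> cT CT; apply: real_cauchy => e e0; have [N HN] := CT e e0; exists N => n m Nn Nm.
    by apply: int2_diff_le; [exact: cpp|exact: cpp|exact: HN].
  (* Only the existence of these two limits matters, since [inner0X] is itself a limit along
     approximating sequences. The next two limits are identified with integrals of [u]. *)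
  have [l1 L1] := lim_of _ (fun k ck => C0inf_dx (C0inf_dx ck)) Cxx.
  have [l2 L2] := lim_of _ (@C0inf_dy R) Cy.
  have L3 : int2 (fun p => dx (g_ n) p * dx psi p) @[n --> \oo] --> int2 (fun p => u p * dx psi p).
    apply: int2_cvg Cx => [n|]; first by apply: cpp; exact: C0inf_dx.
    by apply: ae_leb2S gu => p h; apply: cvgM => //; exact: cvg_cst.
  have L4 : int2 (fun p => f43 (dx (g_ n) p) * dx psi p) @[n --> \oo] -->
            int2 (fun p => f43 (u p) * dx psi p).
    apply: int2_cvg => [n||].
    - by apply: CcMl; [apply/Cc_f43/C0inf_Cc/C0inf_dx|exact: cp1.1].
    - apply: ae_leb2S gu => p h; apply: cvgM; last exact: cvg_cst.
      exact: (@cvg_comp _ _ _ _ (@f43 R) _ _ _ h (@f43_continuous R (u p))).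
    move=> e e0; set K := 6 * (4 * M ^+ 2 + 1).
    have K0 : 0 <= K by rewrite mulr_ge0// addr_ge0// mulr_ge0// sqr_ge0.
    have KK : 0 < K * NX psi + 1 by rewrite ltr_wpDl// mulr_ge0// NX_ge0.
    have [|N HN] := gC (e / (K * NX psi + 1)); first by rewrite divr_gt0.
    exists N => n m Nn Nm; apply: le_trans (f43_diff_le (cg n) (cg m) cp (gM n) (gM m)) _.
    rewrite -/K mulrAC mulrC.
    apply: (@le_trans _ _ (e / (K * NX psi + 1) * (K * NX psi + 1))); last by rewrite divfK// gt_eqF.
    apply: ler_pM; [exact: NX_ge0|by rewrite mulr_ge0// NX_ge0|exact: HN|by rewrite lerDl].
  have iL : inner0X u (dx psi) (l1 + l2).
    exists (fun n => dx (g_ n)), (fun=> dx psi); split => //; split => //.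
    under eq_fun do rewrite inner0_dx//.
    exact: cvgD.
  have E := weak _ (ex_intro _ _ ipsi) _ iL.
  rewrite /dJ -E; apply: cvgB => //; apply: cvgB; first exact: cvgD.
  by apply: cvgM => //; exact: cvg_cst.
move=> e e0; set K := 2 + `|lam| + 6 * (4 * M ^+ 2 + 1).
have K0 : 0 < K by rewrite /K; have := sqr_ge0 M; have := normr_ge0 lam; lra.
have [|N HN] := gC (e / K); first by rewrite divr_gt0.
exists N => n Nn psi cp.
(* Since the value at [g_ m] tends to 0 in [m], the value at [g_ n] is the limit of the differences,
   and these are bounded uniformly in [psi]. *)
have lim0 : `|dJ lam (g_ n) psi - dJ lam (g_ m) psi| @[m --> \oo] --> `|dJ lam (g_ n) psi - 0|.
  by apply: cvg_norm; apply: cvgB; [exact: cvg_cst|exact: pointwise].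
rewrite -[X in `|X|]subr0 -(cvg_lim (@Rhausdorff R) lim0); apply: limr_le.
  by apply/cvg_ex; eexists; exact: lim0.
near=> m; apply: le_trans (dJ_lip lam (cg n) (cg m) cp (gM n) (gM m)) _.
rewrite -/K mulrA ler_wpM2r ?NX_ge0// mulrC -ler_pdivlMr//; apply: HN => //.
by near: m; exists N.
Unshelve. all: by end_near. Qed.

End WeakCritical.

(** * Difference quotients *)
Section Differences.
Context {R : realType}.
Implicit Types (g q r : R * R -> R) (d : bool) (t h : R).

Lemma Cc_continuous q : Cc q -> continuous q. Proof. by case. Qed.

Lemma transl_continuous d t q : continuous q -> continuous (transl d t q).
Proof.
case: d => cq; first exact: tx_continuous.
by have := swap_continuous2 (tx_continuous (a := t) (swap_continuous2 cq)).
Qed.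

Definition axis d (p : R * R) : R := if d then p.1 else p.2.

Lemma mean_value (f df : R -> R) (x t : R) : (forall x : R, is_derive x 1 f (df x)) ->
  exists2 u, `|u| <= `|t| & f (x + t) - f x = t * df (x + u).
Proof.
move=> dF; have [t0|t0|->] := ltgtP t 0; last by exists 0; rewrite ?normr0// addr0 mul0r subrr.
- have [|c /andP[c1 c2] E] := @MVT1 _ f df (x + t) x dF; first by rewrite gtrDl.
  exists (c - x); first by rewrite !ltr0_norm//; lra.
  by rewrite [x + (c - x)]addrC subrK -opprB E; ring.
- have [|c /andP[c1 c2] E] := @MVT1 _ f df x (x + t) dF; first by rewrite ltrDl.
  exists (c - x); first by rewrite !gtr0_norm//; lra.
  by rewrite [x + (c - x)]addrC subrK E; ring.
Qed.

Lemma transl_mean_value d g t p : C0inf g ->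
  exists2 u, `|u| <= `|t| & transl d t g p - g p = t * transl d u (der d g) p.
Proof.
move=> /C0inf_smooth sg; case: d; case: p => x y; rewrite /transl /tx /ty /der/=.
- exact: (@mean_value (fun v => g (v, y)) (fun v => dx g (v, y)) x t (fun v => dx_dX sg (v, y))).
- exact: (@mean_value (fun v => g (x, v)) (fun v => dy g (x, v)) y t (fun v => dy_dY sg (x, v))).
Qed.

Lemma der_le_transl d g (K t : R) p : C0inf g -> (forall p, `|der d g p| <= K) ->
  `|transl d t g p - g p| <= K * `|t|.
Proof.
move=> cg gK; have [u _ ->] := transl_mean_value d t p cg.
by rewrite normrM mulrC ler_wpM2r//; case: d gK => gK; exact: gK.
Qed.

Lemma supp_in_transl d g (M t : R) : supp_in M g -> `|t| <= 1 -> supp_in (M + 1) (transl d t g).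
Proof.
move=> gM t1 p pM; case: d; rewrite /transl /tx /ty; apply: gM => /=.
- case: pM => pM; [left|right; lra].
  by have := ler_normD (p.1 + t) (- t); rewrite addrK normrN; lra.
- case: pM => pM; [left; lra|right].
  by have := ler_normD (p.2 + t) (- t); rewrite addrK normrN; lra.
Qed.

Lemma supp_in_der d g (M : R) : C0inf g -> supp_in M g -> supp_in M (der d g).
Proof.
move=> /C0inf_smooth sg; case: d; first exact: (supp_in_dX (dx_dX sg)).
exact: (supp_in_dY (dy_dY sg)).
Qed.

(** [C] depends on the second derivatives and the support of [g], hence is not uniform along a
    sequence; it is applied to a fixed member or made to disappear by subdivision. *)
Lemma taylor_remainder d g : C0inf g -> exists2 C : R, 0 <= C &
  forall t, `|t| <= 1 -> nrm (fun p => transl d t g p - g p - t * der d g p) <= C * t ^+ 2.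
Proof.
move=> cg; have c1 := C0inf_der d cg; have c2 := C0inf_der d c1.
have [K K0 gK] := Cc_bounded (C0inf_Cc c2).
have [_ [M gM]] := (C0infE g).1 cg.
have gM' : supp_in (`|M| + 1) g.
  by move=> p pM; apply: gM; have := ler_norm M; case: pM => ?; [left|right]; lra.
have M0 : 0 <= `|M| + 1 + 1 by rewrite !addr_ge0.
exists (K * (2 * (`|M| + 1 + 1))) => [|t t1]; first by rewrite !mulr_ge0.
rewrite mulrAC; apply: nrm_bound => //.
- by apply: CcB; [apply: CcB; apply: C0inf_Cc => //; exact: C0inf_transl|apply/CcZ/C0inf_Cc].
- by rewrite mulr_ge0 ?sqr_ge0.
- move=> p; have [u ut ->] := transl_mean_value d t p cg.
  rewrite -mulrBr normrM -(real_normK (num_real t)) expr2 mulrCA ler_wpM2l//.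
  by apply: le_trans (der_le_transl u p c1 gK) _; rewrite ler_wpM2l.
- move=> p pM; rewrite (supp_in_transl d gM' t1 pM).
  have pM' : (`|M| + 1 < `|p.1|) \/ (`|M| + 1 < `|p.2|) by case: pM => ?; [left|right]; lra.
  by rewrite gM'// (supp_in_der d cg gM')// mulr0 !subr0.
Qed.

(** The translation is cut into n equal steps. Each has a Taylor error C (t/n)^2, so the total error
    C t^2 / n vanishes and the constant of [taylor_remainder] does not survive. *)
Lemma nrm_transl_sub d g t : C0inf g ->
  nrm (fun p => transl d t g p - g p) <= `|t| * nrm (der d g).
Proof.
move=> cg; have [C C0 HC] := taylor_remainder d cg.
have cgt u : Cc (transl d u g) by apply: C0inf_Cc; exact: C0inf_transl.
have c1 := C0inf_Cc cg; have c2 := C0inf_Cc (C0inf_der d cg).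
have sub n u : nrm (fun p => transl d (n%:R * u) g p - g p) <= n%:R * nrm (fun p => transl d u g p - g p).
  elim: n => [|n IH].
    rewrite !mul0r transl0 (@eq_nrm _ _ (fun p => 0 * g p)) => [|p]; last by rewrite subrr mul0r.
    by rewrite nrmZ// normr0 mul0r.
  rewrite -natr1 !mulrDl !mul1r.
  rewrite (@eq_nrm _ _ (fun p => (transl d (n%:R * u) (transl d u g) p - transl d (n%:R * u) g p) +
     (transl d (n%:R * u) g p - g p))) => [|p]; last by rewrite transl_transl; ring.
  apply: le_trans (nrmD _ _) _; [by apply: CcB => //; exact: Cc_transl|exact: CcB|].
  rewrite addrC lerD// -translB nrm_transl//; exact: CcB.
apply/ler_addgt0Pr => e e0; have t2 := sqr_ge0 t.
(* Large enough for both |t| / n <= 1 and C t^2 / n <= e. *)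
pose n := (Num.truncn (`|t| + C * t ^+ 2 / e)).+1.
have n0 : 0 < n%:R :> R by rewrite ltr0n.
have nT : `|t| + C * t ^+ 2 / e < n%:R.
  by rewrite /n truncnS_gt.
have e1 : 0 <= C * t ^+ 2 / e by apply: divr_ge0; [exact: mulr_ge0|exact: ltW].
have tn : t = n%:R * (t / n%:R) by rewrite mulrC divfK// gt_eqF.
have tn1 : `|t / n%:R| <= 1.
  by rewrite normrM normfV (gtr0_norm n0) ler_pdivrMr// mul1r; lra.
rewrite {1}tn; apply: le_trans (sub n _) _.
apply: (@le_trans _ _ (n%:R * (C * (t / n%:R) ^+ 2 + `|t / n%:R| * nrm (der d g)))).
  rewrite ler_pM2l//; apply: le_trans (lerD (HC _ tn1) (lexx _)).
  rewrite -nrmZ//.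
  rewrite (@eq_nrm _ _ (fun p => (transl d (t / n%:R) g p - g p - t / n%:R * der d g p) +
    t / n%:R * der d g p)) => [|p]; last by rewrite subrK.
  by apply: nrmD; [apply: CcB; [exact: CcB|exact: CcZ]|exact: CcZ].
rewrite mulrDr addrC normrM normfV (gtr0_norm n0); apply: lerD.
  by rewrite mulrA [_ * (_ / _)]mulrC divfK// gt_eqF.
have -> : n%:R * (C * (t / n%:R) ^+ 2) = C * t ^+ 2 / n%:R by field; rewrite gt_eqF.
rewrite ler_pdivrMr// -ler_pdivrMl// mulrC; have := normr_ge0 t; lra.
Qed.

(** The symmetric quotient is antisymmetric for the L^2 pairing, as a derivative is; this makes
    quadratic terms telescope. *)
Definition Dq d h g : R * R -> R := fun p => (2 * h)^-1 * (transl d h g p - transl d (- h) g p).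

Lemma Cc_Dq d h q : Cc q -> Cc (Dq d h q).
Proof. by move=> cq; apply/CcZ/CcB; exact: Cc_transl. Qed.

Lemma C0inf_Dq d h g : C0inf g -> C0inf (Dq d h g).
Proof. by move=> cg; apply/C0infZ/C0infB; exact: C0inf_transl. Qed.

Lemma der_Dq d d' h g : C0inf g -> der d (Dq d' h g) = Dq d' h (der d g).
Proof.
move=> cg; rewrite /Dq derZ; last by apply: C0infB; exact: C0inf_transl.
rewrite derB; [|exact: C0inf_transl|exact: C0inf_transl].
by rewrite !der_transl.
Qed.

Lemma DqB d h q r p : Dq d h (fun p => q p - r p) p = Dq d h q p - Dq d h r p.
Proof. by rewrite /Dq !translB; ring. Qed.

Lemma nrm_Dq d h g : C0inf g -> 0 < h -> nrm (Dq d h g) <= nrm (der d g).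
Proof.
move=> cg h0; have ct u : Cc (fun p => transl d u g p - g p).
  by apply: CcB; apply: C0inf_Cc => //; exact: C0inf_transl.
rewrite (@eq_nrm _ _ (fun p => (2 * h)^-1 *
   ((transl d h g p - g p) - (transl d (- h) g p - g p)))) => [|p]; last by rewrite /Dq; ring.
have h2 : 0 < 2 * h by rewrite mulr_gt0.
rewrite nrmZ; last exact: CcB.
rewrite gtr0_norm ?invr_gt0// ler_pdivrMl//; apply: le_trans (nrmB (ct _) (ct _)) _.
apply: le_trans (lerD (nrm_transl_sub d h cg) (nrm_transl_sub d (- h) cg)) _.
by rewrite normrN gtr0_norm// -mulrA mulr_natl mulr2n.
Qed.

(** For functions such as g_xx, whose derivatives are not controlled. The factor 1/h is harmless
    because n tends to infinity before h tends to 0. *)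
Lemma nrm_Dq_le d h q : Cc q -> 0 < h -> nrm (Dq d h q) <= h^-1 * nrm q.
Proof.
move=> cq h0; have h2 : 0 < 2 * h by rewrite mulr_gt0.
rewrite /Dq nrmZ; last by apply: CcB; exact: Cc_transl.
rewrite gtr0_norm ?invr_gt0// ler_pdivrMl//.
apply: le_trans (nrmB (Cc_transl _ _ cq) (Cc_transl _ _ cq)) _; rewrite !nrm_transl//.
by rewrite mulrA -[2 * h * _]mulrA divff ?gt_eqF// mulr1 mulr_natl mulr2n.
Qed.

Lemma nrm_Dq_sub d g : C0inf g -> exists2 C : R, 0 <= C &
  forall h, 0 < h -> h <= 1 -> nrm (fun p => Dq d h g p - der d g p) <= C * h.
Proof.
move=> cg; have [C C0 HC] := taylor_remainder d cg; exists C => // h h0 h1.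
have c2 := C0inf_Cc (C0inf_der d cg).
have ct u : Cc (fun p => transl d u g p - g p - u * der d g p).
  apply: CcB; last exact: CcZ.
  by apply: CcB; apply: C0inf_Cc => //; exact: C0inf_transl.
have h2 : 0 < 2 * h by rewrite mulr_gt0.
rewrite (@eq_nrm _ _ (fun p => (2 * h)^-1 * ((transl d h g p - g p - h * der d g p) -
   (transl d (- h) g p - g p - (- h) * der d g p)))) => [|p]; last first.
  by rewrite /Dq; field; rewrite gt_eqF.
rewrite nrmZ; last exact: CcB.
rewrite gtr0_norm ?invr_gt0// ler_pdivrMl//; apply: le_trans (nrmB (ct _) (ct _)) _.
have := HC h; have := HC (- h); rewrite normrN gtr0_norm// sqrrN => /(_ h1) a1 /(_ h1) a2.
have -> : 2 * h * (C * h) = C * h ^+ 2 + C * h ^+ 2 by ring.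
exact: lerD.
Qed.

End Differences.

(** * Discrete integration by parts and the convexity remainder *)

Section Estimates.
Context {R : realType}.
Implicit Types (b g q r s W omega Z psi : R * R -> R) (d : bool).

Lemma continuousB2 (x y : R * R -> R) : continuous x -> continuous y -> continuous (fun p => x p - y p).
Proof. by move=> cx cy p; apply: cvgB; [exact: cx|exact: cy]. Qed.

Lemma continuousZ2 (t : R) (x : R * R -> R) : continuous x -> continuous (fun p => t * x p).
Proof. by move=> cx p; apply: cvgM; [exact: cvg_cst|exact: cx]. Qed.

Lemma continuous_norm2 (x : R * R -> R) : continuous x -> continuous (fun p => `|x p|).
Proof. by move=> cx p; apply: cvg_norm; exact: cx. Qed.

(** Two errors are separated: replacing the weight [omega], later close to a cosine of small
    frequency, by 1, and replacing [r], later a translate or difference quotient, by its limit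
    [q]. *)
Lemma product_est b omega q r : continuous b -> (forall p, 0 <= b p) ->
  continuous omega -> (forall p, `|omega p| <= 1) -> Cc q -> Cc r ->
  `|int2 (fun p => omega p * (b p * (q p * r p))) - int2 (fun p => b p * q p ^+ 2)| <=
  int2 (fun p => `|1 - omega p| * (b p * q p ^+ 2)) +
  Num.sqrt (int2 (fun p => b p * q p ^+ 2)) *
  Num.sqrt (int2 (fun p => b p * (r p - q p) ^+ 2)).
Proof.
move=> cb b0 co o1 cq cr.
have c1 : Cc (fun p => omega p * (b p * (q p * r p))).
  by apply: CcMr => //; apply: CcMr => //; apply: CcMr; [exact: Cc_continuous|].
have c2 : Cc (fun p => b p * q p ^+ 2) by apply: CcMr => //; exact: Cc_sqr.
have c3 : Cc (fun p => `|1 - omega p| * (b p * q p ^+ 2)).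
  apply: CcMr c2; apply: continuous_norm2; apply: continuousB2 co.
  exact: (@cst_continuous _ _ (1 : R)).
have cn : Cc (fun p => `|q p|) by exact: Cc_norm.
have cd : Cc (fun p => `|r p - q p|) by apply/Cc_norm/CcB.
have c4 : Cc (fun p => b p * (`|q p| * `|r p - q p|)).
  by apply: CcMr => //; apply: CcMr; [exact: Cc_continuous|].
rewrite -(int2B c1 c2); apply: le_trans (ler_norm_int2 (CcB c1 c2)) _.
apply: (@le_trans _ _ (int2 (fun p => `|1 - omega p| * (b p * q p ^+ 2) +
    b p * (`|q p| * `|r p - q p|)))).
  apply: le_int2 => [||p]; [exact/Cc_norm/CcB|exact: CcD|].
  have -> : omega p * (b p * (q p * r p)) - b p * q p ^+ 2 =
    omega p * (b p * (q p * (r p - q p))) - (1 - omega p) * (b p * q p ^+ 2) by ring.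
  apply: le_trans (ler_normB _ _) _; rewrite addrC; apply: lerD.
    by rewrite normrM (ger0_norm (mulr_ge0 (b0 p) (sqr_ge0 (q p)))).
  rewrite normrM (normrM (b p)) (ger0_norm (b0 p)) normrM.
  by rewrite ler_piMl// mulr_ge0// mulr_ge0.
rewrite (int2D c3 c4) lerD2l; apply: le_trans (ler_norm _) _.
apply: le_trans (CS_weighted cb b0 cn cd) _.
have E x : (fun p => b p * `|x p| ^+ 2) = (fun p => b p * x p ^+ 2 :> R).
  by apply/funext => p; rewrite real_normK// num_real.
by rewrite (E q) (E (fun p => r p - q p)).
Qed.

Lemma product_est1 omega q r :
  continuous omega -> (forall p, `|omega p| <= 1) -> Cc q -> Cc r ->
  `|int2 (fun p => omega p * (q p * r p)) - nrm q ^+ 2| <=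
  int2 (fun p => `|1 - omega p| * q p ^+ 2) + nrm q * nrm (fun p => r p - q p).
Proof.
move=> co o1 cq cr.
have := product_est (@cst_continuous _ _ (1 : R)) (fun=> ler01) co o1 cq cr.
have E (x : R * R -> R) : (fun p => 1 * x p) = x by apply/funext => p; rewrite mul1r.
have -> : (fun p => omega p * (1 * (q p * r p))) = (fun p => omega p * (q p * r p)).
  by apply/funext => p; rewrite mul1r.
have -> : (fun p => `|1 - omega p| * (1 * q p ^+ 2)) = (fun p => `|1 - omega p| * q p ^+ 2).
  by apply/funext => p; rewrite mul1r.
by rewrite (E (fun p => q p ^+ 2)) (E (fun p => (r p - q p) ^+ 2)) nrm_sqr !nrmE.
Qed.

(** The exact discrete form of int Z q q' = - 1/2 int Z' q^2: translating the backward term by [h]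
    turns it into the forward one with [Z] translated. *)
Lemma shift_est d (h : R) Z q : continuous Z -> Cc q -> 0 < h ->
  int2 (fun p => Z p * (q p * Dq d h q p)) =
  - 2^-1 * int2 (fun p => (h^-1 * (transl d h Z p - Z p)) * (q p * transl d h q p)).
Proof.
move=> cZ cq h0; have ct u := Cc_transl d u cq.
have cp u : Cc (fun p => q p * transl d u q p) by apply: CcMr; [exact: Cc_continuous|].
have czp u : Cc (fun p => Z p * (q p * transl d u q p)) by exact: CcMr.
have ctz : Cc (fun p => transl d h Z p * (q p * transl d h q p)).
  by apply: CcMr => //; exact: transl_continuous.
have -> : (fun p => Z p * (q p * Dq d h q p)) = (fun p => (2 * h)^-1 *
   (Z p * (q p * transl d h q p) - Z p * (q p * transl d (- h) q p))).
  by apply/funext => p; rewrite /Dq; ring.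
have -> : (fun p => (h^-1 * (transl d h Z p - Z p)) * (q p * transl d h q p)) =
   (fun p => h^-1 * (transl d h Z p * (q p * transl d h q p) - Z p * (q p * transl d h q p))).
  by apply/funext => p; ring.
rewrite (int2Z _ (CcB (czp h) (czp (- h)))) (int2Z _ (CcB ctz (czp h))).
rewrite (int2B (czp h) (czp (- h))) (int2B ctz (czp h)).
rewrite -(int2_transl d h (czp (- h))) !translM transl_transl subrr transl0.
have -> : (fun p => transl d h Z p * (transl d h q p * q p)) =
  (fun p => transl d h Z p * (q p * transl d h q p)).
  by apply/funext => p; ring.
by field; rewrite gt_eqF.
Qed.

(** The integrated bound of [F43_taylor] for a translation by [t], without its factor 3. *)
Definition remainder d (t : R) s : R := int2 (fun p =>
  (pow43 (s p) + pow43 (transl d t s p)) * (transl d t s p - s p) ^+ 2).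

Lemma Cc_F43 s : Cc s -> Cc (fun p => F43 (s p)).
Proof.
move=> cs; rewrite /F43; apply/CcZ/CcMl; first exact: Cc_pow43.
exact: (Cc_continuous (Cc_sqr cs)).
Qed.

Lemma Cc_remainder d (t : R) s : Cc s -> Cc (fun p =>
  (pow43 (s p) + pow43 (transl d t s p)) * (transl d t s p - s p) ^+ 2).
Proof.
move=> cs; have ct := Cc_transl d t cs.
apply: CcMl; first by apply: CcD; exact: Cc_pow43.
by apply/Cc_continuous/Cc_sqr/CcB.
Qed.

(** The discrete form of int Z F43(s)' = - int Z' F43(s). Translations move exactly from [Z] to
    [F43 (s)]; what is left are the forward and backward Taylor errors. *)
Lemma nonlinear_est d (h K : R) Z s : continuous Z -> (forall p, `|Z p| <= K) -> Cc s -> 0 < h ->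
  `|int2 (fun p => Z p * (f43 (s p) * Dq d h s p)) +
    int2 (fun p => ((2 * h)^-1 * (transl d h Z p - transl d (- h) Z p)) * F43 (s p))| <=
  (2 * h)^-1 * (K * (3 * (remainder d h s + remainder d (- h) s))).
Proof.
move=> cZ ZK cs h0; have ct u := Cc_transl d u cs.
have h2 : 0 < (2 * h)^-1 by rewrite invr_gt0 mulr_gt0.
have K0 : 0 <= K by exact: le_trans (ZK (0, 0)).
have cZF u : Cc (fun p => Z p * F43 (transl d u s p)) by apply: CcMr => //; exact: Cc_F43.
have ctZ u : Cc (fun p => transl d u Z p * F43 (s p)).
  by apply: CcMr; [exact: transl_continuous|exact: Cc_F43].
have move u : int2 (fun p => transl d u Z p * F43 (s p)) =
    int2 (fun p => Z p * F43 (transl d (- u) s p)).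
  rewrite -(int2_transl d (- u) (ctZ u)) translM transl_transl addNr transl0.
  by rewrite (translE d (- u) (@F43 R)).
have cfD : Cc (fun p => Z p * (f43 (s p) * Dq d h s p)).
  by apply: CcMr => //; apply: CcMl; [exact: Cc_f43|exact/Cc_continuous/Cc_Dq].
pose E u p := F43 (transl d u s p) - F43 (s p) - f43 (s p) * (transl d u s p - s p).
have cE u : Cc (E u).
  apply: CcB; first by apply: CcB; exact: Cc_F43.
  by apply: CcMl; [exact: Cc_f43|apply/Cc_continuous/CcB].
have -> : int2 (fun p => ((2 * h)^-1 * (transl d h Z p - transl d (- h) Z p)) * F43 (s p)) =
  int2 (fun p => (2 * h)^-1 * (Z p * F43 (transl d (- h) s p) - Z p * F43 (transl d h s p))).
  rewrite (int2Z _ (CcB (cZF (- h)) (cZF h))) (int2B (cZF (- h)) (cZF h)).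
  have m1 := move h; have m2 := move (- h); rewrite opprK in m2.
  rewrite -m1 -m2 -(int2B (ctZ h) (ctZ (- h))) -(int2Z _ (CcB (ctZ h) (ctZ (- h)))).
  by congr int2; apply/funext => p; ring.
rewrite -(int2D cfD (CcZ _ (CcB (cZF (- h)) (cZF h)))).
have -> : (fun p => Z p * (f43 (s p) * Dq d h s p) +
    (2 * h)^-1 * (Z p * F43 (transl d (- h) s p) - Z p * F43 (transl d h s p))) =
  (fun p => (2 * h)^-1 * (Z p * (E (- h) p - E h p))).
  by apply/funext => p; rewrite /E /Dq; ring.
have cZE : Cc (fun p => Z p * (E (- h) p - E h p)) by apply: CcMr => //; exact: CcB.
rewrite (int2Z _ cZE) normrM (gtr0_norm h2) ler_pM2l//.
apply: le_trans (ler_norm_int2 cZE) _.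
have cr1 := Cc_remainder d h cs; have cr2 := Cc_remainder d (- h) cs.
rewrite /remainder -(int2D cr1 cr2) -(int2Z _ (CcD cr1 cr2)) -(int2Z _ (CcZ 3 (CcD cr1 cr2))).
apply: le_int2 => [||p]; [exact: Cc_norm|by do 2 apply: CcZ; exact: CcD|].
rewrite normrM; apply: ler_pM => //; apply: le_trans (ler_normB _ _) _.
rewrite mulrDr addrC; apply: lerD; exact: F43_taylor.
Qed.

(** For an increment [W] of step h, the factor [W] is O(h) and [dx (dx W)] is o(1), so [dx W] gains
    a half power of h although g_xy is not controlled. *)
Lemma ibp_norm W : C0inf W -> nrm (dx W) ^+ 2 <= nrm W * nrm (dx (dx W)).
Proof.
move=> cW; have c1 := C0inf_dx cW; have c2 := C0inf_dx c1.
have p1 := Cc_prod c1 c1; have p2 := Cc_prod cW c2.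
have E : int2 (fun p => dx W p * dx W p + W p * dx (dx W) p) = 0.
  apply: int2_dX (Cc_prod cW c1) (CcD p1 p2) _.
  exact: dX_M (dx_dX (C0inf_smooth cW)) (dx_dX (C0inf_smooth c1)).
rewrite (int2D p1 p2) in E.
have -> : nrm (dx W) ^+ 2 = - int2 (fun p => W p * dx (dx W) p).
  rewrite nrm_sqr; have -> : (fun p => dx W p ^+ 2) = (fun p => dx W p * dx W p) by [].
  by apply/eqP; rewrite -addr_eq0 E.
apply: le_trans (ler_norm _) _; rewrite normrN; apply: CS; exact: C0inf_Cc.
Qed.

Lemma dJ_transl lam d (t : R) g psi : C0inf g -> C0inf psi ->
  dJ lam (transl d t g) psi = dJ lam g (transl d (- t) psi).
Proof.
move=> cg cp; have c1 := C0inf_dx cg; have p1 := C0inf_dx cp.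
have H (phi : R -> R) x y : Cc (fun p => phi (x p)) -> C0inf y ->
    int2 (fun p => phi (transl d t x p) * y p) = int2 (fun p => phi (x p) * transl d (- t) y p).
  move=> cx cy; rewrite -[in RHS](int2_transl d t); last first.
    by apply: CcMl => //; apply/Cc_continuous/Cc_transl/C0inf_Cc.
  by rewrite translM (translE d t phi) transl_transl subrr transl0.
rewrite /dJ !dx_transl// !dy_transl//.
rewrite (H id (dx (dx g)))//; [|exact/C0inf_Cc/C0inf_dx|exact: C0inf_dx].
rewrite (H id (dy g))//; [|exact/C0inf_Cc/C0inf_dy|exact: C0inf_dy].
rewrite (H id (dx g))//; last exact: C0inf_Cc.
by rewrite (H (@f43 R) (dx g))//; exact/Cc_f43/C0inf_Cc.
Qed.

(* With [W] the difference of [g] and its translate, testing the difference of the two almost critical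
   equations with [W] bounds [dx (dx W)] by [dx W]; the nonlinear part is absorbed by [trilinear]. *)
Lemma remainder_est lam d (t M e : R) g : C0inf g -> NX g <= M ->
  (forall psi, C0inf psi -> `|dJ lam g psi| <= e * NX psi) -> 0 <= e ->
  remainder d t (dx g) <=
  (2 * `|lam| + 14 + 592 * M ^+ 4) * nrm (fun p => transl d t (dx g) p - dx g p) ^+ 2 + 8 * M * e.
Proof.
move=> cg gM crit e0.
have M0 : 0 <= M by exact: le_trans (NX_ge0 g) gM.
have cgt := C0inf_transl d t cg; pose W := fun p => transl d t g p - g p.
have cW : C0inf W by exact: C0infB.
have c1 := C0inf_dx cW; have c2 := C0inf_dx c1; have c3 := C0inf_dy cW.
have cs := C0inf_dx cg; have cst := C0inf_dx cgt.
have W1 : dx W = (fun p => transl d t (dx g) p - dx g p) by rewrite /W dxB// dx_transl.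
rewrite -W1; set a := nrm (dx W); pose b := nrm (dx (dx W)).
have a0 : 0 <= a := nrm_ge0 _; have b0 : 0 <= b := nrm_ge0 _.
have [g1 g2 _] := le_NX g.
have tri k : C0inf k -> nrm (dx (dx k)) <= M -> nrm (dy k) <= M ->
    int2 (fun p => pow43 (dx k p) * dx W p ^+ 2) <= 4 * M ^+ 2 * (a * b) + a ^+ 2.
  move=> ck k1 k2; apply: le_trans (trilinear ck (C0inf_Cc c1) (C0inf_Cc c2)
    (dx_dX (C0inf_smooth c1)) (@ltr01 R)) _.
  have -> : 4 * M ^+ 2 * (a * b) + a ^+ 2 = 4 * (M ^+ 2 * (a * b)) + a ^+ 2 by ring.
  rewrite invr1 expr1n !mul1r; apply: lerD => //; rewrite ler_pM2l//.
  by apply: ler_pM; rewrite ?mulr_ge0 ?nrm_ge0// expr2; apply: ler_pM; rewrite ?nrm_ge0.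
have rem_le : remainder d t (dx g) <= 8 * M ^+ 2 * (a * b) + 2 * a ^+ 2.
  rewrite /remainder.
  have -> : (fun p => (pow43 (dx g p) + pow43 (transl d t (dx g) p)) * (transl d t (dx g) p - dx g p) ^+ 2)
    = (fun p => pow43 (dx g p) * dx W p ^+ 2 + pow43 (dx (transl d t g) p) * dx W p ^+ 2).
    by apply/funext => p; rewrite W1 dx_transl// mulrDl.
  rewrite int2D; first last.
  - by apply: CcMl; [exact/Cc_pow43/C0inf_Cc|exact/Cc_continuous/Cc_sqr/C0inf_Cc].
  - by apply: CcMl; [exact/Cc_pow43/C0inf_Cc|exact/Cc_continuous/Cc_sqr/C0inf_Cc].
  have t1 := tri g cg (le_trans g1 gM) (le_trans g2 gM).
  have t2 : int2 (fun p => pow43 (dx (transl d t g) p) * dx W p ^+ 2) <= 4 * M ^+ 2 * (a * b) + a ^+ 2.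
    apply: tri => //.
    - rewrite !dx_transl// nrm_transl; [exact: le_trans gM|exact/C0inf_Cc/C0inf_dx].
    - by rewrite dy_transl// nrm_transl; [exact: le_trans gM|exact/C0inf_Cc/C0inf_dy].
  have -> : 8 * M ^+ 2 * (a * b) + 2 * a ^+ 2 =
    (4 * M ^+ 2 * (a * b) + a ^+ 2) + (4 * M ^+ 2 * (a * b) + a ^+ 2) by ring.
  exact: (lerD t1 t2).
have NW : NX W <= 2 * M.
  by apply: le_trans (NXB cgt cg) _; rewrite NX_transl//; lra.
have crit' : `|dJ lam (transl d t g) W - dJ lam g W| <= 4 * M * e.
  rewrite dJ_transl//; apply: le_trans (ler_normB _ _) _.
  have h1 := crit _ (C0inf_transl d (- t) cW); have h2 := crit _ cW.
  rewrite NX_transl// in h1.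
  have : e * NX W <= e * (2 * M) by rewrite ler_wpM2l.
  lra.
(* Testing the difference of the two equations with [W]: the vertical term is a square and is
   dropped, and the nonlinear difference is at most 3 times the remainder. *)
have b_le : b ^+ 2 <= `|lam| * a ^+ 2 + 3 * remainder d t (dx g) + 4 * M * e.
  have x2 := C0inf_dx cs; have x2t := C0inf_dx cst.
  have split_ u v : C0inf u -> C0inf v -> int2 (fun p => (u p - v p) ^+ 2) =
      int2 (fun p => u p * (u p - v p)) - int2 (fun p => v p * (u p - v p)).
    move=> cu cv; have cuv := C0infB cu cv.
    rewrite -(int2B (Cc_prod cu cuv) (Cc_prod cv cuv)); congr int2.
    by apply/funext => p; ring.
  have e1 : b ^+ 2 = int2 (fun p => dx (dx (transl d t g)) p * dx (dx W) p) -
      int2 (fun p => dx (dx g) p * dx (dx W) p).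
    by rewrite /b nrm_sqr /W dxxB// split_.
  have e2 : nrm (dy W) ^+ 2 = int2 (fun p => dy (transl d t g) p * dy W p) -
      int2 (fun p => dy g p * dy W p).
    by rewrite nrm_sqr /W dyB// split_//; exact: C0inf_dy.
  have e3 : a ^+ 2 = int2 (fun p => dx (transl d t g) p * dx W p) -
      int2 (fun p => dx g p * dx W p).
    by rewrite /a nrm_sqr /W dxB// split_.
  have cf1 : Cc (fun p => f43 (dx (transl d t g) p) * dx W p).
    by apply: CcMl; [exact/Cc_f43/C0inf_Cc|exact/Cc_continuous/C0inf_Cc].
  have cf2 : Cc (fun p => f43 (dx g p) * dx W p).
    by apply: CcMl; [exact/Cc_f43/C0inf_Cc|exact/Cc_continuous/C0inf_Cc].
  have e4 : int2 (fun p => f43 (dx (transl d t g) p) * dx W p) -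
      int2 (fun p => f43 (dx g p) * dx W p) <= 3 * remainder d t (dx g).
    have cr := Cc_remainder d t (C0inf_Cc cs).
    rewrite -(int2B cf1 cf2) /remainder -(int2Z _ cr); apply: le_int2 => [||p]; [exact: CcB|exact: CcZ|].
    rewrite W1 dx_transl// -mulrBl.
    set x := transl _ _ _ _; set y := dx g p.
    apply: le_trans (ler_norm _) _; rewrite normrM -(real_normK (num_real (x - y))) expr2 !mulrA.
    by rewrite ler_wpM2r//; exact: f43_lip.
  have e5 : 0 <= nrm (dy W) ^+ 2 by exact: sqr_ge0.
  have e6 : lam * a ^+ 2 <= `|lam| * a ^+ 2 by rewrite ler_wpM2r ?sqr_ge0// ler_norm.
  have e7 := ler_norm (dJ lam (transl d t g) W - dJ lam g W).
  have E : dJ lam (transl d t g) W - dJ lam g W = b ^+ 2 + nrm (dy W) ^+ 2 - lam * a ^+ 2 -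
     (int2 (fun p => f43 (dx (transl d t g) p) * dx W p) - int2 (fun p => f43 (dx g p) * dx W p)).
    by rewrite e1 e2 e3 /dJ; ring.
  rewrite E in e7 crit'.
  move: e4 e5 e6 e7 crit'; set F1 := int2 _ - int2 _; set B1 := nrm (dy W) ^+ 2.
  set r := remainder _ _ _; set n1 := `|_ - F1|; set la := `|lam|; set A2 := a ^+ 2; set B2 := b ^+ 2.
  clearbody F1 B1 r n1 la; move=> *; lra.
move: rem_le b_le; set r := remainder _ _ _; clearbody r; set la := `|lam|.
have la0 : 0 <= la by rewrite normr_ge0.
clearbody a b la; set X := M * e; have X0 : 0 <= X by rewrite mulr_ge0.
have -> : 8 * M * e = 8 * X by rewrite -mulrA.
have -> : 4 * M * e = 4 * X by rewrite -mulrA.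
(* Inserting [rem_le] into [b_le] leaves 24 M^2 a b, of which b^2 / 2 is absorbed on the left. A
   second Young inequality bounds the remainder itself, giving 592 = 2 * 288 + 16 and 14 = 2 * 6 +
   2. *)
have k1 : 24 * M ^+ 2 * (a * b) <= b ^+ 2 / 2 + 288 * M ^+ 4 * a ^+ 2.
  have := sqr_ge0 (b - 24 * M ^+ 2 * a).
  have -> : (b - 24 * M ^+ 2 * a) ^+ 2 = 2 * (b ^+ 2 / 2 + 288 * M ^+ 4 * a ^+ 2 - 24 * M ^+ 2 * (a * b)) by field.
  by rewrite pmulr_rge0// subr_ge0.
have k2 : 8 * M ^+ 2 * (a * b) <= b ^+ 2 + 16 * M ^+ 4 * a ^+ 2.
  have := sqr_ge0 (b - 4 * M ^+ 2 * a).
  have -> : (b - 4 * M ^+ 2 * a) ^+ 2 = b ^+ 2 + 16 * M ^+ 4 * a ^+ 2 - 8 * M ^+ 2 * (a * b) by ring.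
  by rewrite subr_ge0.
move: k1 k2.
have -> : 24 * M ^+ 2 * (a * b) = 24 * (M ^+ 2 * (a * b)) by ring.
have -> : 8 * M ^+ 2 * (a * b) = 8 * (M ^+ 2 * (a * b)) by ring.
have -> : 288 * M ^+ 4 * a ^+ 2 = 288 * (M ^+ 4 * a ^+ 2) by ring.
have -> : 16 * M ^+ 4 * a ^+ 2 = 16 * (M ^+ 4 * a ^+ 2) by ring.
have -> : (2 * la + 14 + 592 * M ^+ 4) * a ^+ 2 = 2 * (la * a ^+ 2) + 14 * a ^+ 2 + 592 * (M ^+ 4 * a ^+ 2) by ring.
set P := M ^+ 2 * (a * b); set S := M ^+ 4 * a ^+ 2; set A2 := a ^+ 2; set B2 := b ^+ 2; set L := la * A2.
clearbody P S A2 B2 L X; move=> *; lra.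
Qed.

End Estimates.

(** * Weights and iterated limits *)
Section Waves.
Context {R : realType}.
Implicit Types (omega : R * R -> R) (d : bool) (k h t : R).

(** The threshold in n may depend on h, and in [eventually3] also on k, because the bounds on the
    test functions blow up as h or k tends to 0. *)
Definition eventually2 (P : R -> nat -> Prop) := exists2 h0 : R, 0 < h0 &
  forall h, 0 < h -> h < h0 -> exists N, forall n, (N <= n)%N -> P h n.

Definition eventually3 (P : R -> R -> nat -> Prop) := exists2 k0 : R, 0 < k0 &
  forall k, 0 < k -> k < k0 -> eventually2 (P k).

Lemma eventually2_and P P' : eventually2 P -> eventually2 P' ->
  eventually2 (fun h n => P h n /\ P' h n).
Proof.
move=> [h0 h00 H] [h1 h10 H']; exists (Num.min h0 h1); first by rewrite lt_min h00.
move=> h hp; rewrite lt_min => /andP[a b].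
have [N HN] := H h hp a; have [N' HN'] := H' h hp b.
exists (maxn N N') => n; rewrite geq_max => /andP[n1 n2].
by split; [exact: HN|exact: HN'].
Qed.

Lemma eventually2_mono (P P' : R -> nat -> Prop) : eventually2 P ->
  (forall h n, 0 < h -> h <= 1 -> P h n -> P' h n) -> eventually2 P'.
Proof.
move=> [h0 h00 H] PP; exists (Num.min h0 1); first by rewrite lt_min h00/=.
move=> h hp; rewrite lt_min => /andP[a b]; have [N HN] := H h hp a.
by exists N => n /HN; apply: PP => //; exact: ltW.
Qed.

Lemma eventually3_and P P' : eventually3 P -> eventually3 P' ->
  eventually3 (fun k h n => P k h n /\ P' k h n).
Proof.
move=> [k0 k00 H] [k1 k10 H']; exists (Num.min k0 k1); first by rewrite lt_min k00.
by move=> k kp; rewrite lt_min => /andP[a b]; apply: eventually2_and; [exact: H|exact: H'].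
Qed.

Lemma eventually3_mono (P P' : R -> R -> nat -> Prop) : eventually3 P ->
  (forall k h n, 0 < k -> 0 < h -> h <= 1 -> P k h n -> P' k h n) -> eventually3 P'.
Proof.
move=> [k0 k00 H] PP; exists k0 => // k kp kk.
by apply: eventually2_mono (H k kp kk) _ => h n h0 h1; exact: PP.
Qed.

Lemma eventually23 (P : R -> R -> nat -> Prop) : (forall k, 0 < k -> eventually2 (P k)) ->
  eventually3 P.
Proof. by move=> H; exists 1 => // k k0 _; exact: H. Qed.

(** With s = [axis d]: sin(k s)/k replaces the unbounded coordinate s, and [wk] and [uk] are its
    first and second derivatives, close to 1 locally and of size k respectively. *)
Definition Zk d k : R * R -> R := plane_wave (if d then k else 0) (if d then 0 else k) k^-1 0.
Definition wk d k : R * R -> R := plane_wave (if d then k else 0) (if d then 0 else k) 0 1.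
Definition uk d k : R * R -> R := plane_wave (if d then k else 0) (if d then 0 else k) (- k) 0.

Lemma ZkE d k p : Zk d k p = k^-1 * sin (k * axis d p).
Proof. by case: d; rewrite /Zk /plane_wave !(mul0r, mul1r, addr0, add0r). Qed.

Lemma wkE d k p : wk d k p = cos (k * axis d p).
Proof. by case: d; rewrite /wk /plane_wave !(mul0r, mul1r, addr0, add0r). Qed.

Lemma ukE d k p : uk d k p = - k * sin (k * axis d p).
Proof. by case: d; rewrite /uk /plane_wave !(mul0r, mul1r, addr0, add0r). Qed.

Lemma der_Zk d k : 0 < k -> der d (Zk d k) = wk d k.
Proof.
move=> k0; rewrite /wk /Zk; case: d; [apply: dX_dx|apply: dY_dy];
  have := @plane_wave_dX R k 0 k^-1 0; have := @plane_wave_dY R 0 k k^-1 0;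
  by rewrite !mul0r oppr0 !mulVf ?gt_eqF.
Qed.

Lemma der_wk d k : der d (wk d k) = uk d k.
Proof.
rewrite /wk /uk; case: d; [apply: dX_dx|apply: dY_dy];
  have := @plane_wave_dX R k 0 0 1; have := @plane_wave_dY R 0 k 0 1;
  by rewrite !mul1r !mul0r.
Qed.

Lemma der_Zk_other d k : der (~~ d) (Zk d k) = (fun=> 0).
Proof.
rewrite /Zk; case: d; [apply: dY_dy|apply: dX_dx] => p.
- have := @plane_wave_dY R k 0 k^-1 0 p; congr is_derive.
  by rewrite /plane_wave !(mul0r, mulr0) oppr0 mul0r addr0.
- have := @plane_wave_dX R 0 k k^-1 0 p; congr is_derive.
  by rewrite /plane_wave !(mul0r, mulr0) oppr0 mul0r addr0.
Qed.

Lemma Zk_le d k p : 0 < k -> `|Zk d k p| <= k^-1.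
Proof.
move=> k0; rewrite ZkE normrM gtr0_norm ?invr_gt0//.
apply: ler_piMr; first by rewrite invr_ge0 ltW.
by rewrite ler_norml sin_geN1 sin_le1.
Qed.

Lemma wk_le d k p : `|wk d k p| <= 1.
Proof. by rewrite wkE ler_norml cos_geN1 cos_le1. Qed.

Lemma uk_le d k p : 0 < k -> `|uk d k p| <= k.
Proof.
move=> k0; rewrite ukE normrM normrN (gtr0_norm k0).
apply: ler_piMr; first exact: ltW.
by rewrite ler_norml sin_geN1 sin_le1.
Qed.

Lemma cos_lip (x : R) : `|1 - cos x| <= `|x|.
Proof.
have := @MVT_le R cos (fun y => - sin y) 1 0 x (fun y => is_derive_cos y).
rewrite cos0 subr0 mul1r distrC; apply => y.
by rewrite normrN ler_norml sin_geN1 sin_le1.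
Qed.

(** The 3 leaves room for shifted arguments: the mean value point in [sym_diff_weight] is at
    distance at most 3 h from [axis d p]. *)
Definition near1_weight d k omega := [/\ continuous omega, forall p, `|omega p| <= 1 &
  forall p, `|1 - omega p| <= k * (`|axis d p| + 3)].

Lemma wk_weight d k : 0 < k -> near1_weight d k (wk d k).
Proof.
move=> k0; split; [exact: plane_wave_continuous|exact: wk_le|move=> p].
rewrite wkE; apply: le_trans (cos_lip _) _; rewrite normrM gtr0_norm// ler_pM2l//.
by rewrite lerDl.
Qed.

Lemma sin_mean k (x t : R) : 0 < k -> exists2 u, `|u| <= `|t| &
  k^-1 * sin (k * (x + t)) - k^-1 * sin (k * x) = t * cos (k * (x + u)).
Proof.
move=> k0.
have dF (y : R) : is_derive y 1 (fun y => k^-1 * sin (k * y)) (cos (k * y)).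
  have := @plane_wave_derive R k 0 k^-1 0 y.
  rewrite mul0r oppr0 mul0r add0r mulVf ?gt_eqF// mul1r addr0; congr is_derive.
  by apply/funext => z; rewrite mul0r !addr0.
exact: (mean_value x t dF).
Qed.

Lemma axis_transl d t k p : transl d t (Zk d k) p = k^-1 * sin (k * (axis d p + t)).
Proof. by case: d; rewrite /transl /tx /ty ZkE. Qed.

Lemma cos_weight k (x u : R) : 0 < k -> `|u| <= 3 -> `|1 - cos (k * (x + u))| <= k * (`|x| + 3).
Proof.
move=> k0 u3; apply: le_trans (cos_lip _) _; rewrite normrM gtr0_norm// ler_pM2l//.
by apply: le_trans (ler_normD _ _) _; rewrite lerD2l.
Qed.

(** By the mean value theorem a difference quotient of sin(k s)/k is a cosine at a nearby point. *)
Lemma diff_weight d k h : 0 < k -> 0 < h -> h <= 1 ->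
  near1_weight d k (fun p => h^-1 * (transl d h (Zk d k) p - Zk d k p)).
Proof.
move=> k0 h0 h1; have H p : exists2 u, `|u| <= 3 &
    h^-1 * (transl d h (Zk d k) p - Zk d k p) = cos (k * (axis d p + u)).
  have [u uh E] := sin_mean (axis d p) h k0; exists u.
    by apply: le_trans uh _; rewrite gtr0_norm//; lra.
  by rewrite axis_transl ZkE E mulKf// gt_eqF.
split.
- apply: continuousZ2; apply: continuousB2; last exact: plane_wave_continuous.
  by apply: transl_continuous; exact: plane_wave_continuous.
- by move=> p; have [u _ ->] := H p; rewrite ler_norml cos_geN1 cos_le1.
- by move=> p; have [u u3 ->] := H p; exact: cos_weight.
Qed.

Lemma sym_diff_weight d k h : 0 < k -> 0 < h -> h <= 1 ->
  near1_weight d k (fun p => (2 * h)^-1 * (transl d h (Zk d k) p - transl d (- h) (Zk d k) p)).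
Proof.
move=> k0 h0 h1; have H p : exists2 u, `|u| <= 3 &
    (2 * h)^-1 * (transl d h (Zk d k) p - transl d (- h) (Zk d k) p) = cos (k * (axis d p + u)).
  have [u uh E] := sin_mean (axis d p - h) (2 * h) k0; exists (u - h).
    have h2 : 0 < 2 * h by rewrite mulr_gt0.
    apply: le_trans (ler_normB _ _) _; rewrite (gtr0_norm h0).
    by rewrite (gtr0_norm h2) in uh; lra.
  rewrite !axis_transl addrA addrAC -addrA.
  have -> : axis d p + h = axis d p - h + 2 * h by ring.
  rewrite E mulKf; last by rewrite gt_eqF// mulr_gt0.
  by congr (cos (k * _)); ring.
split.
- apply: continuousZ2; apply: continuousB2; apply: transl_continuous; exact: plane_wave_continuous.
- by move=> p; have [u _ ->] := H p; rewrite ler_norml cos_geN1 cos_le1.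
- by move=> p; have [u u3 ->] := H p; exact: cos_weight.
Qed.

End Waves.

(** * Estimates uniform along Cauchy sequences *)

Section Sequences.
Context {R : realType}.
Implicit Types (omega : R * R -> R) (q b : nat -> R * R -> R) (d : bool) (k h t : R).

Definition nrm_cauchy q := forall e : R, 0 < e -> exists N, forall n, (N <= n)%N ->
  nrm (fun p => q n p - q N p) <= e.

(** Translation is an isometry, so comparison with one fixed member [q N] suffices, and only that
    member is differentiated. *)
Lemma transl_small q d : (forall n, C0inf (q n)) -> nrm_cauchy q ->
  forall e : R, 0 < e -> exists2 h0 : R, 0 < h0 & exists N, forall t, `|t| < h0 ->
    forall n, (N <= n)%N -> nrm (fun p => transl d t (q n) p - q n p) <= e.
Proof.
move=> cq qC e e0; have e3 : 0 < e / 3 by rewrite divr_gt0.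
have [N HN] := qC _ e3; pose K := nrm (der d (q N)) + 1.
have K0 : 0 < K by rewrite ltr_wpDl// nrm_ge0.
exists (e / 3 / K); first by rewrite divr_gt0.
exists N => t th n Nn.
have c1 := C0inf_Cc (cq n); have c2 := C0inf_Cc (cq N); have c12 := CcB c1 c2.
rewrite (@eq_nrm _ _ (fun p => (transl d t (fun p => q n p - q N p) p - (q n p - q N p)) +
  (transl d t (q N) p - q N p))) => [|p]; last by rewrite translB; ring.
have c3 := Cc_transl d t c12; have c4 := CcB (Cc_transl d t c2) c2.
apply: le_trans (nrmD (CcB c3 c12) c4) _.
apply: (@le_trans _ _ ((e / 3 + e / 3) + e / 3)); last lra.
apply: lerD.
  by apply: le_trans (nrmB c3 c12) _; rewrite (nrm_transl _ _ c12); apply: lerD; exact: HN.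
apply: le_trans (nrm_transl_sub d t (cq N)) _; apply: (@le_trans _ _ (e / 3 / K * K)).
  apply: ler_pM => //; [exact: nrm_ge0|exact: ltW|by rewrite /K lerDl].
by rewrite divfK// gt_eqF.
Qed.

(** As for [transl_small], with [nrm_Dq] in the place of the isometry: the derivatives are Cauchy,
    and the nonuniform constant [C] concerns only [q N]. *)
Lemma Dq_small q d : (forall n, C0inf (q n)) -> nrm_cauchy (fun n => der d (q n)) ->
  forall e : R, 0 < e ->
  eventually2 (fun h n => nrm (fun p => Dq d h (q n) p - der d (q n) p) <= e).
Proof.
move=> cq qC e e0; have e3 : 0 < e / 3 by rewrite divr_gt0.
have [N HN] := qC _ e3; have [C C0 HC] := nrm_Dq_sub d (cq N).
have C1 : 0 < C + 1 by rewrite ltr_wpDl.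
exists (Num.min 1 (e / 3 / (C + 1))); first by rewrite lt_min ltr01/= divr_gt0.
move=> h h0; rewrite lt_min => /andP[h1 hC]; exists N => n Nn.
have cd := C0infB (cq n) (cq N).
have c1 := C0inf_Cc (C0inf_Dq d h cd); have c2 := C0inf_Cc (C0inf_der d cd).
have c3 := C0inf_Cc (C0infB (C0inf_Dq d h (cq N)) (C0inf_der d (cq N))).
have E := derB d (cq n) (cq N).
rewrite (@eq_nrm _ _ (fun p => (Dq d h (fun p => q n p - q N p) p - der d (fun p => q n p - q N p) p) +
  (Dq d h (q N) p - der d (q N) p))) => [|p]; last by rewrite E DqB; ring.
apply: le_trans (nrmD (CcB c1 c2) c3) _.
apply: (@le_trans _ _ ((e / 3 + e / 3) + e / 3)); last lra.
have H : nrm (der d (fun p => q n p - q N p)) <= e / 3 by rewrite E; exact: HN.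
apply: lerD.
  apply: le_trans (nrmB c1 c2) _; apply: lerD => //.
  exact: le_trans (nrm_Dq d cd h0) H.
apply: le_trans (HC h h0 (ltW h1)) _; apply: (@le_trans _ _ ((C + 1) * (e / 3 / (C + 1)))).
  by apply: ler_pM => //; [exact: ltW|by rewrite lerDl|exact: ltW].
by rewrite mulrC divfK// gt_eqF.
Qed.

(* A Cauchy sequence is tight, so a bounded weight tending to 1 locally uniformly does not change the limit. *)
Lemma tight b q d (K : R) : (forall n, continuous (b n)) -> (forall n p, 0 <= b n p) ->
  (forall n, Cc (q n)) -> (forall n m, int2 (fun p => b n p * q m p ^+ 2) <= K) ->
  (forall e : R, 0 < e -> exists N, forall n, (N <= n)%N ->
    int2 (fun p => b n p * (q n p - q N p) ^+ 2) <= e) ->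
  forall e : R, 0 < e -> exists2 k0 : R, 0 < k0 & exists N, forall k, 0 < k -> k < k0 ->
    forall omega, near1_weight d k omega -> forall n, (N <= n)%N ->
    int2 (fun p => `|1 - omega p| * (b n p * q n p ^+ 2)) <= e.
Proof.
move=> cb b0 cq bK bC e e0; have e8 : 0 < e / 8 by rewrite divr_gt0.
have [N HN] := bC _ e8; have [_ [M hM]] := cq N.
have K0 : 0 <= K.
  by apply: le_trans (bK 0%N 0%N); apply: int2_ge0 => p; rewrite mulr_ge0 ?sqr_ge0.
pose L := 2 * ((`|M| + 3) * (K + 1)).
have L0 : 0 < L.
  by rewrite !mulr_gt0// ?ltr_wpDl// ltr_pwDr.
exists (e / 2 / L); first by rewrite !divr_gt0.
exists N => k k0 kL omega [co o1 ok] n Nn.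
have cbq m : Cc (fun p => b n p * q m p ^+ 2) by apply: CcMr => //; exact: Cc_sqr.
have cbd : Cc (fun p => b n p * (q n p - q N p) ^+ 2) by apply: CcMr => //; apply/Cc_sqr/CcB.
have cw : continuous (fun p => `|1 - omega p|).
  apply: continuous_norm2; apply: continuousB2 co.
  exact: (@cst_continuous _ _ (1 : R)).
have w2 p : `|1 - omega p| <= 2.
  by apply: le_trans (ler_normB _ _) _; rewrite normr1; have := o1 p; lra.
apply: (@le_trans _ _ (int2 (fun p => 2 * (k * (`|M| + 3) * (b n p * q N p ^+ 2)) +
   4 * (b n p * (q n p - q N p) ^+ 2)))).
  apply: le_int2 => [||p].
  - exact: CcMr.
  - by apply: CcD; do ?apply: CcZ.
  have bq : 0 <= b n p * q N p ^+ 2 by rewrite mulr_ge0 ?sqr_ge0.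
  have bd : 0 <= b n p * (q n p - q N p) ^+ 2 by rewrite mulr_ge0 ?sqr_ge0.
  (* q_n^2 is at most 2 q_N^2 + 2 (q_n - q_N)^2. On the support of [q N] the weight is within k (|M|
     + 3) of 1; elsewhere only the second term is left and the crude bound 2 is used. *)
  apply: (@le_trans _ _ (`|1 - omega p| * (2 * (b n p * q N p ^+ 2) + 2 * (b n p * (q n p - q N p) ^+ 2)))).
    rewrite ler_wpM2l// -subr_ge0.
    have -> : 2 * (b n p * q N p ^+ 2) + 2 * (b n p * (q n p - q N p) ^+ 2) - b n p * q n p ^+ 2 =
      b n p * (q n p - 2 * q N p) ^+ 2 by ring.
    by rewrite mulr_ge0// sqr_ge0.
  rewrite mulrDr; apply: lerD.
    rewrite mulrCA ler_pM2l//.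
    have [->|qN0] := eqVneq (q N p) 0; first by rewrite expr0n !mulr0.
    apply: ler_wpM2r => //; apply: le_trans (ok p) _; rewrite ler_pM2l// lerD2r.
    apply: le_trans (ler_norm M); rewrite leNgt; apply/negP => pM.
    case/eqP: qN0; apply: hM; move: pM; rewrite /axis; case: d {ok} => pM; [by left|by right].
  have -> : 4 * (b n p * (q n p - q N p) ^+ 2) = 2 * (2 * (b n p * (q n p - q N p) ^+ 2)) by ring.
  by rewrite ler_wpM2r// mulr_ge0.
rewrite int2D; [|by do ?apply: CcZ|exact: CcZ].
rewrite (int2Z 2 (CcZ _ (cbq N))) (int2Z _ (cbq N)) (int2Z 4 cbd).
have h1 := HN n Nn.
have h2 : 2 * (k * (`|M| + 3) * int2 (fun p => b n p * q N p ^+ 2)) <= e / 2.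
  apply: (@le_trans _ _ (e / 2 / L * L)); last by rewrite divfK// gt_eqF.
  have -> : 2 * (k * (`|M| + 3) * int2 (fun p => b n p * q N p ^+ 2)) =
    k * (2 * ((`|M| + 3) * int2 (fun p => b n p * q N p ^+ 2))) by ring.
  have M3 : 0 <= `|M| + 3 by rewrite addr_ge0.
  apply: ler_pM => //; [exact: ltW| |exact: ltW|].
    by rewrite !mulr_ge0//; apply: int2_ge0 => p; rewrite mulr_ge0 ?sqr_ge0.
  rewrite /L ler_pM2l// ler_wpM2l//; apply: le_trans (bK n N) _; by rewrite lerDl.
move: h1 h2; set x := int2 _; set y := 2 * _; clearbody x y => h1 h2; lra.
Qed.

Lemma tight1 q d (M : R) : (forall n, Cc (q n)) -> nrm_cauchy q -> (forall n, nrm (q n) <= M) ->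
  forall e : R, 0 < e -> exists2 k0 : R, 0 < k0 & exists N, forall k, 0 < k -> k < k0 ->
    forall omega, near1_weight d k omega -> forall n, (N <= n)%N ->
    int2 (fun p => `|1 - omega p| * q n p ^+ 2) <= e.
Proof.
move=> cq qC qM e e0.
have E (x : R * R -> R) : (fun p => 1 * x p) = x by apply/funext => p; rewrite mul1r.
have h1 (n : nat) : continuous ((fun _ _ => 1) n : R * R -> R) by exact: (@cst_continuous _ _ (1 : R)).
have h3 (n m : nat) : int2 (fun p => 1 * q m p ^+ 2) <= M ^+ 2.
  rewrite (E (fun p => q m p ^+ 2)) -nrm_sqr ler_pXn2r ?nnegrE ?nrm_ge0//.
  exact: le_trans (nrm_ge0 _) (qM m).
have h4 (e' : R) : 0 < e' -> exists N, forall n, (N <= n)%N ->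
    int2 (fun p => 1 * (q n p - q N p) ^+ 2) <= e'.
  move=> e'0; have s0 : 0 < Num.sqrt e' by rewrite sqrtr_gt0.
  have [N HN] := qC _ s0; exists N => n Nn.
  rewrite (E (fun p => (q n p - q N p) ^+ 2)) -nrm_sqr -(sqr_sqrtr (ltW e'0)).
  by rewrite ler_pXn2r ?nnegrE ?nrm_ge0 ?sqrtr_ge0//; exact: HN.
have [k0 k00 [N HN]] := @tight (fun _ _ => 1 : R) q d (M ^+ 2) h1 (fun _ _ => ler01) cq h3 h4 e e0.
exists k0 => //; exists N => k kp kk omega ow n Nn.
have := HN k kp kk omega ow n Nn.
have -> // : (fun p => `|1 - omega p| * (1 * q n p ^+ 2)) = (fun p => `|1 - omega p| * q n p ^+ 2).
by apply/funext => p; rewrite mul1r.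
Qed.

End Sequences.

(** * Nehari and Pohozaev identities *)
Section Pohozaev.
Context {R : realType}.
Variables (g : nat -> R * R -> R) (lam M : R).
Hypothesis cg : forall n, C0inf (g n).
Hypothesis gC : cauchyX g.
Hypothesis gM : forall n, NX (g n) <= M.
Hypothesis crit : forall e : R, 0 < e -> exists N, forall n, (N <= n)%N ->
  forall psi, C0inf psi -> `|dJ lam (g n) psi| <= e * NX psi.
Implicit Types (d : bool) (k h t : R).

(** This is where k and h leave the argument: a statement free of them needs a single admissible
    pair. *)
Lemma eventually3_ex (P : nat -> Prop) : @eventually3 R (fun _ _ => P) ->
  exists N, forall n, (N <= n)%N -> P n.
Proof.
move=> [k0 k00 /(_ (k0 / 2))]; case; [by rewrite divr_gt0|lra|].
move=> h0 h00 /(_ (h0 / 2)); case; [by rewrite divr_gt0|lra|].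
by move=> N HN; exists N.
Qed.

Lemma tight_eventually3 d (om : R -> R -> R * R -> R) (F : nat -> R * R -> R) (e : R) :
  (forall k h, 0 < k -> 0 < h -> h <= 1 -> near1_weight d k (om k h)) ->
  (exists2 k0 : R, 0 < k0 & exists N, forall k, 0 < k -> k < k0 ->
    forall omega, near1_weight d k omega -> forall n, (N <= n)%N ->
    int2 (fun p => `|1 - omega p| * F n p) <= e) ->
  eventually3 (fun k h n => int2 (fun p => `|1 - om k h p| * F n p) <= e).
Proof.
move=> wom [k0 k00 [N HN]]; exists k0 => // k kp kk; exists 1 => // h hp h1.
by exists N => n Nn; exact: (HN k kp kk _ (wom k h kp hp (ltW h1)) n Nn).
Qed.

Lemma Mge0 : 0 <= M. Proof. exact: le_trans (NX_ge0 _) (gM 0%N). Qed.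

Let bounds n : [/\ nrm (dx (dx (g n))) <= M, nrm (dy (g n)) <= M & nrm (dx (g n)) <= M].
Proof. by have [a b c] := le_NX (g n); split; apply: le_trans (gM n). Qed.

Lemma nrm_der_le d n : nrm (der d (g n)) <= M.
Proof. by have [_ b c] := bounds n; case: d. Qed.

Lemma cauchy_components : [/\ nrm_cauchy (fun n => dx (dx (g n))), nrm_cauchy (fun n => dy (g n)) &
  nrm_cauchy (fun n => dx (g n))].
Proof.
have H n N := le_NX (fun p => g n p - g N p).
split=> e e0; have [N HN] := gC e0; exists N => n Nn; have [a b c] := H n N.
- rewrite dxxB// in a; exact: le_trans a (HN n N Nn (leqnn N)).
- rewrite dyB// in b; exact: le_trans b (HN n N Nn (leqnn N)).
- rewrite dxB// in c; exact: le_trans c (HN n N Nn (leqnn N)).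
Qed.

Lemma cauchy_der d : nrm_cauchy (fun n => der d (g n)).
Proof. by have [_ b c] := cauchy_components; case: d. Qed.

Let cs n : C0inf (dx (g n)). Proof. exact: C0inf_dx. Qed.
Let csx n : C0inf (dx (dx (g n))). Proof. exact: C0inf_dx. Qed.
Let cv n : C0inf (dy (g n)). Proof. exact: C0inf_dy. Qed.

(** By [remainder_est] it suffices to bound the squared norm of W_x, W the increment of [g n]. By
    [ibp_norm] it is at most h M times the norm of W_xx, and the latter is small uniformly in n by
    [transl_small]. *)
Lemma remainder_small d (c : R) : 0 < c -> eventually2 (fun h n =>
  remainder d h (dx (g n)) <= c * h /\ remainder d (- h) (dx (g n)) <= c * h).
Proof.
move=> c0; have M0 := Mge0.
pose K := 2 * `|lam| + 14 + 592 * M ^+ 4.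
have K0 : 0 < K by rewrite /K; have := normr_ge0 lam; have := exprn_ge0 4 M0; lra.
(* Chosen so that K h (M + 1) eta = c h / 2. *)
pose eta := c / 2 / (K * (M + 1)).
have KM : 0 < K * (M + 1) by rewrite mulr_gt0// ltr_wpDl.
have eta0 : 0 < eta by rewrite !divr_gt0.
have [Cx _ _] := cauchy_components.
have [h0 h00 [N HN]] := transl_small d csx Cx eta0.
exists h0 => // h hp hh.
have M8 : 0 < 8 * M + 1 by rewrite ltr_wpDl// mulr_ge0.
(* The equation error is made proportional to h, which is allowed because n is chosen after h. *)
have e0 : 0 < c * h / 2 / (8 * M + 1) by rewrite !divr_gt0// mulr_gt0.
have [N' HN'] := crit e0; exists (maxn N N') => n; rewrite geq_max => /andP[n1 n2].
suff H t : `|t| = h -> remainder d t (dx (g n)) <= c * h.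
  by split; apply: H; rewrite ?normrN gtr0_norm.
move=> th; apply: le_trans (remainder_est d t (cg n) (gM n) (HN' n n2) (ltW e0)) _.
pose W p := transl d t (g n) p - g n p.
have cW : C0inf W by apply: C0infB => //; exact: C0inf_transl.
have ct := C0inf_transl d t (cg n).
have W1 : dx W = (fun p => transl d t (dx (g n)) p - dx (g n) p) by rewrite /W dxB// dx_transl.
have W2 : dx (dx W) = (fun p => transl d t (dx (dx (g n))) p - dx (dx (g n)) p).
  by rewrite /W dxxB// !dx_transl.
have a_le : nrm (fun p => transl d t (dx (g n)) p - dx (g n) p) ^+ 2 <= h * M * eta.
  rewrite -W1; apply: le_trans (ibp_norm cW) _; apply: ler_pM; rewrite ?nrm_ge0//.
    rewrite -th; apply: le_trans (nrm_transl_sub d t (cg n)) _.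
    by rewrite ler_wpM2l//; exact: nrm_der_le.
  by rewrite W2; apply: HN => //; rewrite th.
apply: (@le_trans _ _ (c * h / 2 + c * h / 2)); last lra.
apply: lerD.
  apply: (@le_trans _ _ (K * (h * M * eta))); first by rewrite ler_pM2l.
  apply: (@le_trans _ _ (K * (h * (M + 1) * eta))).
    by rewrite ler_pM2l// ler_pM2r// ler_pM2l// lerDl.
  have -> : K * (h * (M + 1) * eta) = c * h / 2; last by [].
  by rewrite /eta; field; rewrite !gt_eqF// ltr_wpDl.
apply: (@le_trans _ _ ((8 * M + 1) * (c * h / 2 / (8 * M + 1)))); first by apply: ler_wpM2r; [exact: ltW|rewrite lerDl].
by rewrite mulrC divfK// gt_eqF.
Qed.

(** The limiting identity is int s q q_s = - 1/2 int q^2, where s is the coordinate in direction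
    [d]. *)
Lemma shift_limit q d : (forall n, C0inf (q n)) -> nrm_cauchy q -> (forall n, nrm (q n) <= M) ->
  forall e : R, 0 < e -> eventually3 (fun k h n =>
  `|int2 (fun p => Zk d k p * (q n p * Dq d h (q n) p)) + 2^-1 * nrm (q n) ^+ 2| <= e).
Proof.
move=> cq qC qM e e0; have M0 := Mge0; have M1 : 0 < M + 1 by rewrite ltr_wpDl.
have cq' n := C0inf_Cc (cq n).
have t1 := tight_eventually3 (@diff_weight R d) (tight1 d cq' qC qM e0).
have em : 0 < e / (M + 1) by rewrite divr_gt0.
have [h0 h00 [N HN]] := transl_small d cq qC em.
have t2 : eventually3 (fun k h n => nrm (fun p => transl d h (q n) p - q n p) <= e / (M + 1)).
  apply: eventually23 => k _; exists h0 => // h hp hh; exists N => n; apply: HN.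
  by rewrite gtr0_norm.
apply: eventually3_mono (eventually3_and t1 t2) _ => k h n k0 hp h1 [b1 b2].
have [co o1 ok] := @diff_weight R d k h k0 hp h1.
rewrite (shift_est d (@plane_wave_continuous R _ _ _ _) (cq' n) hp).
have := product_est1 co o1 (cq' n) (Cc_transl d h (cq' n)).
have b3 : nrm (q n) * nrm (fun p => transl d h (q n) p - q n p) <= e.
  apply: (@le_trans _ _ ((M + 1) * (e / (M + 1)))); last by rewrite mulrC divfK// gt_eqF.
  apply: ler_pM; rewrite ?nrm_ge0//; apply: le_trans (qM n) _; by rewrite lerDl.
move=> H; have {H} := le_trans H (lerD b1 b3).
set x := int2 _; set y := nrm _ ^+ 2 => H.
have -> : - 2^-1 * x + 2^-1 * y = - (2^-1 * (x - y)) by ring.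
by rewrite normrN normrM ger0_norm ?invr_ge0// ler_pdivrMl//; lra.
Qed.

Lemma product_limit q d : (forall n, C0inf (q n)) -> nrm_cauchy (fun n => der d (q n)) ->
  (forall n, nrm (der d (q n)) <= M) ->
  forall e : R, 0 < e -> eventually3 (fun k h n =>
  `|int2 (fun p => wk d k p * (der d (q n) p * Dq d h (q n) p)) - nrm (der d (q n)) ^+ 2| <= e).
Proof.
move=> cq qC qM e e0; have M0 := Mge0; have M1 : 0 < M + 1 by rewrite ltr_wpDl.
have cq' n := C0inf_Cc (C0inf_der d (cq n)).
have e2 : 0 < e / 2 by rewrite divr_gt0.
have t1 := tight_eventually3 (fun k h kp _ _ => @wk_weight R d k kp) (tight1 d cq' qC qM e2).
have em : 0 < e / 2 / (M + 1) by rewrite divr_gt0.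
have t2 := eventually23 (fun k _ => Dq_small cq qC em).
apply: eventually3_mono (eventually3_and t1 t2) _ => k h n k0 hp h1 [b1 b2].
have [co o1 ok] := @wk_weight R d k k0.
apply: le_trans (product_est1 co o1 (cq' n) (C0inf_Cc (C0inf_Dq d h (cq n)))) _.
apply: (@le_trans _ _ (e / 2 + e / 2)); last lra.
apply: lerD => //.
apply: (@le_trans _ _ ((M + 1) * (e / 2 / (M + 1)))); last by rewrite mulrC divfK// gt_eqF.
apply: ler_pM; rewrite ?nrm_ge0//; apply: le_trans (qM n) _; by rewrite lerDl.
Qed.

(** The quantity Q, of exponent 4/3 + 2 = 10/3 despite the name. *)
Definition quartic n : R := int2 (fun p => pow43 (dx (g n) p) * dx (g n) p ^+ 2).

Let K43 := 4 * M ^+ 2 + 1.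

Lemma K43_gt0 : 0 < K43.
Proof. by rewrite /K43 ltr_wpDl// mulr_ge0// sqr_ge0. Qed.

Lemma pow43_bound n m : int2 (fun p => pow43 (dx (g n) p) * dx (g m) p ^+ 2) <= K43 * M ^+ 2.
Proof.
apply: le_trans (pow43_weight_le (cg n) (cg m) (gM n)) _.
rewrite -/K43; apply: ler_wpM2l; first by rewrite ltW// K43_gt0.
by rewrite ler_pXn2r ?nnegrE ?NX_ge0 ?Mge0.
Qed.

Lemma pow43_tight d (e : R) : 0 < e ->
  exists2 k0 : R, 0 < k0 & exists N, forall k, 0 < k -> k < k0 ->
    forall omega, near1_weight d k omega -> forall n, (N <= n)%N ->
    int2 (fun p => `|1 - omega p| * (pow43 (dx (g n) p) * dx (g n) p ^+ 2)) <= e.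
Proof.
move=> e0; apply: (@tight _ (fun n p => pow43 (dx (g n) p)) (fun n => dx (g n)) d (K43 * M ^+ 2)) => //.
- by move=> n; apply/Cc_continuous/Cc_pow43/C0inf_Cc.
- by move=> n p; exact: pow43_ge0.
- by move=> n; exact: C0inf_Cc.
- exact: pow43_bound.
move=> {}e {}e0; have s0 : 0 < Num.sqrt (e / K43) by rewrite sqrtr_gt0 divr_gt0// K43_gt0.
have [N HN] := gC s0; exists N => n Nn.
have -> : (fun p => pow43 (dx (g n) p) * (dx (g n) p - dx (g N) p) ^+ 2) =
  (fun p => pow43 (dx (g n) p) * dx (fun p => g n p - g N p) p ^+ 2) by rewrite dxB.
apply: le_trans (pow43_weight_le (cg n) (C0infB (cg n) (cg N)) (gM n)) _.
have eK : 0 <= e / K43 by apply: divr_ge0; apply: ltW => //; exact: K43_gt0.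
rewrite -/K43 mulrC -ler_pdivlMr ?K43_gt0// -[leRHS](sqr_sqrtr eK).
by rewrite ler_pXn2r ?nnegrE ?NX_ge0 ?sqrtr_ge0//; exact: HN.
Qed.

Lemma nonlinear_limit d (e : R) : 0 < e -> eventually3 (fun k h n =>
  `|int2 (fun p => Zk d k p * (f43 (dx (g n) p) * Dq d h (dx (g n)) p)) + 3 / 10 * quartic n| <= e).
Proof.
move=> e0; have e2 : 0 < e / 2 by rewrite divr_gt0.
have t1 := tight_eventually3 (@sym_diff_weight R d) (pow43_tight d e2).
(* The factor k offsets the supremum 1/k of [Zk] and the factor h the quotient 1/(2 h), so that the
   error of [nonlinear_est] is at most e / 2. *)
have t2 : eventually3 (fun k h n => remainder d h (dx (g n)) <= e * k / 6 * h /\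
    remainder d (- h) (dx (g n)) <= e * k / 6 * h).
  apply: eventually23 => k k0; apply: remainder_small; by rewrite divr_gt0// mulr_gt0.
apply: eventually3_mono (eventually3_and t1 t2) _ => k h n k0 hp h1 [b1 [b2 b3]].
have [co o1 ok] := @sym_diff_weight R d k h k0 hp h1.
have cZ := @plane_wave_continuous R (if d then k else 0) (if d then 0 else k) k^-1 0.
have c1 := C0inf_Cc (cs n).
have := nonlinear_est d cZ (fun p => Zk_le d p k0) c1 hp.
set X := int2 _; set om := (fun p => (2 * h)^-1 * _) in co o1 ok b1.
have cw : continuous (fun p => `|1 - om p|).
  apply: continuous_norm2; apply: continuousB2 co.
  exact: (@cst_continuous _ _ (1 : R)).
have cQ : Cc (fun p => pow43 (dx (g n) p) * dx (g n) p ^+ 2).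
  by apply: CcMl; [exact: Cc_pow43|exact/Cc_continuous/Cc_sqr].
have cF : Cc (fun p => om p * F43 (dx (g n) p)) by apply: CcMr => //; exact: Cc_F43.
have b4 : `|3 / 10 * quartic n - int2 (fun p => om p * F43 (dx (g n) p))| <= e / 2.
  rewrite /quartic -(int2Z _ cQ) -(int2B (CcZ _ cQ) cF).
  apply: le_trans (ler_norm_int2 (CcB (CcZ _ cQ) cF)) _; apply: le_trans b1.
  apply: le_int2 => [||p]; [exact/Cc_norm/CcB/cF/CcZ|exact: CcMr|].
  rewrite /F43 -/(om p); set c := pow43 _ * _.
  have c0 : 0 <= c by rewrite mulr_ge0 ?pow43_ge0 ?sqr_ge0.
  have -> : 3 / 10 * c - om p * (3 / 10 * c) = (1 - om p) * (3 / 10 * c) by ring.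
  by rewrite normrM (ger0_norm (mulr_ge0 _ c0))// ler_wpM2l//; lra.
set Y := int2 _ in b4 *; set r1 := remainder _ _ _; set r2 := remainder _ _ _ => b5.
have b6 : (2 * h)^-1 * (k^-1 * (3 * (r1 + r2))) <= e / 2.
  apply: (@le_trans _ _ ((2 * h)^-1 * (k^-1 * (3 * (e * k / 6 * h + e * k / 6 * h))))).
    rewrite ler_pM2l ?invr_gt0 ?mulr_gt0// ler_pM2l ?invr_gt0// ler_pM2l//.
    exact: (lerD b2 b3).
  rewrite le_eqVlt; apply/orP; left; apply/eqP; field; by rewrite !gt_eqF.
have -> : X + 3 / 10 * quartic n = (X + Y) + (3 / 10 * quartic n - Y) by ring.
apply: le_trans (ler_normD _ _) _; apply: (@le_trans _ _ (e / 2 + e / 2)); last lra.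
by apply: lerD => //; exact: le_trans b5 b6.
Qed.

(** This is the nonlinear term in which the x-derivative falls on [Zk]. The error w = D g - g_x is
    small in L^2 while w_x is merely bounded, which is enough for [trilinear] to make its weighted
    norm small. *)
Lemma nonlinear_limit_x (e : R) : 0 < e -> eventually3 (fun k h n =>
  `|int2 (fun p => wk true k p * (f43 (dx (g n) p) * Dq true h (g n) p)) - quartic n| <= e).
Proof.
move=> e0; have e2 : 0 < e / 2 by rewrite divr_gt0.
have M0 := Mge0.
have t1 := tight_eventually3 (fun k h kp _ _ => @wk_weight R true k kp) (pow43_tight true e2).
pose S := Num.sqrt (K43 * M ^+ 2) + 1.
have S0 : 0 < S by rewrite ltr_wpDl// sqrtr_ge0.
pose eta := (e / 2 / S) ^+ 2; have eta0 : 0 < eta by rewrite exprn_gt0// !divr_gt0.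
(* [trilinear] gives at most 8 M^3 del + del^2, hence at most L del since del <= 1. *)
pose L := 8 * M ^+ 3 + 1; have L0 : 0 < L by rewrite ltr_wpDl// mulr_ge0// exprn_ge0.
pose del := Num.min 1 (eta / L); have del0 : 0 < del by rewrite lt_min ltr01 divr_gt0.
have t2 := eventually23 (fun k _ => Dq_small cg (cauchy_der true) del0).
apply: eventually3_mono (eventually3_and t1 t2) _ => k h n k0 hp h1 [b1 b2].
have [co o1 ok] := @wk_weight R true k k0.
have c1 := C0inf_Cc (cs n); have cD := C0inf_Dq true h (cg n).
have := product_est (Cc_continuous (Cc_pow43 c1)) (fun p => pow43_ge0 _) co o1 c1 (C0inf_Cc cD).
have -> : (fun p => wk true k p * (pow43 (dx (g n) p) * (dx (g n) p * Dq true h (g n) p))) =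
  (fun p => wk true k p * (f43 (dx (g n) p) * Dq true h (g n) p)).
  by apply/funext => p; rewrite f43E; ring.
move/le_trans; apply; apply: (@le_trans _ _ (e / 2 + e / 2)); last lra.
apply: lerD => //.
have cw : C0inf (fun p => Dq true h (g n) p - dx (g n) p) by exact: C0infB.
set w := (fun p => Dq true h (g n) p - dx (g n) p) in cw *.
have [x1 x2 x3] := bounds n.
have cw1 : dx w = (fun p => Dq true h (dx (g n)) p - dx (dx (g n)) p).
  have E : dx (Dq true h (g n)) = Dq true h (dx (g n)) := der_Dq true true h (cg n).
  by rewrite /w dxB// E.
have b3 : int2 (fun p => pow43 (dx (g n) p) * w p ^+ 2) <= eta.
  apply: le_trans (trilinear (cg n) (C0inf_Cc cw) (C0inf_Cc (C0inf_dx cw))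
    (dx_dX (C0inf_smooth cw)) (@ltr01 R)) _.
  have w1 : nrm w <= del := b2.
  have w2 : nrm (dx w) <= 2 * M.
    rewrite cw1; apply: le_trans (nrmB (Cc_Dq _ _ c1) (C0inf_Cc (csx n))) _.
    by have := nrm_Dq true (cs n) hp; rewrite /der; lra.
  have d1 : del <= 1 by rewrite ge_min lexx.
  have d2 : del <= eta / L by rewrite ge_min lexx orbT.
  rewrite invr1 expr1n !mul1r; apply: (@le_trans _ _ (4 * (M * M * (del * (2 * M))) + del * 1)).
    apply: lerD.
      rewrite ler_pM2l//; apply: ler_pM.
      - exact: mulr_ge0 (nrm_ge0 _) (nrm_ge0 _).
      - exact: mulr_ge0 (nrm_ge0 _) (nrm_ge0 _).
      - exact: ler_pM (nrm_ge0 _) (nrm_ge0 _) x1 x2.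
      - exact: ler_pM (nrm_ge0 _) (nrm_ge0 _) w1 w2.
    by rewrite expr2; apply: ler_pM; rewrite ?nrm_ge0//; exact: le_trans w1 d1.
  have -> : 4 * (M * M * (del * (2 * M))) + del * 1 = L * del by rewrite /L; ring.
  by rewrite -ler_pdivlMl// mulrC.
apply: (@le_trans _ _ (S * (e / 2 / S))); last by rewrite mulrC divfK// gt_eqF.
apply: ler_pM; rewrite ?sqrtr_ge0//.
  apply: (@le_trans _ _ (Num.sqrt (K43 * M ^+ 2))); last by rewrite lerDl.
  by rewrite ler_wsqrtr//; exact: pow43_bound.
have es : 0 <= e / 2 / S by rewrite !divr_ge0// ltW.
by rewrite -[leRHS](ger0_norm es) -sqrtr_sqr ler_wsqrtr.
Qed.

(** [C] may blow up as k or h tends to 0, but not with n; the almost critical property wins because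
    n is chosen last. *)
Lemma critical_limit (psi : R -> R -> nat -> R * R -> R) (C : R -> R -> R) :
  (forall k h n, 0 < k -> 0 < h -> C0inf (psi k h n)) ->
  (forall k h n, 0 < k -> 0 < h -> NX (psi k h n) <= C k h) ->
  forall e : R, 0 < e -> eventually3 (fun k h n => `|dJ lam (g n) (psi k h n)| <= e).
Proof.
move=> cpsi Cpsi e e0; apply: eventually23 => k k0; exists 1 => // h hp _.
have C0 : 0 <= C k h by apply: le_trans (Cpsi k h 0%N k0 hp); exact: NX_ge0.
have C1 : 0 < C k h + 1 by rewrite ltr_wpDl.
have ec : 0 < e / (C k h + 1) by rewrite divr_gt0.
have [N HN] := crit ec; exists N => n Nn.
apply: le_trans (HN n Nn _ (cpsi k h n k0 hp)) _.
apply: (@le_trans _ _ (e / (C k h + 1) * (C k h + 1))); last by rewrite divfK// gt_eqF.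
apply: ler_wpM2l; first exact: ltW.
by apply: le_trans (Cpsi k h n k0 hp) _; rewrite lerDl.
Qed.

End Pohozaev.

(** * The test functions and the three identities *)

Section Conclusion.
Context {R : realType}.
Variables (g : nat -> R * R -> R) (lam M : R).
Hypothesis cg : forall n, C0inf (g n).
Hypothesis gC : cauchyX g.
Hypothesis gM : forall n, NX (g n) <= M.
Hypothesis crit : forall e : R, 0 < e -> exists N, forall n, (N <= n)%N ->
  forall psi, C0inf psi -> `|dJ lam (g n) psi| <= e * NX psi.
Implicit Types (d : bool) (k h : R).

Let cs n : C0inf (dx (g n)). Proof. exact: C0inf_dx. Qed.
Let csx n : C0inf (dx (dx (g n))). Proof. exact: C0inf_dx. Qed.
Let cv n : C0inf (dy (g n)). Proof. exact: C0inf_dy. Qed.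

Definition virial d k h n p : R := Zk d k p * Dq d h (g n) p.

Lemma smooth_Zk d k : smooth (Zk d k). Proof. exact: smooth_plane_wave. Qed.
Lemma smooth_wk d k : smooth (wk d k). Proof. exact: smooth_plane_wave. Qed.

Lemma C0inf_virial d k h n : C0inf (virial d k h n).
Proof. by apply: C0infMl; [exact: smooth_Zk|exact: C0inf_Dq]. Qed.

Lemma der_virial d k h n : 0 < k -> der d (virial d k h n) =
  (fun p => wk d k p * Dq d h (g n) p + Zk d k p * Dq d h (der d (g n)) p).
Proof.
move=> k0; rewrite /virial (derM d (smooth_Zk d k) (C0inf_Dq d h (cg n))).
by rewrite der_Zk// der_Dq.
Qed.

Lemma der_virial_other d k h n : der (~~ d) (virial d k h n) =
  (fun p => Zk d k p * Dq d h (der (~~ d) (g n)) p).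
Proof.
rewrite /virial (derM (~~ d) (smooth_Zk d k) (C0inf_Dq d h (cg n))).
by rewrite der_Zk_other der_Dq//; apply/funext => p; rewrite mul0r add0r.
Qed.

Lemma dx_virial_y k h n : dx (virial false k h n) = (fun p => Zk false k p * Dq false h (dx (g n)) p).
Proof. exact: (der_virial_other false). Qed.

Lemma dxM (u v : R * R -> R) : smooth u -> C0inf v ->
  dx (fun p => u p * v p) = (fun p => dx u p * v p + u p * dx v p).
Proof. exact: (@derM _ true). Qed.

Lemma dx_Dq d h (u : R * R -> R) : C0inf u -> dx (Dq d h u) = Dq d h (dx u).
Proof. exact: (@der_Dq _ true). Qed.

Lemma dxx_virial_y k h n :
  dx (dx (virial false k h n)) = (fun p => Zk false k p * Dq false h (dx (dx (g n))) p).
Proof.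
have E : dx (Zk false k) = (fun=> 0) := der_Zk_other false k.
rewrite dx_virial_y (dxM (smooth_Zk false k) (C0inf_Dq false h (cs n))) E (dx_Dq _ _ (cs n)).
by apply/funext => p; rewrite mul0r add0r.
Qed.

Lemma dy_virial_y k h n : 0 < k -> dy (virial false k h n) =
  (fun p => wk false k p * Dq false h (g n) p + Zk false k p * Dq false h (dy (g n)) p).
Proof. exact: (der_virial false). Qed.

Lemma dx_virial_x k h n : 0 < k -> dx (virial true k h n) =
  (fun p => wk true k p * Dq true h (g n) p + Zk true k p * Dq true h (dx (g n)) p).
Proof. exact: (der_virial true). Qed.

Lemma dy_virial_x k h n : dy (virial true k h n) = (fun p => Zk true k p * Dq true h (dy (g n)) p).
Proof. exact: (der_virial_other true). Qed.

Lemma dxx_virial_x k h n : 0 < k -> dx (dx (virial true k h n)) =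
  (fun p => uk true k p * Dq true h (g n) p + 2 * (wk true k p * Dq true h (dx (g n)) p) +
    Zk true k p * Dq true h (dx (dx (g n))) p).
Proof.
move=> k0; rewrite dx_virial_x//.
have c1 := C0infMl (smooth_wk true k) (C0inf_Dq true h (cg n)).
have c2 := C0infMl (smooth_Zk true k) (C0inf_Dq true h (cs n)).
have E1 : dx (Zk true k) = wk true k := der_Zk true k0.
have E2 : dx (wk true k) = uk true k := der_wk true k.
rewrite (dxD c1 c2) (dxM (smooth_wk true k) (C0inf_Dq true h (cg n))).
rewrite (dxM (smooth_Zk true k) (C0inf_Dq true h (cs n))).
rewrite (dx_Dq _ _ (cg n)) (dx_Dq _ _ (cs n)) E1 E2.
by apply/funext => p; ring.
Qed.

Let M0 : 0 <= M. Proof. exact: (Mge0 gM). Qed.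

Let bounds n : [/\ nrm (dx (dx (g n))) <= M, nrm (dy (g n)) <= M & nrm (dx (g n)) <= M].
Proof. by have [a b c] := le_NX (g n); split; apply: le_trans (gM n). Qed.

Lemma nrm_Zk_Dq d k h (q : R * R -> R) : Cc q -> nrm q <= M -> 0 < k -> 0 < h ->
  nrm (fun p => Zk d k p * Dq d h q p) <= k^-1 * (h^-1 * M).
Proof.
move=> cq qM k0 h0.
have cZ := @plane_wave_continuous R (if d then k else 0) (if d then 0 else k) k^-1 0.
apply: le_trans (nrm_le_mul cZ (fun p => Zk_le d p k0) (Cc_Dq d h cq)) _.
rewrite ler_pM2l ?invr_gt0//; apply: le_trans (nrm_Dq_le d cq h0) _.
by rewrite ler_pM2l ?invr_gt0.
Qed.

Lemma nrm_wk_Dq d k h (q : R * R -> R) : C0inf q -> nrm (der d q) <= M -> 0 < h ->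
  nrm (fun p => wk d k p * Dq d h q p) <= M.
Proof.
move=> cq qM h0.
have cw := @plane_wave_continuous R (if d then k else 0) (if d then 0 else k) 0 1.
apply: le_trans (nrm_le_mul cw (wk_le d k) (C0inf_Cc (C0inf_Dq d h cq))) _.
by rewrite mul1r; apply: le_trans (nrm_Dq d cq h0) _.
Qed.

Lemma nrm_uk_Dq d k h (q : R * R -> R) : C0inf q -> nrm (der d q) <= M -> 0 < k -> 0 < h ->
  nrm (fun p => uk d k p * Dq d h q p) <= k * M.
Proof.
move=> cq qM k0 h0.
have cu := @plane_wave_continuous R (if d then k else 0) (if d then 0 else k) (- k) 0.
apply: le_trans (nrm_le_mul cu (fun p => uk_le d p k0) (C0inf_Cc (C0inf_Dq d h cq))) _.
by rewrite ler_pM2l//; apply: le_trans (nrm_Dq d cq h0) _.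
Qed.

Let CcZD d k h (q : R * R -> R) : Cc q -> Cc (fun p => Zk d k p * Dq d h q p).
Proof. by move=> cq; apply: CcMr; [exact: plane_wave_continuous|exact: Cc_Dq]. Qed.

Let CcwD d k h (q : R * R -> R) : Cc q -> Cc (fun p => wk d k p * Dq d h q p).
Proof. by move=> cq; apply: CcMr; [exact: plane_wave_continuous|exact: Cc_Dq]. Qed.

Let CcuD d k h (q : R * R -> R) : Cc q -> Cc (fun p => uk d k p * Dq d h q p).
Proof. by move=> cq; apply: CcMr; [exact: plane_wave_continuous|exact: Cc_Dq]. Qed.

Lemma NX_virial_y k h n : 0 < k -> 0 < h ->
  NX (virial false k h n) <= 3 * (k^-1 * (h^-1 * M)) + M.
Proof.
move=> k0 h0; have [b1 b2 b3] := bounds n.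
rewrite /NX dxx_virial_y dx_virial_y dy_virial_y//.
have n1 := nrm_Zk_Dq false (C0inf_Cc (csx n)) b1 k0 h0.
have n2 := nrm_Zk_Dq false (C0inf_Cc (cv n)) b2 k0 h0.
have n3 := nrm_Zk_Dq false (C0inf_Cc (cs n)) b3 k0 h0.
have n4 := @nrm_wk_Dq false k h (g n) (cg n) b2 h0.
have n5 := nrmD (CcwD false k h (C0inf_Cc (cg n))) (CcZD false k h (C0inf_Cc (cv n))).
move: n1 n2 n3 n4 n5; set B := k^-1 * _; clearbody B => n1 n2 n3 n4 n5.
apply: (@le_trans _ _ (B + (M + B) + B)); last by rewrite le_eqVlt; apply/orP; left; apply/eqP; ring.
by apply: lerD n3; apply: (lerD n1); exact: le_trans n5 (lerD n4 n2).
Qed.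

Lemma NX_virial_x k h n : 0 < k -> 0 < h ->
  NX (virial true k h n) <= 3 * (k^-1 * (h^-1 * M)) + (k * M + 3 * M).
Proof.
move=> k0 h0; have [b1 b2 b3] := bounds n.
rewrite /NX dxx_virial_x// dx_virial_x// dy_virial_x.
have n1 := nrm_Zk_Dq true (C0inf_Cc (csx n)) b1 k0 h0.
have n2 := nrm_Zk_Dq true (C0inf_Cc (cv n)) b2 k0 h0.
have n3 := nrm_Zk_Dq true (C0inf_Cc (cs n)) b3 k0 h0.
have n4 := @nrm_wk_Dq true k h (g n) (cg n) b3 h0.
have n5 := @nrm_wk_Dq true k h (dx (g n)) (cs n) b1 h0.
have n6 := @nrm_uk_Dq true k h (g n) (cg n) b3 k0 h0.
have c0 := CcuD true k h (C0inf_Cc (cg n)); have c1 := CcwD true k h (C0inf_Cc (cg n)).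
have c2 := CcwD true k h (C0inf_Cc (cs n)); have c3 := CcZD true k h (C0inf_Cc (csx n)).
have n7 := nrmD c1 (CcZD true k h (C0inf_Cc (cs n))).
have n8 := nrmD (CcD c0 (CcZ 2 c2)) c3; have n9 := nrmD c0 (CcZ 2 c2).
rewrite (nrmZ 2 c2) ger0_norm// in n9.
move: n1 n2 n3 n4 n5 n6 n7 n8 n9; set B := k^-1 * _; set B' := k * M.
clearbody B B' => n1 n2 n3 n4 n5 n6 n7 n8 n9.
have n5' := ler_wpM2l (ler0n R 2) n5.
apply: (@le_trans _ _ ((B' + 2 * M + B) + B + (M + B))); last first.
  by rewrite le_eqVlt; apply/orP; left; apply/eqP; ring.
apply: lerD; last exact: le_trans n7 (lerD n4 n3).
by apply: lerD n2; apply: le_trans n8 (lerD _ n1); exact: le_trans n9 (lerD n6 n5').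
Qed.

Let A n := nrm (dx (dx (g n))) ^+ 2.
Let B n := nrm (dy (g n)) ^+ 2.
Let L n := lam * nrm (dx (g n)) ^+ 2.

Lemma nehari (e : R) : 0 < e -> exists N, forall n, (N <= n)%N ->
  `|A n + B n - L n - quartic g n| <= e.
Proof.
move=> e0; have M1 : 0 < M + 1 by rewrite ltr_wpDl.
have em : 0 < e / (M + 1) by rewrite divr_gt0.
have [N HN] := crit em; exists N => n Nn; have := HN n Nn _ (cg n).
have -> : dJ lam (g n) (g n) = A n + B n - L n - quartic g n.
  rewrite /dJ /A /B /L /quartic !nrm_sqr; congr (_ - int2 _).
  by apply/funext => p; rewrite f43E expr2 mulrA.
move/le_trans; apply; apply: (@le_trans _ _ (e / (M + 1) * (M + 1))); last by rewrite divfK// gt_eqF.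
by rewrite ler_pM2l//; apply: le_trans (gM n) _; rewrite lerDl.
Qed.

Let int2CA (a Z b : R * R -> R) :
  int2 (fun p => a p * (Z p * b p)) = int2 (fun p => Z p * (a p * b p)).
Proof. by congr int2; apply/funext => p; rewrite mulrCA. Qed.

(** Each term contributes -1/2 of itself by [shift_limit], or -3/10 for the nonlinear one. The
    y-derivative falling on [Zk] adds one B, and [lam] and the nonlinear term enter [dJ] with a
    minus sign. *)
Lemma pohozaev_y (e : R) : 0 < e -> exists N, forall n, (N <= n)%N ->
  `|- 2^-1 * A n + 2^-1 * B n + 2^-1 * L n + 3 / 10 * quartic g n| <= e.
Proof.
move=> e0; apply: eventually3_ex.
have [Cx Cv Cs] := cauchy_components cg gC.
(* An equal share for each error term: five of weight 1 and one of weight |lam|, with some slack. *)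
pose z := e / (7 + `|lam|); have l7 : 0 < 7 + `|lam| by rewrite ltr_pwDl.
have z0 : 0 < z by rewrite divr_gt0.
have b1 n : nrm (dx (dx (g n))) <= M by have [] := bounds n.
have b2 n : nrm (dy (g n)) <= M by have [] := bounds n.
have b3 n : nrm (dx (g n)) <= M by have [] := bounds n.
have s1 := shift_limit gM false csx Cx b1 z0.
have s2 := shift_limit gM false cv Cv b2 z0.
have s3 := shift_limit gM false cs Cs b3 z0.
have s4 := product_limit gM (d := false) cg Cv b2 z0.
have s5 := nonlinear_limit cg gC gM crit false z0.
have s6 := critical_limit crit (fun k h n _ _ => C0inf_virial false k h n)
  (fun k h n kp hp => NX_virial_y n kp hp) z0.
apply: eventually3_mono (eventually3_and s1 (eventually3_and s2 (eventually3_and s3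
  (eventually3_and s4 (eventually3_and s5 s6))))) _.
move=> k h n k0 h0 h1 [t1 [t2 [t3 [t4 [t5 t6]]]]].
move: t6; rewrite /dJ dxx_virial_y dx_virial_y dy_virial_y//.
have c1 : Cc (fun p => dy (g n) p * (wk false k p * Dq false h (g n) p)).
  by apply: CcMl; [exact: C0inf_Cc|exact/Cc_continuous/CcwD/C0inf_Cc].
have c2 : Cc (fun p => dy (g n) p * (Zk false k p * Dq false h (dy (g n)) p)).
  by apply: CcMl; [exact: C0inf_Cc|exact/Cc_continuous/CcZD/C0inf_Cc].
have -> : (fun p => dy (g n) p * (wk false k p * Dq false h (g n) p +
    Zk false k p * Dq false h (dy (g n)) p)) =
  (fun p => dy (g n) p * (wk false k p * Dq false h (g n) p) +
    dy (g n) p * (Zk false k p * Dq false h (dy (g n)) p)).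
  by apply/funext => p; ring.
rewrite (int2D c1 c2) (int2CA (dx (dx (g n))) (Zk false k) (Dq false h (dx (dx (g n))))).
rewrite (int2CA (dy (g n)) (wk false k) (Dq false h (g n))).
rewrite (int2CA (dy (g n)) (Zk false k) (Dq false h (dy (g n)))).
rewrite (int2CA (dx (g n)) (Zk false k) (Dq false h (dx (g n)))).
rewrite (int2CA (fun p => f43 (dx (g n) p)) (Zk false k) (Dq false h (dx (g n)))).
rewrite /der -/(A n) -/(B n) in t1 t2 t3 t4.
move: t1 t2 t3 t4 t5; rewrite /L.
set x1 := int2 _; set x2 := int2 _; set x3 := int2 _; set x4 := int2 _; set x5 := int2 _.
set q := quartic _ _; set m := nrm _ ^+ 2; move=> t1 t2 t3 t4 t5 t6.
have t3' : `|lam * (x3 + 2^-1 * m)| <= `|lam| * z by rewrite normrM ler_wpM2l.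
have lz : (7 + `|lam|) * z = e by rewrite /z mulrC divfK// gt_eqF.
rewrite mulrDr in t3'; rewrite mulrDl in lz.
move: t1 t2 t3' t4 t5 t6 lz; clearbody x1 x2 x3 x4 x5 q m z; move: (A n) (B n) => a b.
set y1 := lam * x3; set y2 := `|lam| * z.
have -> : 2^-1 * (lam * m) = lam * (2^-1 * m) by ring.
set y3 := lam * (_ * _); clearbody y1 y2 y3; rewrite !ler_norml.
move=> /andP[? ?] /andP[? ?] /andP[? ?] /andP[? ?] /andP[? ?] /andP[? ?] ?.
by apply/andP; split; lra.
Qed.

(** The second x-derivative of the test function yields 2 A beyond the -A/2 of the shift, hence 3/2.
    Mass and nonlinear terms gain one full term each: -1/2 + 1 = 1/2 and -3/10 + 1 = 7/10. *)
Lemma pohozaev_x (e : R) : 0 < e -> exists N, forall n, (N <= n)%N ->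
  `|3 / 2 * A n - 2^-1 * B n - 2^-1 * L n - 7 / 10 * quartic g n| <= e.
Proof.
move=> e0; apply: eventually3_ex.
have [Cx Cv Cs] := cauchy_components cg gC.
pose z := e / (11 + 2 * `|lam|).
have l7 : 0 < 11 + 2 * `|lam| by rewrite ltr_pwDl// mulr_ge0.
have z0 : 0 < z by rewrite divr_gt0.
have b1 n : nrm (dx (dx (g n))) <= M by have [] := bounds n.
have b2 n : nrm (dy (g n)) <= M by have [] := bounds n.
have b3 n : nrm (dx (g n)) <= M by have [] := bounds n.
have s1 := shift_limit gM true csx Cx b1 z0.
have s2 := shift_limit gM true cv Cv b2 z0.
have s3 := shift_limit gM true cs Cs b3 z0.
have s4 := product_limit gM (d := true) cs Cx b1 z0.
have s5 := product_limit gM (d := true) cg Cs b3 z0.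
have s6 := nonlinear_limit cg gC gM crit true z0.
have s7 := nonlinear_limit_x cg gC gM z0.
have s8 := critical_limit crit (fun k h n _ _ => C0inf_virial true k h n)
  (fun k h n kp hp => NX_virial_x n kp hp) z0.
have M2 : 0 < M ^+ 2 + 1 by rewrite ltr_wpDl// sqr_ge0.
(* The term in which both derivatives fall on the sine is at most k M^2, and disappears with k. *)
have s9 : eventually3 (fun k h n => `|int2 (fun p => dx (dx (g n)) p *
    (uk true k p * Dq true h (g n) p))| <= z).
  exists (z / (M ^+ 2 + 1)); first by rewrite divr_gt0.
  move=> k k0 kz; exists 1 => // h h0 h1; exists 0%N => n _.
  apply: le_trans (CS (C0inf_Cc (csx n)) (CcuD true k h (C0inf_Cc (cg n)))) _.
  have n6 := @nrm_uk_Dq true k h (g n) (cg n) (b3 n) k0 h0.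
  apply: (@le_trans _ _ (M * (k * M))); first by apply: ler_pM; rewrite ?nrm_ge0.
  have -> : M * (k * M) = k * M ^+ 2 by ring.
  apply: (@le_trans _ _ (z / (M ^+ 2 + 1) * (M ^+ 2 + 1))); last by rewrite divfK// gt_eqF.
  by apply: ler_pM => //; [exact: ltW|exact: sqr_ge0|exact: ltW|rewrite lerDl].
apply: eventually3_mono (eventually3_and s1 (eventually3_and s2 (eventually3_and s3
  (eventually3_and s4 (eventually3_and s5 (eventually3_and s6 (eventually3_and s7
  (eventually3_and s8 s9)))))))) _.
move=> k h n k0 h0 h1 [t1 [t2 [t3 [t4 [t5 [t6 [t7 [t8 t9]]]]]]]].
move: t8; rewrite /dJ dxx_virial_x// dx_virial_x// dy_virial_x.
have cx u := C0inf_Cc (csx u); have cc u := C0inf_Cc (cs u).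
have c1 : Cc (fun p => dx (dx (g n)) p * (uk true k p * Dq true h (g n) p)).
  by apply: CcMl; [exact: cx|exact/Cc_continuous/CcuD/C0inf_Cc].
have c2 : Cc (fun p => dx (dx (g n)) p * (wk true k p * Dq true h (dx (g n)) p)).
  by apply: CcMl; [exact: cx|exact/Cc_continuous/CcwD/cc].
have c3 : Cc (fun p => dx (dx (g n)) p * (Zk true k p * Dq true h (dx (dx (g n))) p)).
  by apply: CcMl; [exact: cx|exact/Cc_continuous/CcZD/cx].
have c4 : Cc (fun p => dx (g n) p * (wk true k p * Dq true h (g n) p)).
  by apply: CcMl; [exact: cc|exact/Cc_continuous/CcwD/C0inf_Cc].
have c5 : Cc (fun p => dx (g n) p * (Zk true k p * Dq true h (dx (g n)) p)).
  by apply: CcMl; [exact: cc|exact/Cc_continuous/CcZD/cc].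
have c6 : Cc (fun p => f43 (dx (g n) p) * (wk true k p * Dq true h (g n) p)).
  by apply: CcMl; [exact/Cc_f43/cc|exact/Cc_continuous/CcwD/C0inf_Cc].
have c7 : Cc (fun p => f43 (dx (g n) p) * (Zk true k p * Dq true h (dx (g n)) p)).
  by apply: CcMl; [exact/Cc_f43/cc|exact/Cc_continuous/CcZD/cc].
have -> : (fun p => dx (dx (g n)) p * (uk true k p * Dq true h (g n) p +
    2 * (wk true k p * Dq true h (dx (g n)) p) + Zk true k p * Dq true h (dx (dx (g n))) p)) =
  (fun p => dx (dx (g n)) p * (uk true k p * Dq true h (g n) p) +
    2 * (dx (dx (g n)) p * (wk true k p * Dq true h (dx (g n)) p)) +
    dx (dx (g n)) p * (Zk true k p * Dq true h (dx (dx (g n))) p)).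
  by apply/funext => p; ring.
have -> : (fun p => dx (g n) p * (wk true k p * Dq true h (g n) p +
    Zk true k p * Dq true h (dx (g n)) p)) =
  (fun p => dx (g n) p * (wk true k p * Dq true h (g n) p) +
    dx (g n) p * (Zk true k p * Dq true h (dx (g n)) p)).
  by apply/funext => p; ring.
have -> : (fun p => f43 (dx (g n) p) * (wk true k p * Dq true h (g n) p +
    Zk true k p * Dq true h (dx (g n)) p)) =
  (fun p => f43 (dx (g n) p) * (wk true k p * Dq true h (g n) p) +
    f43 (dx (g n) p) * (Zk true k p * Dq true h (dx (g n)) p)).
  by apply/funext => p; ring.
rewrite (int2D (CcD c1 (CcZ 2 c2)) c3) (int2D c1 (CcZ 2 c2)) (int2Z 2 c2) (int2D c4 c5) (int2D c6 c7).
move: t9; set x0 := int2 _ => t9.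
rewrite (int2CA (dx (dx (g n))) (wk true k) (Dq true h (dx (g n)))).
rewrite (int2CA (dx (dx (g n))) (Zk true k) (Dq true h (dx (dx (g n))))).
rewrite (int2CA (dy (g n)) (Zk true k) (Dq true h (dy (g n)))).
rewrite (int2CA (dx (g n)) (wk true k) (Dq true h (g n))).
rewrite (int2CA (dx (g n)) (Zk true k) (Dq true h (dx (g n)))).
rewrite (int2CA (fun p => f43 (dx (g n) p)) (wk true k) (Dq true h (g n))).
rewrite (int2CA (fun p => f43 (dx (g n) p)) (Zk true k) (Dq true h (dx (g n)))).
rewrite /der -/(A n) -/(B n) in t1 t2 t3 t4 t5 t6 t7.
move: t1 t2 t3 t4 t5 t6 t7; rewrite /L.
set x1 := int2 _; set x2 := int2 _; set x3 := int2 _; set x4 := int2 _; set x5 := int2 _.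
set x6 := int2 _; set q := quartic _ _; set x7 := int2 _; set m := nrm (dx (g n)) ^+ 2.
move=> t1 t2 t3 t4 t5 t6 t7 t8.
have t3' : `|lam * (x3 + 2^-1 * m)| <= `|lam| * z by rewrite normrM ler_wpM2l.
have t5' : `|lam * (x5 - m)| <= `|lam| * z by rewrite normrM ler_wpM2l.
have lz : (11 + 2 * `|lam|) * z = e by rewrite /z mulrC divfK// gt_eqF.
rewrite mulrDr in t3'; rewrite mulrBr in t5'; rewrite mulrDl -mulrA in lz; rewrite mulrDr in t8.
move: t1 t2 t3' t4 t5' t6 t7 t8 t9 lz; clearbody x0 x1 x2 x3 x4 x5 x6 x7 q m z; move: (A n) (B n) => a b.
have -> : lam * (2^-1 * m) = 2^-1 * (lam * m) by ring.
set y1 := lam * x3; set y2 := `|lam| * z; set y3 := lam * m; set y4 := lam * x5.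
clearbody y1 y2 y3 y4; rewrite !ler_norml.
move=> /andP[? ?] /andP[? ?] /andP[? ?] /andP[? ?] /andP[? ?] /andP[? ?] /andP[? ?] /andP[? ?] /andP[? ?] ?.
by apply/andP; split; lra.
Qed.

End Conclusion.

(** * Small mass *)
Section Final.
Context {R : realType}.

Lemma quartic_le (g : nat -> R * R -> R) n (del : R) : C0inf (g n) -> 0 < del ->
  quartic g n <= (nrm (dx (dx (g n))) ^+ 2 + nrm (dy (g n)) ^+ 2 + del) *
    (4 * nrm (dx (g n)) + nrm (dx (g n)) ^+ 2).
Proof.
move=> cg d0; have cs := C0inf_dx cg.
set A := nrm (dx (dx (g n))); set B := nrm (dy (g n)); set m := nrm (dx (g n)).
have A0 : 0 <= A := nrm_ge0 _; have B0 : 0 <= B := nrm_ge0 _; have m0 : 0 <= m := nrm_ge0 _.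
set E := A ^+ 2 + B ^+ 2 + del.
have A2 := sqr_ge0 A; have B2 := sqr_ge0 B.
have E0 : 0 < E by rewrite /E; lra.
(* [trilinear] is applied with parameter 1/S, which gives both of its terms the common factor S^2;
   [del] keeps S positive. *)
pose S := Num.sqrt E; have S0 : 0 < S by rewrite sqrtr_gt0.
have SE : S ^+ 2 = E by rewrite sqr_sqrtr// ltW.
have le_S x : 0 <= x -> x ^+ 2 <= E -> x <= S.
  by move=> x0 xE; rewrite -(ger0_norm x0) -sqrtr_sqr ler_wsqrtr.
have AS : A <= S by apply: le_S => //; rewrite /E; lra.
have BS : B <= S by apply: le_S => //; rewrite /E; lra.
have iS : 0 < S^-1 by rewrite invr_gt0.
have := trilinear cg (C0inf_Cc cs) (C0inf_Cc (C0inf_dx cs)) (dx_dX (C0inf_smooth cs)) iS.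
rewrite -/A -/B -/m invrK SE => /le_trans; apply.
rewrite mulrDr; apply: lerD => //.
apply: (@le_trans _ _ (S^-1 * (4 * (S * S * (m * S))))).
  rewrite ler_pM2l// ler_pM2l//; apply: ler_pM; rewrite ?mulr_ge0//; first exact: ler_pM.
  exact: ler_wpM2l.
rewrite -SE le_eqVlt; apply/orP; left; apply/eqP; field; by rewrite gt_eqF.
Qed.

Lemma no_small_critical_sequence (g : nat -> R * R -> R) (lam M a : R) :
  (forall n, C0inf (g n)) -> cauchyX g -> (forall n, NX (g n) <= M) ->
  (forall e : R, 0 < e -> exists N, forall n, (N <= n)%N ->
    forall psi, C0inf psi -> `|dJ lam (g n) psi| <= e * NX psi) ->
  0 < a -> a <= 10^-1 -> nrm (dx (g n)) ^+ 2 @[n --> \oo] --> a ^+ 2 -> False.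
Proof.
move=> cg gC gM crit a0 a1 ga.
have a2 : 0 < a ^+ 2 by rewrite exprn_gt0.
have near_a : exists N, forall n, (N <= n)%N -> `|nrm (dx (g n)) ^+ 2 - a ^+ 2| <= a ^+ 2 / 8.
  have a8 : 0 < a ^+ 2 / 8 by rewrite divr_gt0.
  have /cvgrPdist_le/(_ _ a8)[N _ HN] := ga; exists N => n Nn; rewrite distrC; exact: HN.
(* With a <= 1/10 the squared norm is at most 9/8 * 1/100 < 1/81. The bound 1/10 is convenient
   rather than sharp: the factor 4 m + m^2 only has to stay below 5/3. *)
have m_le n : `|nrm (dx (g n)) ^+ 2 - a ^+ 2| <= a ^+ 2 / 8 ->
    nrm (dx (g n)) <= 1 / 9.
  rewrite ler_norml => /andP[_ h].
  have a3 : a ^+ 2 <= 10^-1 ^+ 2 by rewrite !expr2; apply: ler_pM => //; exact: ltW.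
  have h9 : nrm (dx (g n)) ^+ 2 <= (1 / 9) ^+ 2.
    have t1 : 10^-1 ^+ 2 = 1 / 100 :> R by field.
    have t2 : (1 / 9) ^+ 2 = 1 / 81 :> R by field.
    by rewrite t1 in a3; rewrite t2; lra.
  by rewrite ler_pXn2r ?nnegrE ?nrm_ge0 in h9.
have energy (e : R) : 0 < e -> exists N, forall n, (N <= n)%N ->
    nrm (dx (dx (g n))) ^+ 2 + nrm (dy (g n)) ^+ 2 <= e.
  (* Half of [nehari], twice [pohozaev_y] and [pohozaev_x] add up to A + B - 3/5 Q, with total error
     at most 7/2 * e/14 = e/4. *)
  move=> e0; have e7 : 0 < e / 14 by rewrite divr_gt0.
  have [N1 H1] := nehari cg gM crit e7.
  have [N2 H2] := pohozaev_y cg gC gM crit e7.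
  have [N3 H3] := pohozaev_x cg gC gM crit e7.
  have [N4 H4] := near_a.
  exists (maxn (maxn N1 N2) (maxn N3 N4)) => n.
  rewrite !geq_max => /andP[/andP[n1 n2] /andP[n3 n4]].
  have := H1 n n1; have := H2 n n2; have := H3 n n3; have := m_le n (H4 n n4).
  have := quartic_le (cg n) e0; have m0 := nrm_ge0 (dx (g n)).
  have A2 := sqr_ge0 (nrm (dx (dx (g n)))); have B2 := sqr_ge0 (nrm (dy (g n))).
  move: A2 B2; set A := nrm (dx (dx _)) ^+ 2; set B := nrm (dy _) ^+ 2.
  set L := lam * _; set Q := quartic _ _; set m := nrm _ in m0 *.
  clearbody A B L Q m => A2 B2 hQ hm.
  rewrite !ler_norml => /andP[? ?] /andP[? ?] /andP[? ?].
  have m2 : m ^+ 2 <= 1 / 81.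
    have -> : 1 / 81 = (1 / 9) ^+ 2 :> R by field.
    by rewrite ler_pXn2r ?nnegrE.
  (* 4/9 + 1/81 < 1/2, so A + B is at most 3/10 (A + B + e) + e/4, hence below e. *)
  have hQ' : Q <= (A + B + e) * (1 / 2).
    by apply: le_trans hQ _; apply: ler_wpM2l; lra.
  lra.
have aq : 0 < a / 4 by rewrite divr_gt0.
have [_ _ Cs] := cauchy_components cg gC.
have [N1 H1] := Cs _ aq; have [N2 H2] := near_a.
(* [N1] is fixed before the energy is made small, because the required smallness depends on the norm
   of [g N1], which has no bound along the sequence. *)
pose G := nrm (g N1) + 1; have G0 : 0 < G by rewrite ltr_wpDl// nrm_ge0.
have eG : 0 < (a ^+ 2 / 8 / G) ^+ 2 by rewrite exprn_gt0// !divr_gt0.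
have [N3 H3] := energy _ eG.
pose n := maxn N1 (maxn N2 N3).
have n1 : (N1 <= n)%N by rewrite leq_maxl.
have n2 : (N2 <= n)%N by rewrite /n (leq_trans _ (leq_maxr _ _))// leq_maxl.
have n3 : (N3 <= n)%N by rewrite /n (leq_trans _ (leq_maxr _ _))// leq_maxr.
have cs := C0inf_dx (cg n); have cx := C0inf_dx cs; have cN := C0inf_dx (cg N1).
have p1 := Cc_prod cx (cg N1); have p2 := Cc_prod cs cN; have p3 := Cc_prod cs (C0infB cs cN).
have by_parts : int2 (fun p => dx (dx (g n)) p * g N1 p) + int2 (fun p => dx (g n) p * dx (g N1) p) = 0.
  rewrite -(int2D p1 p2); apply: int2_dX (Cc_prod cs (cg N1)) (CcD p1 p2) _.
  exact: dX_M (dx_dX (C0inf_smooth cs)) (dx_dX (C0inf_smooth (cg N1))).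
have split_m : nrm (dx (g n)) ^+ 2 = int2 (fun p => dx (g n) p * dx (g N1) p) +
    int2 (fun p => dx (g n) p * (dx (g n) p - dx (g N1) p)).
  by rewrite nrm_sqr -(int2D p2 p3); congr int2; apply/funext => p; ring.
have h1 : `|int2 (fun p => dx (g n) p * (dx (g n) p - dx (g N1) p))| <= nrm (dx (g n)) * (a / 4).
  apply: le_trans (CS (C0inf_Cc cs) (C0inf_Cc (C0infB cs cN))) _.
  by apply: ler_wpM2l; [exact: nrm_ge0|exact: H1].
have h2 : `|int2 (fun p => dx (dx (g n)) p * g N1 p)| <= a ^+ 2 / 8.
  apply: le_trans (CS (C0inf_Cc cx) (C0inf_Cc (cg N1))) _.
  apply: (@le_trans _ _ (a ^+ 2 / 8 / G * G)); last by rewrite divfK// gt_eqF.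
  apply: ler_pM; rewrite ?nrm_ge0//; last by rewrite lerDl.
  have h := H3 n n3; have B2 := sqr_ge0 (nrm (dy (g n))).
  rewrite -(@ler_pXn2r _ 2) ?nnegrE ?nrm_ge0//; last by rewrite !divr_ge0 ?sqr_ge0// ltW.
  by apply: le_trans h; rewrite lerDl.
have h3 := H2 n n2.
have m0 := nrm_ge0 (dx (g n)).
move: by_parts split_m h1 h2 h3 m0; set x := int2 _; set y := int2 _; set z := int2 _.
set m := nrm _; clearbody x y z m => e1 e2; rewrite !ler_norml.
move=> /andP[? ?] /andP[? ?] /andP[? ?] m0.
(* With this, 3/4 m^2 <= a^2/8 + a^2/16, so m^2 <= a^2/4, against m^2 >= 7/8 a^2. *)
have k : m * (a / 4) <= m ^+ 2 / 4 + a ^+ 2 / 16.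
  have := sqr_ge0 (m - a / 2); have -> : (m - a / 2) ^+ 2 = 4 * (m ^+ 2 / 4 + a ^+ 2 / 16 - m * (a / 4)) by field.
  by rewrite pmulr_rge0// subr_ge0.
lra.
Qed.

End Final.

Theorem theorem1p2 (R : realType) :
  exists astar : R, 0 < astar /\
    forall a : R, 0 < a -> a <= astar ->
      forall (u : R * R -> R) (lam : R), ~ weak_solution (@f43 R) a u lam.
Proof.
exists 10^-1; split; first by rewrite invr_gt0.
move=> a a0 a1 u lam /weak_critical[g [cg gC [M gM] ga crit]].
exact: (no_small_critical_sequence cg gC gM crit a0 a1 ga).
Qed.
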